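(* Let $F(x,y)\in\mathbb{Z}[x,y]$ be an irreducible binary form of degree $n\geq 3$ and discriminant $D$. Let $\epsilon$ be a real number with $0<\epsilon<\frac{1}{2(n-1)}$ and let $m$ be an integer with $$0<m\leq \frac{|D|^{\frac{1}{2(n-1)}-\epsilon}}{(3.5)^{n/2}\, n^{\frac{n}{2(n-1)}}}.$$ Then the equation $|F(x,y)|=m$ has at most $7n+\frac{n}{(n-1)\epsilon}$ primitive solutions if $n\geq 5$, and at most $9n+\frac{n}{(n-1)\epsilon}$ primitive solutions if $n=3,4$. If in addition the polynomial $F(X,1)$ has exactly $2q$ non-real roots, then the number of primitive solutions does not exceed $7n-12q+\frac{n-q}{(n-1)\epsilon}$ if $n\geq 5$, and $9n-16q+\frac{n-q}{(n-1)\epsilon}$ if $n=3,4$.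
   Context: A pair $(x,y)\in\mathbb{Z}^2$ is a primitive solution of an equation in $x,y$ if it satisfies it and $\gcd(x,y)=1$. Solutions $(x,y)$ and $(-x,-y)$ are regarded as one and the same solution when counting. *)

(* Defs.v *)
From mathcomp Require Import all_boot all_order all_algebra.
From mathcomp Require Import complex mpoly.
From mathcomp Require Import classical_sets functions cardinality reals.

Set Implicit Arguments.
Unset Strict Implicit.
Unset Printing Implicit Defensive.

Import Order.TTheory GRing.Theory Num.Theory.
Local Open Scope classical_set_scope.
Local Open Scope card_scope.
Local Open Scope ring_scope.

Definition irreducible_elt (A : unitRingType) (p : A) : Prop :=
  [/\ p != 0, p \isn't a GRing.unit &
      forall a b : A, p = a * b ->
        (a \is a GRing.unit) || (b \is a GRing.unit)].

(* A binary form of degree n over the integers, irreducible over the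
   rationals; its content is not required to be 1. *)
Definition irreducible_binary_form (n : nat) (F : {mpoly int[2]}) : Prop :=
  F \is n.-homog /\ irreducible_elt (map_mpoly (intr : int -> rat) F).

(* D is the discriminant of F: if F factors over the complex numbers as
   prod_i (a_i x - b_i y), then D = prod_(i < j) (a_i b_j - a_j b_i)^2.
   This value does not depend on the chosen factorization. *)
Definition is_discriminant (R : realType) (n : nat) (F : {mpoly int[2]})
    (D : int) : Prop :=
  exists a b : 'I_n -> R[i],
    map_mpoly (intr : int -> R[i]) F
      = \prod_(i < n) (a i *: 'X_(0 : 'I_2) - b i *: 'X_(1 : 'I_2)) /\
    D%:~R = \prod_(i < n) \prod_(j < n | (i < j)%N)
              (a i * b j - a j * b i) ^+ 2.

Definition dehomogenize (F : {mpoly int[2]}) : {poly int} :=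
  mmap (polyC : int -> {poly int}) (tnth [tuple 'X; 1]) F.

Definition nonreal_roots (R : realType) (f : {poly int}) : set R[i] :=
  [set z | root (map_poly (intr : int -> R[i]) f) z /\ z \isn't Num.real].
Arguments nonreal_roots R f : clear implicits.

Definition primitive_solutions (F : {mpoly int[2]}) (m : int)
    : set (int * int) :=
  [set v | `|F.@[tnth [tuple v.1; v.2]]| = m /\ gcdz v.1 v.2 = 1].

(* Solutions up to sign: (x, y) and (- x, - y) yield the same pair. *)
Definition solution_classes (F : {mpoly int[2]}) (m : int)
    : set (set (int * int)) :=
  [set [set v; (- v.1, - v.2)] | v in primitive_solutions F m].

Definition card_at_most (R : realType) (T : Type) (A : set T) (B : R) : Prop :=
  exists2 k : nat, A #= `I_k & k%:R <= B.

(* Main.v *)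
(** Factor [F = prod_i L_i] over the complex numbers, [L_i = a_i x - b_i y].

    For [n >= 4], act by [GL2(Z)] so that the height [exp eta = prod_i max(t |a_i|, |b_i| / t)],
    [t^2 = 5/2], is within a factor [19/10] of its infimum.  Hadamard's inequality bounds
    [eta] below by [l0 = (ln |D| - n ln n) / (2 (n - 1))], and the hypothesis on [m] reads
    [ln m <= (1 - e) l0 - (n / 2) ln (7/2)] with [e = 2 (n - 1) eps].  A primitive solution
    can be completed to a basis, so near-minimality forces it to approximate the roots with
    total gain at least [e eta]; since consecutive approximations of one root grow by their
    gain, at most [2 (r + q) / e] solutions up to a bounded number have height below a fixed
    power of [exp eta] ([r] real roots, [q] pairs of complex ones).  The larger solutions
    attached to one root satisfy a gap principle with exponent [n - 1], and Thue's method
    (auxiliary polynomials by the pigeonhole principle on the conjugates, nonvanishing by the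
    Wronskian) leaves at most 6, for [n = 4] at most 8, of them for each real root.

    For [n = 3] the three forms [M_i = det(L_j, L_k) L_i] have sum [0] and are covariant, so
    no reduction is needed.  The forms [u = w^2 M_1 - M_2], [v = w M_1 - M_2] diagonalize [F]:
    [u^3 - v^3] is [F] up to a constant, and [u^3 + v^3] and the polarization of [u v] have
    integer coefficients.  Approximating the cube root of [(u/v)^3] near [1] by polynomials built with the
    pigeonhole principle, whose coefficients do not depend on [F], bounds the number of
    solutions attached to a real root by [8 + 2 / e]. *)

(* For [n >= 4] a real root is charged with one small solution, the last of its chain, and with the
   large ones; a conjugate pair is charged with one of each kind. So [n >= 5] gives
   [7 r + 2 q = 7 n - 12 q], [n = 4] gives [9 r + 2 q = 9 n - 16 q], and the bounds without [q] are
   weaker. All arithmetic enters through one property of the roots, [norm_integral]: an integer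
   polynomial whose values at all roots have a small enough product vanishes at all of them. It
   survives a change of basis of determinant 1, so the form can be reduced without returning to [F].
   The constant [7 / 2] is [5 / 2] times [7 / 5]. The first factor is [t^2], the loss per linear
   factor when a solution is completed to a basis; powers of the second pay for the factor [19 / 10]
   of near-minimality, since [19 / 10 <= (7 / 5)^2], and this takes [n >= 4]. Thue's method closes
   with a margin whose leading coefficient is [nu^2 - 491/500 nu - 103/50], where [nu = n - 1]. It
   is negative at [nu = 2], which is why cubic forms need auxiliary polynomials whose height is
   independent of the form. *)
Require Import Defs.
From mathcomp Require Import all_boot all_order all_algebra.
From mathcomp Require Import complex mpoly.
From mathcomp Require Import finmap.
From mathcomp Require Import boolp classical_sets functions cardinality reals exp.
From mathcomp Require Import ring lra zify.

Set Implicit Arguments.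
Unset Strict Implicit.
Unset Printing Implicit Defensive.

Import Order.TTheory GRing.Theory Num.Theory.
Local Open Scope classical_set_scope.
Local Open Scope card_scope.
Local Open Scope ring_scope.

Local Notation expR := sequences.expR.

(** * Moduli, logarithms and Hadamard's inequality *)

Section Modulus.
Variable R : realType.
Local Notation C := R[i].
Implicit Types (x y z : C).

(** The norm of [R[i]] takes values in [R[i]]; logarithms need the modulus as an element of [R]. *)
Definition cn z : R := complex.Re `|z|.

Lemma cnE z : `|z| = (cn z)%:C%C.
Proof. by rewrite /cn normc_def. Qed.

Lemma realC_inj : injective (fun t : R => t%:C%C).
Proof. by move=> s t []. Qed.

Lemma realC_le (s t : R) : (s%:C%C <= t%:C%C) = (s <= t).
Proof. by rewrite lecE /= eqxx. Qed.

Lemma cn_ge0 z : 0 <= cn z.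
Proof. by rewrite -realC_le -cnE normr_ge0. Qed.

Lemma cnM z1 z2 : cn (z1 * z2) = cn z1 * cn z2.
Proof. by apply: realC_inj; rewrite rmorphM /= -!cnE normrM. Qed.

Lemma cnN z : cn (- z) = cn z.
Proof. by rewrite /cn normrN. Qed.

Lemma cnD z1 z2 : cn (z1 + z2) <= cn z1 + cn z2.
Proof. by rewrite -realC_le rmorphD /= -!cnE ler_normD. Qed.

Lemma cnB z1 z2 : cn (z1 - z2) <= cn z1 + cn z2.
Proof. by rewrite (le_trans (cnD _ _)) // cnN. Qed.

Lemma cn_dist z1 z2 : cn (z1 - z2) = cn (z2 - z1).
Proof. by rewrite -cnN opprB. Qed.

Lemma cn_real (t : R) : cn t%:C%C = `|t|.
Proof.
by rewrite /cn normc_def /= expr0n /= addr0 sqrtr_sqr.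
Qed.

Lemma cn0 : cn 0 = 0.
Proof. by rewrite /cn normr0. Qed.

Lemma cn1 : cn 1 = 1.
Proof. by rewrite /cn normr1. Qed.

Lemma cn_eq0 z : (cn z == 0) = (z == 0).
Proof. by rewrite -[z == 0]normr_eq0 cnE (inj_eq realC_inj _ 0). Qed.

Lemma cn_gt0 z : (0 < cn z) = (z != 0).
Proof. by rewrite lt_def cn_ge0 andbT cn_eq0. Qed.

Lemma cnV z : cn z^-1 = (cn z)^-1.
Proof. by apply: realC_inj; rewrite fmorphV /= -!cnE normfV. Qed.

Lemma cnX z k : cn (z ^+ k) = cn z ^+ k.
Proof. by elim: k => [|k IH]; rewrite ?cn1 // !exprS cnM IH. Qed.

Lemma cn_prod (I : Type) (r : seq I) (P : pred I) (f : I -> C) :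
  cn (\prod_(i <- r | P i) f i) = \prod_(i <- r | P i) cn (f i).
Proof. by apply: (big_morph cn cnM cn1). Qed.

Lemma cn_sum (I : Type) (r : seq I) (P : pred I) (f : I -> C) :
  cn (\sum_(i <- r | P i) f i) <= \sum_(i <- r | P i) cn (f i).
Proof.
elim/big_ind2: _ => [|x1 x2 y1 y2 h1 h2|//]; first by rewrite cn0.
by rewrite (le_trans (cnD _ _)) // lerD.
Qed.

Lemma cn_int (k : int) : cn k%:~R = `|k|%:~R.
Proof.
have -> : (k%:~R : C) = (k%:~R : R)%:C%C by rewrite rmorph_int.
by rewrite cn_real intr_norm.
Qed.

Lemma cn_nat (k : nat) : cn k%:R = k%:R.
Proof. by rewrite (cn_int k). Qed.

Lemma cn_conj z : cn (z^*)%C = cn z.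
Proof. by rewrite /cn normcJ. Qed.

Lemma cn_Re z : `|complex.Re z| <= cn z.
Proof. by rewrite -realC_le -cnE normc_ge_Re. Qed.

Lemma cn_Im z : `|complex.Im z| <= cn z.
Proof.
by rewrite -[complex.Im z]opprK -ReiNIm normrN (le_trans (cn_Re _)) // cnM
  (_ : cn 'i%C = 1) ?mulr1 // /cn normc_def /= expr0n /= add0r expr1n sqrtr1.
Qed.

Lemma cn_le_ReIm z : cn z <= `|complex.Re z| + `|complex.Im z|.
Proof.
rewrite {1}[z]complexE (le_trans (cnD _ _)) // cnM !cn_real.
by rewrite (_ : cn 'i%C = 1) ?mul1r // /cn normc_def /= expr0n /= add0r expr1n
  sqrtr1.
Qed.

End Modulus.

Section LogFacts.
Variable R : realType.
Implicit Types x y : R.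

Lemma ln_prod (I : Type) (r : seq I) (P : pred I) (f : I -> R) :
  (forall i, P i -> 0 < f i) ->
  ln (\prod_(i <- r | P i) f i) = \sum_(i <- r | P i) ln (f i).
Proof.
move=> f0.
have [] : 0 < \prod_(i <- r | P i) f i /\
   ln (\prod_(i <- r | P i) f i) = \sum_(i <- r | P i) ln (f i); last by [].
elim/big_ind2: _ => [|x1 x2 y1 y2 [h1 e1] [h2 e2]|i Pi].
- by rewrite ltr01 ln1.
- by rewrite mulr_gt0 // lnM ?posrE // e1 e2.
- by rewrite f0.
Qed.

Lemma le_ln x y : 0 < x -> x <= y -> ln x <= ln y.
Proof. by move=> x0 xy; rewrite ler_ln ?posrE // (lt_le_trans x0). Qed.

Lemma lnMp x y : 0 < x -> 0 < y -> ln (x * y) = ln x + ln y.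
Proof. by move=> x0 y0; rewrite lnM ?posrE. Qed.

Lemma lnDiv x y : 0 < x -> 0 < y -> ln (x / y) = ln x - ln y.
Proof. by move=> x0 y0; rewrite ln_div ?posrE. Qed.

Lemma lnX x k : 0 < x -> ln (x ^+ k) = k%:R * ln x.
Proof. by move=> x0; rewrite lnXn // mulr_natl. Qed.

End LogFacts.

Section Hadamard.
Variable C : numClosedFieldType.

(** Gram-Schmidt writes [A = L B] with [B] unitary and [L] lower triangular: the determinant has the
    modulus of the product of the diagonal of [L], and the rows of [L] are as long as those of
    [A]. *)
Lemma hadamard_schmidt n (A : 'M[C]_n) :
  `|\det A| ^+ 2 <= \prod_(i < n) \sum_(j < n) `|A i j| ^+ 2.
Proof.
pose B := schmidt A; have Bu : B \is unitarymx by apply: schmidt_unitarymx.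
pose L := A *m B ^t*%sesqui.
have BB : B *m B ^t*%sesqui = 1%:M by apply/unitarymxP.
have BB' : B ^t*%sesqui *m B = 1%:M by apply: mulmx1C.
have AE : A = L *m B by rewrite /L -mulmxA BB' mulmx1.
have L0 (i j : 'I_n) : (i < j)%N -> L i j = 0.
  move=> lt_ij.
  have : (row i A <= kermx ((row j B) ^t*%sesqui))%MS.
    apply: (submx_trans (row_schmidt_sub A i)).
    apply/sumsmx_subP => k le_ki; rewrite genmxE; apply/sub_kermxP.
    have /row_unitarymxP /(_ k j) := Bu.
    rewrite dotmxE => h; apply/matrixP => u v; rewrite !ord1 h mxE.
    case: eqP => // kj; move: le_ki; rewrite kj leqNgt lt_ij //.
  move/sub_kermxP => /matrixP /(_ 0 0); rewrite !mxE => e.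
  rewrite -[RHS]e; apply: eq_bigr => k _.
  by rewrite !mxE.
have trigL : is_trig_mx L by apply/is_trig_mxP => i j; apply: L0.
have dB : `|\det B| = 1.
  have := congr1 determinant BB; rewrite det_mulmx det1 det_map_mx det_tr => h.
  have : `|\det B| ^+ 2 = 1 by rewrite normCK h.
  by move/eqP; rewrite sqrp_eq1 ?normr_ge0 // => /eqP.
rewrite {1}AE det_mulmx normrM dB mulr1 det_trig // normr_prod -prodrXl.
apply: ler_prod => i _; rewrite exprn_ge0 //=.
have -> : \sum_(j < n) `|A i j| ^+ 2 = (A *m A ^t*%sesqui) i i.
  by rewrite mxE; apply: eq_bigr => j _; rewrite !mxE normCK.
have -> : A *m A ^t*%sesqui = L *m L ^t*%sesqui.
  rewrite /L [in RHS]trmx_mul map_mxM /= trmxCK mulmxA -(mulmxA A) BB'.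
  by rewrite mulmx1.
have -> : (L *m L ^t*%sesqui) i i = \sum_(j < n) `|L i j| ^+ 2.
  by rewrite mxE; apply: eq_bigr => j _; rewrite normCK; congr (_ * _);
     rewrite mxE; congr (_^*); exact: mxE.
by rewrite (bigD1 i) //= lerDl sumr_ge0 // => j _; rewrite exprn_ge0.
Qed.

End Hadamard.

(** * Linear forms: height against discriminant *)

Section LinearForms.
Variable R : realType.
Local Notation C := R[i].

Definition dt n (a b : 'I_n -> C) i j := a i * b j - a j * b i.
Definition ht n (a b : 'I_n -> C) i : R := Num.max (cn (a i)) (cn (b i)).
Definition eta n (a b : 'I_n -> C) : R := \sum_i ln (ht a b i).
(** Ordered pairs count each [dt] twice, which is the square in the discriminant: this is
    [ln |D|]. *)
Definition lnD n (a b : 'I_n -> C) : R :=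
  \sum_i \sum_(j | j != i) ln (cn (dt a b i j)).
Definition ell n (a b : 'I_n -> C) : R :=
  (lnD a b - n%:R * ln n%:R) / (2 * (n%:R - 1)).
Definition lform n (a b : 'I_n -> C) (x y : C) i := a i * x - b i * y.

Lemma dt_anti n (a b : 'I_n -> C) i j : dt a b i j = - dt a b j i.
Proof. by rewrite /dt opprB [in RHS]mulrC [X in _ - X]mulrC; ring. Qed.

Lemma sum_offdiag_sym n (f : 'I_n -> 'I_n -> R) : (forall i j, f i j = f j i) ->
  \sum_i \sum_(j | j != i) f i j = 2 * \sum_(i < n) \sum_(j < n | (i < j)%N) f i j.
Proof.
move=> fC.
have -> : \sum_i \sum_(j | j != i) f i j =
   \sum_(i < n) (\sum_(j < n | (i < j)%N) f i j + \sum_(j < n | (j < i)%N) f i j).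
  apply: eq_bigr => i _; rewrite (bigID (fun j : 'I_n => (i < j)%N)) /=.
  congr (_ + _); apply: eq_bigl => j;
    by rewrite -(inj_eq val_inj); case: ltngtP.
rewrite big_split /= mulr2n mulrDl !mul1r; congr (_ + _).
rewrite [RHS](exchange_big_dep predT) //=.
by apply: eq_bigr => i _; apply: eq_bigr => j _.
Qed.

(** Row [i] is [a i ^+ (n - 1)] times a Vandermonde row in [b i / a i]; the [n - 1] copies of [a i]
    are shared out among the [n - 1] pairs that contain [i]. *)
Lemma det_homogeneous_Vandermonde n (a b : 'I_n -> C) :
  (forall i, a i != 0) ->
  \det (\matrix_(i < n, k < n) (b i ^+ k * a i ^+ (n - 1 - k))) =
  \prod_(i < n) \prod_(j < n | (i < j)%N) dt a b i j.
Proof.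
move=> a0.
have -> : \matrix_(i < n, k < n) (b i ^+ k * a i ^+ (n - 1 - k)) =
  diag_mx (\row_i a i ^+ (n - 1)) *m (Vandermonde n (\row_i (b i / a i)))^T.
  rewrite mul_diag_mx; apply/matrixP => i k; rewrite !mxE.
  have kn : (k <= n - 1)%N by have := ltn_ord k; lia.
  rewrite -[in RHS](subnK kn) exprD expr_div_n mulrAC -!mulrA.
  by rewrite mulVf ?expf_neq0 // mulr1 mulrC.
rewrite det_mulmx det_diag det_tr det_Vandermonde.
have -> : \prod_i (\row_i0 a i0 ^+ (n - 1)) 0 i =
   \prod_(i < n) \prod_(j < n | (i < j)%N) (a i * a j).
  under [RHS]eq_bigr do rewrite big_split /=.
  rewrite big_split /= [X in _ = _ * X](exchange_big_dep predT) //=.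
  rewrite -big_split /=; apply: eq_bigr => i _; rewrite mxE.
  rewrite !prodr_const -exprD; congr (_ ^+ _).
  have := cardC1 i; rewrite card_ord subn1 => <-.
  rewrite -(cardID (fun j : 'I_n => (i < j)%N) (predC1 i)); congr (_ + _)%N;
    apply: eq_card => j; apply/idP/idP; rewrite /in_mem /= -?(inj_eq val_inj) /=
      -?[eqn _ _]/(_ == _); lia.
rewrite -big_split /=; apply: eq_bigr => i _.
rewrite -big_split /=; apply: eq_bigr => j _.
by rewrite !mxE /dt; field; rewrite !a0.
Qed.

Section Bounds.
Variables (n : nat) (a b : 'I_n -> C).
Hypothesis a0 : forall i, a i != 0.

Lemma ht_gt0 i : 0 < ht a b i.
Proof. by rewrite lt_max cn_gt0 a0. Qed.

Lemma cn_a_le i : cn (a i) <= ht a b i. Proof. by rewrite le_max lexx. Qed.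
Lemma cn_b_le i : cn (b i) <= ht a b i. Proof. by rewrite le_max lexx orbT. Qed.

Hypothesis d0 : forall i j, i != j -> dt a b i j != 0.

(** All entries of row [i] of the homogeneous Vandermonde matrix have modulus at most
    [ht a b i ^+ (n - 1)]; then Hadamard's inequality applies. *)
Lemma lnD_le : (0 < n)%N ->
  lnD a b <= n%:R * ln n%:R + 2 * (n%:R - 1) * eta a b.
Proof.
move=> n0.
pose V := \matrix_(i < n, k < n) (b i ^+ k * a i ^+ (n - 1 - k)).
have dV := det_homogeneous_Vandermonde b a0.
have dij0 (i j : 'I_n) : (i < j)%N -> 0 < cn (dt a b i j).
  by move=> ij; rewrite cn_gt0 d0 // neq_ltn ij.
have E : lnD a b = ln (cn (\det V) ^+ 2).
  rewrite /V dV lnX ?cn_prod; last first.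
    by apply: prodr_gt0 => i _; rewrite cn_prod; apply: prodr_gt0 => j; apply: dij0.
  rewrite ln_prod; last first.
    by move=> i _; rewrite cn_prod; apply: prodr_gt0 => j; apply: dij0.
  rewrite /lnD sum_offdiag_sym; last by move=> i j; rewrite dt_anti cnN.
  congr (_ * _); apply: eq_bigr => i _.
  by rewrite cn_prod ln_prod // => j; apply: dij0.
have V0 : 0 < cn (\det V).
  by rewrite /V dV cn_prod; apply: prodr_gt0 => i _; rewrite cn_prod;
     apply: prodr_gt0 => j; apply: dij0.
have H : cn (\det V) ^+ 2 <= \prod_(i < n) (n%:R * (ht a b i ^+ 2) ^+ (n - 1)).
  rewrite -realC_le rmorphXn /= -cnE rmorph_prod /=.
  apply: (le_trans (hadamard_schmidt V)); apply: ler_prod => i _.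
  rewrite sumr_ge0 //=; last by move=> j _; rewrite exprn_ge0.
  have -> : \sum_j `|V i j| ^+ 2 = (\sum_j cn (V i j) ^+ 2)%:C%C.
    by rewrite rmorph_sum /=; apply: eq_bigr => j _; rewrite cnE rmorphXn.
  rewrite realC_le; apply: (@le_trans _ _ (\sum_(j < n) (ht a b i ^+ 2) ^+ (n - 1))).
    apply: ler_sum => j _; rewrite mxE cnM !cnX -exprM [(2 * _)%N]mulnC exprM.
    apply: lerXn2r; rewrite ?nnegrE ?mulr_ge0 ?exprn_ge0 ?cn_ge0 ?(ltW (ht_gt0 _)) //.
    have {2}-> : (n - 1)%N = (j + (n - 1 - j))%N by have := ltn_ord j; lia.
    rewrite exprD; apply: ler_pM; rewrite ?exprn_ge0 ?cn_ge0 //;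
      by apply: lerXn2r; rewrite ?nnegrE ?cn_ge0 ?(ltW (ht_gt0 _)) ?cn_a_le ?cn_b_le.
  by rewrite sumr_const card_ord mulr_natl.
rewrite E (le_trans (le_ln _ H)) ?exprn_gt0 //.
have h2 i : 0 < ht a b i ^+ 2 ^+ (n - 1) by rewrite !exprn_gt0 ?ht_gt0.
rewrite ln_prod; last by move=> i _; rewrite mulr_gt0 ?ltr0n.
rewrite /eta mulr_sumr -[n in n%:R * ln n%:R]card_ord.
rewrite mulr_natl -sumr_const -big_split /=; apply: ler_sum => i _.
rewrite lnMp ?ltr0n // lnX ?exprn_gt0 ?ht_gt0 // lnX ?ht_gt0 //.
rewrite natrB // card_ord; lra.
Qed.

Lemma ell_le_eta : (1 < n)%N -> ell a b <= eta a b.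
Proof.
move=> n1; have := lnD_le (ltnW n1).
have n1' : (1 : R) < n%:R by rewrite ltr1n.
by rewrite /ell ler_pdivrMr; [nra|lra].
Qed.

End Bounds.

Section Argmin.
Variables (n : nat) (a b : 'I_n -> C).
Hypothesis a0 : forall i, a i != 0.
Hypothesis d0 : forall i j, i != j -> dt a b i j != 0.
Hypothesis n1 : (1 < n)%N.

Let A := ht a b.
Let A0 i : 0 < A i := ht_gt0 b a0 i.

Definition lnP i : R := \sum_(j | j != i) (ln (cn (dt a b i j)) - ln (A i) - ln (A j)).

Let n1' : (1 : R) < n%:R. Proof. by rewrite ltr1n. Qed.

Lemma cardC1R (i : 'I_n) (t : R) : \sum_(j < n | j != i) t = (n%:R - 1) * t.
Proof.
rewrite sumr_const (_ : #|_| = n.-1); last by have := cardC1 i; rewrite card_ord.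
have -> : n.-1 = (n - 1)%N by rewrite subn1.
by rewrite -[t *+ _]mulr_natl natrB // ltnW.
Qed.

Lemma lnD_lift i : lnD a b =
  2 * \sum_(j | j != i) ln (cn (dt a b i j)) + lnD (a \o lift i) (b \o lift i).
Proof.
have E : \sum_(j | j != i) ln (cn (dt a b i j)) =
   \sum_(j < n.-1) ln (cn (dt a b i (lift i j))).
  rewrite big_mkcond (bigD1_ord i) //= eqxx add0r.
  by apply: eq_bigr => j _; rewrite eq_sym neq_lift.
rewrite /lnD (bigD1_ord i) //= mulr2n mulrDl !mul1r -addrA; congr (_ + _).
rewrite E -big_split /=; apply: eq_bigr => j _.
rewrite (bigD1_ord i) ?neq_lift //= dt_anti cnN; congr (_ + _).
by apply: eq_big => [k|//]; rewrite (inj_eq lift_inj).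
Qed.

(** Without factor [i] there remain [n - 1] forms, to which [lnD_le] applies; what the discriminant
    has lost is the squared product of the distances from root [i] to the others. *)
Lemma lnP_ge i : (n%:R - 1) * (ell a b - eta a b) <= lnP i.
Proof.
pose a' := a \o lift i; pose b' := b \o lift i.
have a0' j : a' j != 0 by apply: a0.
have d0' j k : j != k -> dt a' b' j k != 0.
  by move=> jk; apply: d0; rewrite (inj_eq lift_inj).
have n2 : (0 < n.-1)%N by move: n1; case: (n) => [|[]].
have H := lnD_le a0' d0' n2.
have -> : lnP i = \sum_(j | j != i) ln (cn (dt a b i j)) -
    (n%:R - 2) * ln (A i) - eta a b.
  by rewrite /lnP !sumrB cardC1R /eta /A [X in _ = _ - X](bigD1 i) //=; ring.
have Ee : eta a b = ln (A i) + eta a' b' by rewrite /eta (bigD1_ord i).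
have := lnD_lift i.
have En : (n.-1)%:R = n%:R - 1 :> R by rewrite -subn1 natrB // ltnW.
move: H; rewrite En -/a' -/b' => H Ed.
have ln1 : (n%:R - 1) * ln (n%:R - 1) <= n%:R * ln n%:R :> R.
  have [|n2'] := leqP n 2.
    move=> n2'; have -> : n%:R = 2%:R :> R by congr (_%:R); move: n1 n2'; lia.
    by rewrite (_ : 2%:R - 1 = 1 :> R) ?ln1 ?mulr0 ?mulr_ge0 ?ln_ge0 //; lra.
  have n2R : (2 : R) < n%:R by rewrite ltr_nat.
  apply: ler_pM; rewrite ?ln_ge0 //; try lra.
  by apply: le_ln; lra.
have -> : (n%:R - 1) * (ell a b - eta a b) =
  (lnD a b - n%:R * ln n%:R) / 2 - (n%:R - 1) * eta a b.
  have n10 : n%:R - 1 != 0 :> R by rewrite lt0r_neq0 // subr_gt0.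
  by rewrite /ell; field; rewrite n10.
rewrite Ed Ee; lra.
Qed.

Lemma cn_dt_le i j : cn (dt a b i j) <= 2 * (A i * A j).
Proof.
rewrite (le_trans (cnB _ _)) // !cnM mulr2n mulrDl !mul1r.
apply: lerD; first by apply: ler_pM; rewrite ?cn_ge0 ?cn_a_le ?cn_b_le.
by rewrite mulrC; apply: ler_pM; rewrite ?cn_ge0 ?cn_a_le ?cn_b_le.
Qed.

Lemma lnd_le i j : i != j -> ln (cn (dt a b i j)) - ln (A i) - ln (A j) <= ln 2.
Proof.
move=> ij; have d := d0 ij.
have := le_ln _ (cn_dt_le i j); rewrite cn_gt0 => /(_ d).
rewrite lnMp ?mulr_gt0 // lnMp //; lra.
Qed.

Variables (x y : C).
Let L := lform a b x y.
Let H : R := Num.max (cn x) (cn y).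
Hypothesis H0 : 0 < H.
Hypothesis L0 : forall i, L i != 0.

(** Cramer's rule recovers [x] and [y] from [L i] and [L j]. *)
Lemma cramer_le i j : H * cn (dt a b i j) <= A i * cn (L j) + A j * cn (L i).
Proof.
rewrite maxr_pMl ?cn_ge0 // ge_max -!cnM; apply/andP; split.
  have -> : x * dt a b i j = - (b i * L j - b j * L i).
    by rewrite /dt /L /lform; ring.
  rewrite cnN (le_trans (cnB _ _)) // !cnM.
  by apply: lerD; apply: ler_wpM2r; rewrite ?cn_ge0 ?cn_b_le.
have -> : y * dt a b i j = - (a i * L j - a j * L i).
  by rewrite /dt /L /lform; ring.
rewrite cnN (le_trans (cnB _ _)) // !cnM.
by apply: lerD; apply: ler_wpM2r; rewrite ?cn_ge0 ?cn_a_le.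
Qed.

Variable i : 'I_n.
Hypothesis imin : forall j, cn (L i) / A i <= cn (L j) / A j.

Definition lnL j : R := ln (cn (L j)) - ln (A j).

Lemma lnL_ge j : j != i ->
  ln H - ln 2 + (ln (cn (dt a b i j)) - ln (A i) - ln (A j)) <= lnL j.
Proof.
move=> ji; have d : dt a b i j != 0 by apply: d0; rewrite eq_sym.
have := cramer_le i j; have := imin j.
rewrite ler_pdivrMr // mulrAC ler_pdivlMr // => h1 h2.
have h3 : H * cn (dt a b i j) <= 2 * (A i * cn (L j)).
  by rewrite (le_trans h2) // mulr2n mulrDl !mul1r lerD2l mulrC [A i * _]mulrC.
have := le_ln _ h3; rewrite mulr_gt0 ?cn_gt0 // => /(_ isT).
rewrite !lnMp ?mulr_gt0 ?cn_gt0 // /lnL; lra.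
Qed.

Lemma sum_lnL : \sum_j lnL j = ln (\prod_j cn (L j)) - eta a b.
Proof. by rewrite sumrB ln_prod // => j _; rewrite cn_gt0. Qed.

(** The other [n - 1] factors are bounded below by [H] times a distance of roots, so the smallest
    factor has to make up for them: approximation with exponent [n - 1]. *)
Lemma lnL_min_le : lnL i <= ln (\prod_j cn (L j)) + (n%:R - 1) * ln 2
   - (n%:R - 1) * ln H + (n%:R - 2) * eta a b - (n%:R - 1) * ell a b.
Proof.
have := sum_lnL; rewrite (bigD1 i) //=.
have : \sum_(j | j != i) (ln H - ln 2 + (ln (cn (dt a b i j)) - ln (A i) - ln (A j)))
   <= \sum_(j | j != i) lnL j by apply: ler_sum => j ji; apply: lnL_ge.
rewrite big_split /= cardC1R -/(lnP i); have := lnP_ge i; lra.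
Qed.

(** If a second factor ties with the smallest one, as for a conjugate root, its lower bound [lnL_ge]
    holds for the smallest one too; all [n] factors are then bounded below, and this bounds [H]. *)
Lemma lnH_pair_le c : c != i -> cn (L c) / A c = cn (L i) / A i ->
  n%:R * ln H <= ln (\prod_j cn (L j)) + (2 * n%:R - 3) * eta a b
    - (2 * n%:R - 2) * ell a b + (2 * n%:R - 2) * ln 2.
Proof.
move=> ci Ec.
have Ei : lnL i = lnL c.
  rewrite /lnL -!lnDiv ?cn_gt0 //.
  by rewrite Ec.
have := sum_lnL; rewrite (bigD1 i) //=.
have : \sum_(j | j != i) (ln H - ln 2 + (ln (cn (dt a b i j)) - ln (A i) - ln (A j)))
   <= \sum_(j | j != i) lnL j by apply: ler_sum => j ji; apply: lnL_ge.
rewrite big_split /= cardC1R -/(lnP i); have := lnP_ge i.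
have := lnL_ge ci; rewrite -Ei.
(* The extra bound involves the single distance to root [c]. The other normalized distances are at
   most [2], so the product of all of them controls it. *)
have : lnP i <= (ln (cn (dt a b i c)) - ln (A i) - ln (A c)) + (n%:R - 2) * ln 2.
  rewrite /lnP (bigD1 c) //= lerD2l.
  have : \sum_(j | (j != i) && (j != c)) (ln (cn (dt a b i j)) - ln (A i) - ln (A j))
     <= \sum_(j < n | (j != i) && (j != c)) ln (2 : R).
    by apply: ler_sum => j /andP[ji _]; rewrite lnd_le // eq_sym.
  move/le_trans; apply.
  have := cardC1R i (ln 2); rewrite (bigD1 c) //=; lra.
lra.
Qed.

End Argmin.

Lemma cross_le (a b x y x' y' : C) :
  cn (x * y' - y * x') * Num.max (cn a) (cn b) <=
  Num.max (cn x) (cn y) * cn (a * x' - b * y') +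
  Num.max (cn x') (cn y') * cn (a * x - b * y).
Proof.
have mx (u v : C) : cn u <= Num.max (cn u) (cn v) by rewrite le_max lexx.
have my (u v : C) : cn v <= Num.max (cn u) (cn v) by rewrite le_max lexx orbT.
rewrite maxr_pMr ?cn_ge0 // ge_max -!cnM; apply/andP; split.
  have -> : (x * y' - y * x') * a =
     y' * (a * x - b * y) - y * (a * x' - b * y') by ring.
  rewrite (le_trans (cnB _ _)) // addrC !cnM.
  by apply: lerD; apply: ler_wpM2r; rewrite ?cn_ge0 ?my.
have -> : (x * y' - y * x') * b =
   x' * (a * x - b * y) - x * (a * x' - b * y') by ring.
rewrite (le_trans (cnB _ _)) // addrC !cnM.
by apply: lerD; apply: ler_wpM2r; rewrite ?cn_ge0 ?mx.
Qed.

End LinearForms.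

(** * A zero estimate through the Wronskian *)

Section Wronskian.
Variable F : numFieldType.
Implicit Types (p q U V : {poly F}) (z : F).

Lemma horner_nderivn_sum (A : comNzRingType) N (p : {poly A}) j (z : A) : (size p <= N.+1)%N ->
  (p^`N(j)).[z] = \sum_(l < N.+1) p`_l * 'C(l, j)%:R * z ^+ (l - j).
Proof.
move=> sp.
have -> : p^`N(j) = \sum_(l < N.+1) p`_l *: ('X^(l - j) *+ 'C(l, j)).
  have {1}-> : p = \sum_(l < N.+1) p`_l *: 'X^l.
    rewrite -poly_def; apply/polyP => i; rewrite coef_poly; case: ltnP => // h.
    by rewrite nth_default // (leq_trans sp).
  by rewrite linear_sum; apply: eq_bigr => l _; rewrite linearZ /= nderivnXn.
rewrite horner_sum; apply: eq_bigr => l _.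
by rewrite hornerZ hornerMn hornerXn -mulr_natl mulrA.
Qed.

Lemma taylor_poly N p z : (size p <= N.+1)%N ->
  p = \sum_(l < N.+1) (p^`N(l)).[z] *: ('X - z%:P) ^+ l.
Proof.
move=> sp.
rewrite -{1}(comp_polyXr p) /comp_poly -{1}(subrK z%:P 'X) addrC.
rewrite (@nderiv_taylor_wide _ N.+1) ?size_map_polyC //; last exact: mulrC.
by apply: eq_bigr => l _; rewrite nderivn_map horner_map mul_polyC.
Qed.

Lemma dvdp_XsubC_exp k p z : (forall j, (j < k)%N -> (p^`N(j)).[z] = 0) ->
  ('X - z%:P) ^+ k %| p.
Proof.
move=> h; rewrite (taylor_poly z (leqnSn (size p))).
apply: (big_ind (fun q => ('X - z%:P) ^+ k %| q)); first exact: dvdp0.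
  by move=> *; apply: dvdp_add.
move=> l _; case: (ltnP l k) => [/h ->|kl]; first by rewrite scale0r dvdp0.
by rewrite -mul_polyC dvdp_mull // dvdp_exp2l.
Qed.

Definition wronskian U V := U * V^`() - U^`() * V.

Lemma wronskian_sub U V c : wronskian (U - c *: V) V = wronskian U V.
Proof. by rewrite /wronskian derivB derivZ -!mul_polyC; ring. Qed.

Lemma dvdp_deriv_XsubC k p z : ('X - z%:P) ^+ k.+1 %| p -> ('X - z%:P) ^+ k %| p^`().
Proof.
case/dvdpP => q ->; rewrite derivM deriv_exp /= derivXsubC mul1r.
apply: dvdp_add; first by rewrite dvdp_mull // dvdp_exp2l.
by rewrite dvdp_mull // -mulr_natr dvdp_mulr.
Qed.

Lemma dvdp_wronskian k U V z c :
  ('X - z%:P) ^+ k.+1 %| U - c *: V -> ('X - z%:P) ^+ k %| wronskian U V.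
Proof.
move=> h; rewrite -(wronskian_sub U V c) /wronskian; apply: dvdp_sub.
  by rewrite dvdp_mulr // (dvdp_trans _ h) // dvdp_exp2l.
by rewrite dvdp_mulr // dvdp_deriv_XsubC.
Qed.

Lemma deriv_eq0_size p : p^`() = 0 -> (size p <= 1)%N.
Proof.
move=> p0; apply/leq_sizeP => -[//|i] _.
by have /eqP := congr1 (fun q : {poly F} => q`_i) p0;
   rewrite coef_deriv coef0 mulrn_eq0 => /eqP.
Qed.

(** After division by the gcd, [u v' = u' v] with [u], [v] coprime makes [v] divide its own
    derivative, so [v' = 0] by degree; both quotients are constant in characteristic zero. *)
Lemma wronskian_eq0 U V : V != 0 -> wronskian U V = 0 -> exists c, U = c *: V.
Proof.
move=> V0 W0; pose g := gcdp U V.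
have g0 : g != 0 by rewrite gcdp_eq0 negb_and V0 orbT.
have Ue : U = U %/ g * g by rewrite divpK // dvdp_gcdl.
have Ve : V = V %/ g * g by rewrite divpK // dvdp_gcdr.
set u := U %/ g in Ue; set v := V %/ g in Ve.
have cuv : coprimep u v by rewrite coprimep_div_gcd // V0 orbT.
have E : u * v^`() = u^`() * v.
  have : g ^+ 2 * (u * v^`() - u^`() * v) = 0.
    transitivity (wronskian (u * g) (v * g)); last by rewrite -Ue -Ve.
    by rewrite /wronskian !derivM; ring.
  by move/eqP; rewrite mulf_eq0 expf_eq0 (negPf g0) /= subr_eq0 => /eqP.
have v0 : v != 0 by apply: contra V0 => /eqP v0; rewrite Ve v0 mul0r.
have dv : v^`() = 0.
  apply/eqP; apply: contrapT => /negP dv0.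
  have : v %| v^`() by rewrite -(Gauss_dvdpr _ (_ : coprimep v u)) 1?coprimep_sym // E dvdp_mull.
  by move/(dvdp_leq dv0); rewrite leqNgt lt_size_deriv.
have du : u^`() = 0.
  by move/eqP: E; rewrite dv mulr0 eq_sym mulf_eq0 (negPf v0) orbF => /eqP.
have /size1_polyC ue := deriv_eq0_size du; have /size1_polyC ve := deriv_eq0_size dv.
have c0 : v`_0 != 0 by apply: contra v0; rewrite {2}ve => /eqP ->.
have EU : U = u`_0 *: g by rewrite Ue {1}ue mul_polyC.
have EV : V = v`_0 *: g by rewrite Ve {1}ve mul_polyC.
by exists (u`_0 / v`_0); rewrite {1}EU EV scalerA divfK.
Qed.

(** The naive bound is one too large because the leading terms cancel: subtracting a multiple of [V]
    from [U] lowers its degree and keeps the Wronskian. *)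
Lemma size_wronskian N U V : (size U <= N.+1)%N -> (size V <= N.+1)%N ->
  (size (wronskian U V) <= (2 * N).-1)%N.
Proof.
have small (P Q : {poly F}) : (size P <= N)%N -> (size Q <= N.+1)%N ->
    (size (wronskian P Q) <= (2 * N).-1)%N.
  move=> sP sQ; apply: (leq_trans (size_polyD _ _)); rewrite size_polyN geq_max.
  have dl (p : {poly F}) : (size p^`() <= (size p).-1)%N.
    have [->|p0] := eqVneq p 0; first by rewrite deriv0 size_poly0.
    by have := lt_size_deriv p0; case: (size p).
  have := size_polyMleq P Q^`(); have := size_polyMleq P^`() Q.
  have := dl P; have := dl Q; move: sP sQ.
  move: (size P) (size Q) (size (P * _)) (size (P^`() * Q)) (size P^`()) (size Q^`()).
  by move=> *; apply/andP; split; lia.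
move=> sU sV; have [V0|V0] := eqVneq V`_N 0.
  have -> : wronskian U V = - wronskian V U by rewrite /wronskian; ring.
  rewrite size_polyN small //.
  have := sV; rewrite leq_eqVlt => /orP[/eqP sV'|//].
  by move/eqP: V0; rewrite -[N]/(N.+1.-1) -sV' -/(lead_coef V) lead_coef_eq0
     -size_poly_eq0 sV'.
rewrite -(wronskian_sub U V (U`_N / V`_N)) small //.
apply/leq_sizeP => j; rewrite leq_eqVlt => /orP[/eqP <-|Nj].
  by rewrite coefB coefZ divfK // subrr.
by rewrite coefB coefZ (nth_default _ (leq_trans sU Nj))
  (nth_default _ (leq_trans sV Nj)) mulr0 subr0.
Qed.

Lemma coprimep_XsubC_exp (z z' : F) k l : z != z' ->
  coprimep (('X - z%:P) ^+ k) (('X - z'%:P) ^+ l).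
Proof.
move=> zz; apply: coprimep_expl; apply: coprimep_expr.
by rewrite coprimep_XsubC root_XsubC eq_sym.
Qed.

Lemma dvdp_prod_XsubC_exp (I : finType) (P : pred I) (alpha : I -> F) k p :
  injective alpha -> (forall i, P i -> ('X - (alpha i)%:P) ^+ k %| p) ->
  \prod_(i | P i) ('X - (alpha i)%:P) ^+ k %| p.
Proof.
move=> inja h.
have : uniq (enum P) by apply: enum_uniq.
have hin i : i \in enum P -> ('X - (alpha i)%:P) ^+ k %| p.
  by rewrite mem_enum; apply: h.
rewrite -big_enum; elim: (enum P) hin => [|i s IH] hin; first by rewrite big_nil dvd1p.
rewrite big_cons /= => /andP[nis us]; rewrite Gauss_dvdp.
  by rewrite hin ?mem_head // IH // => j js; apply: hin; rewrite inE js orbT.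
rewrite big_seq; apply: (big_ind (fun q => coprimep _ q)).
- exact: coprimep1.
- by move=> x y cx cy; rewrite coprimepMr cx.
- move=> j js; apply: coprimep_XsubC_exp; by apply: contra nis => /eqP/inja ->.
Qed.

Lemma size_prod_XsubC_exp (I : finType) (P : pred I) (alpha : I -> F) k :
  size (\prod_(i | P i) ('X - (alpha i)%:P) ^+ k) = (#|P| * k).+1.
Proof.
have m i : ('X - (alpha i)%:P) ^+ k \is monic by rewrite monic_exp ?monicXsubC.
rewrite -big_enum size_prod_seq; last by move=> i _; rewrite monic_neq0.
rewrite (eq_bigr (fun=> k.+1)); last by move=> i _; rewrite size_exp_XsubC.
by rewrite big_const_seq count_predT iter_addn_0 -cardE; nia.
Qed.

(** The Wronskian vanishes to order [k] at the [n] points [alpha i] and, if the conclusion fails, to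
    order [J] at [z]: more than its degree. *)
Lemma wronskian_zero_estimate n (alpha : 'I_n -> F) U V N k J z Y :
  injective alpha -> (forall i, z != alpha i) ->
  (size U <= N.+1)%N -> (size V <= N.+1)%N -> (U != 0) || (V != 0) ->
  (forall i, ('X - (alpha i)%:P) ^+ k.+1 %| U - alpha i *: V) ->
  (N < n.-1 * k.+1)%N -> (2 * N < n * k + J + 2)%N ->
  exists2 j, (j <= J)%N & (U^`N(j)).[z] - Y * (V^`N(j)).[z] != 0.
Proof.
move=> inja za sU sV UV0 hd hN hJ.
have W0 : wronskian U V != 0.
  have [V0|V0] := eqVneq V 0.
    rewrite V0 eqxx orbF in UV0.
    have hU i : ('X - (alpha i)%:P) ^+ k.+1 %| U.
      by have := hd i; rewrite V0 scaler0 subr0.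
    have := dvdp_leq UV0 (dvdp_prod_XsubC_exp inja (fun i (_ : predT i) => hU i)).
    rewrite size_prod_XsubC_exp cardT size_enum_ord => h.
    by exfalso; have := leq_trans h sU; nia.
  (* If [U = c *: V], then [V] vanishes to order [k.+1] at every [alpha i] except the one that may
     equal [c]; hence the [n.-1] in the hypothesis on [N]. *)
  apply/eqP => /(wronskian_eq0 V0) [c Uc].
  have hV i : alpha i != c -> ('X - (alpha i)%:P) ^+ k.+1 %| V.
    move=> ic; have := hd i; rewrite Uc -scalerBl dvdpZr // subr_eq0 eq_sym //.
  have := dvdp_leq V0 (dvdp_prod_XsubC_exp inja hV).
  rewrite size_prod_XsubC_exp => h.
  have cP : (n.-1 <= #|[pred i | alpha i != c]|)%N.
    have := cardC [pred i | alpha i == c]; rewrite card_ord.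
    have : (#|[pred i | alpha i == c]| <= 1)%N.
      by apply/card_le1_eqP => i j; rewrite !inE => /eqP <- /eqP /inja.
    have -> : #|[predC [pred i | alpha i == c]]| = #|[pred i | alpha i != c]| by [].
    by move=> c1 c2; rewrite -subn1 leq_subLR -[X in (X <= _)%N]c2 leq_add2r.
  have := leq_trans h sV; rewrite ltnS => h'.
  have := leq_ltn_trans h' hN; rewrite ltn_mul2r /= => h2.
  have : (#|(fun i => alpha i != c)| = #|[pred i | alpha i != c]|) by [].
  by move=> e; move: h2; rewrite e ltnNge cP.
apply: contrapT => hex.
have hz : ('X - z%:P) ^+ J.+1 %| U - Y *: V.
  apply: dvdp_XsubC_exp => j; rewrite ltnS => jJ; rewrite nderivnB nderivnZ.
  apply/eqP; apply: contrapT => hj; apply: hex; exists j => //.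
  by move/negP: hj; rewrite hornerD hornerN hornerZ.
have hWz := dvdp_wronskian hz.
have hWa : \prod_(i < n) ('X - (alpha i)%:P) ^+ k %| wronskian U V.
  by apply: dvdp_prod_XsubC_exp => // i _; apply: (dvdp_wronskian (hd i)).
have hW : ('X - z%:P) ^+ J * \prod_(i < n) ('X - (alpha i)%:P) ^+ k %| wronskian U V.
  rewrite Gauss_dvdp ?hWz //; apply: (big_ind (fun q => coprimep _ q)).
  - exact: coprimep1.
  - by move=> x y cx cy; rewrite coprimepMr cx.
  - by move=> i _; apply: coprimep_XsubC_exp.
have := leq_trans (dvdp_leq W0 hW) (size_wronskian sU sV).
rewrite size_Mmonic ?monic_neq0 ?monic_exp ?monicXsubC //; last first.
  by apply: monic_prod => i _; rewrite monic_exp ?monicXsubC.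
rewrite size_prod_XsubC_exp size_exp_XsubC cardT size_enum_ord; nia.
Qed.

End Wronskian.

(** * Siegel's lemma for algebraic conditions *)

Section Siegel.
Variable R : realType.
Local Notation C := R[i].

(** Box principle on vectors with entries in [[0, B]]: the difference of two vectors that share all
    their cells is the solution. *)
Lemma pigeonhole_forms (S T : finType) (w : T -> S -> R) (W : T -> R)
    (B : nat) (l : T -> nat) :
  (forall t, \sum_s `|w t s| <= W t) -> (forall t, 0 < W t) ->
  (forall t, 0 < l t)%N -> (0 < B)%N ->
  (\prod_t (l t).+1 < B.+1 ^ #|S|)%N ->
  exists x : S -> int, [/\ exists s, x s != 0,
    forall s, `|x s| <= B%:Z &
    forall t, `|\sum_s w t s * (x s)%:~R| < B%:R * W t / (l t)%:R].
Proof.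
move=> hW W0 l0 B0 hcard.
have BR : 0 < B%:R :> R by rewrite ltr0n.
pose phi t (f : {ffun S -> 'I_B.+1}) : R := \sum_s w t s * ((f s)%:R - B%:R / 2).
(* Centering the entries at [B / 2] puts the form [t] in an interval of length [B * W t], rescaled
   here to [[0, l t]]. The right end is a cell of its own, whence [(l t).+1]. *)
pose val t f : R := (l t)%:R * (phi t f / (B%:R * W t) + 1 / 2).
have lR t : 0 < (l t)%:R :> R by rewrite ltr0n.
have BW t : 0 < B%:R * W t by rewrite mulr_gt0.
have phi_le t f : `|phi t f| <= B%:R / 2 * W t.
  rewrite (le_trans (ler_norm_sum _ _ _)) //.
  apply: (@le_trans _ _ (\sum_s `|w t s| * (B%:R / 2))); last first.
    by rewrite -mulr_suml mulrC ler_wpM2l // ?divr_ge0 ?ler0n.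
  apply: ler_sum => s _; rewrite normrM ler_wpM2l // ler_norml.
  have : (f s)%:R <= B%:R :> R by rewrite ler_nat -ltnS.
  have : 0 <= (f s)%:R :> R by rewrite ler0n.
  lra.
have val_itv t f : 0 <= val t f <= (l t)%:R.
  have := phi_le t f; rewrite ler_norml => /andP[p1 p2].
  have q1 : - (1 / 2) <= phi t f / (B%:R * W t) by rewrite ler_pdivlMr //; lra.
  have q2 : phi t f / (B%:R * W t) <= 1 / 2 by rewrite ler_pdivrMr //; lra.
  rewrite /val; have := lR t; nra.
have code_lt t f : (Num.truncn (val t f) < (l t).+1)%N.
  have /andP[v0 v1] := val_itv t f.
  by rewrite truncn_lt_nat // (le_lt_trans v1) // ltr_nat.
pose code f : {dffun forall t : T, 'I_(l t).+1} :=
  [ffun t => Ordinal (code_lt t f)].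
have [f [g [fg e]]] : exists f g, f != g /\ code f = code g.
  apply: contrapT => hno.
  have inj : injective code.
    move=> f g e; apply/eqP; apply: contrapT => /negP h; apply: hno.
    by exists f, g.
  have E1 : #|{dffun forall t : T, 'I_(l t).+1}| = \prod_t (l t).+1.
    rewrite card_dep_ffun foldrE big_image /=.
    by apply: eq_bigr => t _; rewrite card_ord.
  have E2 : #|{ffun S -> 'I_B.+1}| = (B.+1 ^ #|S|)%N by rewrite card_ffun card_ord.
  by have := leq_card code inj; rewrite E1 E2 leqNgt hcard.
exists (fun s => (f s)%:Z - (g s)%:Z); split.
- apply: contrapT => hno; move/eqP: fg; apply; apply/ffunP => s.
  apply/eqP; apply: contrapT => h; apply: hno; exists s.
  by rewrite subr_eq0; apply: contra_notN h => /eqP [] h; apply/eqP/val_inj.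
- move=> s; have := ltn_ord (f s); have := ltn_ord (g s); lia.
- move=> t.
  have ct : Num.truncn (val t f) = Num.truncn (val t g).
    have /(congr1 (fun h : {dffun forall t : T, 'I_(l t).+1} => nat_of_ord (h t))) := e.
    by rewrite /code !ffunE.
  have /andP[f0 _] := val_itv t f; have /andP[g0 _] := val_itv t g.
  have := truncn_itv f0; have := truncn_itv g0; rewrite ct -natr1 => /andP[g1 g2] /andP[f1 f2].
  have E : \sum_s w t s * ((f s)%:Z - (g s)%:Z)%:~R = (val t f - val t g) * (B%:R * W t) / (l t)%:R.
    transitivity (phi t f - phi t g).
      by rewrite /phi -sumrB; apply: eq_bigr => s _; rewrite rmorphB /= -!pmulrn; ring.
    by rewrite /val; field; rewrite !gt_eqF.
  rewrite E normrM normrM normfV (gtr0_norm (BW t)) (gtr0_norm (lR t)).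
  rewrite ltr_pM2r ?invr_gt0 // -[ltRHS]mul1r ltr_pM2r // ltr_norml; lra.
Qed.

Lemma bin_le_exp2 l j : ('C(l, j) <= 2 ^ l)%N.
Proof.
elim: l j => [|l IH] [|j]; rewrite ?bin0 ?expn_gt0 ?bin0n // binS expnS mul2n -addnn.
by rewrite leq_add.
Qed.

Lemma sum_exp2 m : \sum_(l < m) 2 ^+ l <= 2 ^+ m :> R.
Proof.
elim: m => [|m IH]; first by rewrite big_ord0 expr0 ler01.
by rewrite big_ord_recr /= exprS mulr2n mulrDl !mul1r lerD2r.
Qed.

Lemma sum_bin_pow N j (t m : R) : 0 <= t -> t <= m -> 1 <= m -> (j <= N.+1)%N ->
  \sum_(l < N.+1) 'C(l, j)%:R * t ^+ (l - j) * m <= 2 ^+ N.+1 * m ^+ (N.+1 - j).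
Proof.
move=> t0 tm m1 jN; have m0 : 0 <= m := le_trans ler01 m1.
apply: (@le_trans _ _ (\sum_(l < N.+1) 2 ^+ l * m ^+ (N.+1 - j))).
  apply: ler_sum => l _; case: (ltnP l j) => lj.
    by rewrite bin_small // mul0r mul0r mulr_ge0 ?exprn_ge0.
  rewrite -mulrA ler_pM // ?mulr_ge0 ?exprn_ge0 //.
    by rewrite -natrX ler_nat bin_le_exp2.
  apply: (@le_trans _ _ (m ^+ (l - j).+1)).
    by rewrite exprSr ler_wpM2r // lerXn2r ?nnegrE.
  by apply: ler_weXn2l => //; have := ltn_ord l; lia.
by rewrite -mulr_suml ler_wpM2r ?sum_exp2 // exprn_ge0.
Qed.

(** For the roots of an irreducible form the product is the modulus of a resultant, an integer;
    below 1 it is zero, and irreducibility spreads the zero to all roots. *)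
Definition norm_integral n (a alpha : 'I_n -> C) :=
  forall d (P : {poly int}), (size P <= d.+1)%N ->
  \prod_i (cn (a i) ^+ d * cn ((map_poly intr P).[alpha i])) < 1 ->
  forall i, (map_poly (intr : int -> C) P).[alpha i] = 0.

Section Form.
Variables (n : nat) (a alpha : 'I_n -> C) (c : 'I_n -> 'I_n).
Hypothesis n0 : (0 < n)%N.
Hypothesis HI : norm_integral a alpha.
Hypothesis cc : forall i, c (c i) = i.
Hypothesis alphaJ : forall i, alpha (c i) = ((alpha i)^*)%C.

Definition mu i : R := Num.max 1 (cn (alpha i)).
(** The logarithmic Mahler measure of the polynomial with factors [a i * (X - alpha i)]. *)
Definition lnMM : R := \sum_i ln (cn (a i) * mu i).

Lemma mu_ge1 i : 1 <= mu i. Proof. by rewrite le_max lexx. Qed.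
Lemma mu_gt0 i : 0 < mu i. Proof. exact: lt_le_trans (mu_ge1 i). Qed.
Lemma cn_alpha_le i : cn (alpha i) <= mu i. Proof. by rewrite le_max lexx orbT. Qed.
Lemma mu_c i : mu (c i) = mu i. Proof. by rewrite /mu alphaJ cn_conj. Qed.

(** A conjugate pair is split between its indices, the smaller one carrying the real part and the
    larger one the imaginary part: [n] real conditions instead of [2 n]. *)
Definition part (i : 'I_n) (z : C) : R := if (i <= c i)%N then complex.Re z else complex.Im z.

Lemma part_le i z : `|part i z| <= cn z.
Proof. by rewrite /part; case: ifP => _; rewrite ?cn_Re ?cn_Im. Qed.

Lemma cn_le_parts i z z' : z' = (z^*)%C -> (c i = i -> z' = z) ->
  cn z <= `|part i z| + `|part (c i) z'|.
Proof.
move=> zz zr; apply: (le_trans (cn_le_ReIm z)); rewrite /part cc.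
case: (ltngtP i (c i)) => h.
- by rewrite zz; case: (z) => x y /=; rewrite normrN.
- by rewrite zz; case: (z) => x y /=; rewrite addrC.
- have zr' : z' = z by apply: zr; apply: val_inj.
  rewrite zr' lerD2l; move: zz; rewrite zr'; case: (z) => x y /= [] e.
  have -> : y = 0 by lra.
  by rewrite normr0 normr_ge0.
Qed.

Lemma part_sum (I : finType) i (f : I -> C) (x : I -> int) :
  part i (\sum_s f s * (x s)%:~R) = \sum_s part i (f s) * (x s)%:~R.
Proof.
have Ex (s : I) : ((x s)%:~R : C) = ((x s)%:~R : R)%:C%C by rewrite rmorph_int.
have ReM (z : C) (t : R) : complex.Re (z * t%:C%C) = complex.Re z * t.
  by case: z => ? ? /=; ring.
have ImM (z : C) (t : R) : complex.Im (z * t%:C%C) = complex.Im z * t.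
  by case: z => ? ? /=; ring.
rewrite /part; case: ifP => _.
  rewrite (@raddf_sum _ _ (@complex.Re R)) /=.
  by apply: eq_bigr => s _; rewrite Ex ReM.
rewrite (@raddf_sum _ _ (@complex.Im R)) /=.
by apply: eq_bigr => s _; rewrite Ex ImM.
Qed.

Variables N k B : nat.
Hypothesis kN : (k <= N.+1)%N.
Hypothesis B0 : (0 < B)%N.

Definition cf i j (s : bool * 'I_N.+1) : C :=
  (if s.1 then - alpha i else 1) * ('C(s.2, j)%:R * alpha i ^+ (s.2 - j)).

Lemma sum_bin_mu i j : (j <= N.+1)%N ->
  \sum_(l < N.+1) 'C(l, j)%:R * cn (alpha i) ^+ (l - j) * mu i
    <= 2 ^+ N.+1 * mu i ^+ (N.+1 - j).
Proof. by move=> jN; apply: sum_bin_pow; rewrite ?cn_ge0 ?mu_ge1 ?cn_alpha_le. Qed.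

Lemma sum_cf i j : (j <= N.+1)%N ->
  \sum_s cn (cf i j s) <= 2 ^+ N.+2 * mu i ^+ (N.+1 - j).
Proof.
move=> jN; rewrite -(pair_bigA _ (fun s l => cn (cf i j (s, l)))) /=.
rewrite big_bool /=.
have -> : 2 ^+ N.+2 * mu i ^+ (N.+1 - j) = 2 ^+ N.+1 * mu i ^+ (N.+1 - j) +
   2 ^+ N.+1 * mu i ^+ (N.+1 - j) by rewrite [2 ^+ N.+2]exprS; ring.
have H := sum_bin_mu i jN.
have e l : cn ('C(l, j)%:R * alpha i ^+ (l - j)) = 'C(l, j)%:R * cn (alpha i) ^+ (l - j).
  by rewrite cnM cnX cn_nat.
apply: lerD; apply: le_trans H; apply: ler_sum => l _; rewrite /cf /=.
  by rewrite cnM cnN e mulrC ler_wpM2l ?cn_alpha_le // mulr_ge0 ?exprn_ge0 ?cn_ge0.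
by rewrite mul1r e ler_peMr ?mu_ge1 // mulr_ge0 ?exprn_ge0 ?cn_ge0.
Qed.

Lemma nderivn_alpha i j (x : bool * 'I_N.+1 -> int) (U V : {poly int}) :
  U = \poly_(l < N.+1) x (false, inord l) -> V = \poly_(l < N.+1) x (true, inord l) ->
  ((map_poly intr U)^`N(j)).[alpha i] - alpha i * ((map_poly intr V)^`N(j)).[alpha i]
   = \sum_s cf i j s * (x s)%:~R.
Proof.
move=> UE VE.
have sz (f : nat -> int) : (size (map_poly (intr : int -> C) (\poly_(l < N.+1) f l)) <= N.+1)%N.
  by rewrite (leq_trans (size_poly _ _)) // size_poly.
rewrite (horner_nderivn_sum _ _ (_ : (size (map_poly intr U) <= N.+1)%N)) ?UE ?sz //.
rewrite (horner_nderivn_sum _ _ (_ : (size (map_poly intr V) <= N.+1)%N)) ?VE ?sz //.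
have -> : \sum_s cf i j s * (x s)%:~R =
    \sum_(s : bool) \sum_(l < N.+1) cf i j (s, l) * (x (s, l))%:~R.
  by rewrite pair_bigA; apply: eq_bigr => -[].
rewrite big_bool /=.
rewrite addrC mulr_sumr -sumrN; congr (_ + _); apply: eq_bigr => l _;
  rewrite /cf coef_map coef_poly ltn_ord inord_val /=; ring.
Qed.

Hypothesis lnMM0 : 0 <= lnMM.
Hypothesis a0 : forall i, a i != 0.

(** The pigeonhole principle only makes the conditions small at all conjugates. Being values of an
    integer polynomial, they then vanish by [norm_integral]. The hypothesis compares [B] to the
    number of unknowns with the number of cells. *)
Lemma siegel_form :
  (k * n)%:R * (N.+4%:R * ln 2 + ln B%:R) + (\sum_(j < k) (N.+1 - j)%:R) * lnMM
    <= 2 * N.+1%:R * ln B%:R ->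
  exists U V : {poly int},
  [/\ (size U <= N.+1)%N /\ (size V <= N.+1)%N, (U != 0) || (V != 0),
      forall l, `|U`_l| <= B%:Z /\ `|V`_l| <= B%:Z &
      forall i j, (j < k)%N -> ((map_poly intr U)^`N(j)).[alpha i] =
         alpha i * ((map_poly intr V)^`N(j)).[alpha i]].
Proof.
move=> hB.
have BR : 0 < B%:R :> R by rewrite ltr0n.
have BR1 : 1 <= B%:R :> R by rewrite ler1n.
have nR : 0 < n%:R :> R by rewrite ltr0n.
(* The precision for order [j], chosen so that the product of the bounds over all conjugates is just
   below 1, see [le1]. Of the powers of [2], [N.+2] come from [sum_cf] and one from joining real and
   imaginary parts. *)
pose lX (j : nat) : R := N.+3%:R * ln 2 + ln B%:R + (N.+1 - j)%:R / n%:R * lnMM.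
have lX_ge j : 3 * ln 2 <= lX j.
  have ln2 : 0 <= ln 2 :> R by rewrite ln_ge0 // ler1n.
  have lB : 0 <= ln B%:R :> R by rewrite ln_ge0.
  have : 0 <= (N.+1 - j)%:R / n%:R * lnMM by rewrite !mulr_ge0 ?invr_ge0 ?ler0n.
  have : 3 <= N.+3%:R :> R by rewrite ler_nat.
  rewrite /lX; nra.
have X8 j : 8 <= expR (lX j).
  have -> : 8 = expR (3 * ln 2) :> R by rewrite expRM_natl lnK ?posrE //; ring.
  by rewrite ler_expR.
pose l (t : 'I_n * 'I_k) : nat := (Num.truncn (expR (lX t.2))).+1.
have l_gt (t : 'I_n * 'I_k) : expR (lX t.2) < (l t)%:R by rewrite truncnS_gt.
have l_le (t : 'I_n * 'I_k) : (l t).+1%:R <= expR (lX t.2 + ln 2).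
  rewrite expRD lnK ?posrE //; have := truncn_le (expR (lX t.2)).
  rewrite expR_ge0 /l -!natr1 => h; have := X8 t.2.
  have : (Num.truncn (expR (lX t.2)))%:R <= expR (lX t.2) by rewrite h.
  lra.
pose w (t : 'I_n * 'I_k) s := part t.1 (cf t.1 t.2 s).
pose W (t : 'I_n * 'I_k) : R := 2 ^+ N.+2 * mu t.1 ^+ (N.+1 - t.2).
have hW (t : 'I_n * 'I_k) : \sum_s `|w t s| <= W t.
  apply: le_trans (sum_cf _ _); last by have := ltn_ord t.2; lia.
  by apply: ler_sum => s _; rewrite part_le.
have W0 t : 0 < W t by rewrite mulr_gt0 ?exprn_gt0 ?mu_gt0.
have hcard : (\prod_t (l t).+1 < B.+1 ^ #|{: bool * 'I_N.+1}|)%N.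
  rewrite card_prod card_bool card_ord.
  apply: (@leq_ltn_trans (B ^ (2 * N.+1))); last by rewrite ltn_exp2r.
  rewrite -(ler_nat R) natr_prod natrX.
  apply: (@le_trans _ _ (\prod_(t : 'I_n * 'I_k) expR (lX t.2 + ln 2))).
    by apply: ler_prod => t _; rewrite ler0n l_le.
  rewrite -expR_sum -[leRHS]lnK ?posrE ?exprn_gt0 // ler_expR lnX //.
  rewrite -(pair_bigA _ (fun (i : 'I_n) (j : 'I_k) => lX j + ln 2)) /=.
  rewrite sumr_const card_ord natrM; apply: le_trans hB.
  rewrite mulr_suml (_ : (k * n)%:R * _ = \sum_(j < k) (n%:R * (N.+4%:R * ln 2 + ln B%:R))).
    rewrite -[leRHS]big_split /= -[leLHS]mulr_natl mulr_sumr; apply: ler_sum => j _.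
    rewrite le_eqVlt; apply/orP; left; apply/eqP; rewrite /lX -[N.+4%:R]natr1; field.
    by rewrite gt_eqF.
  by rewrite sumr_const card_ord -[RHS]mulr_natl natrM; ring.
have [x [[s xs] xB xsmall]] := pigeonhole_forms hW W0 (fun t => ltn0Sn _) B0 hcard.
pose U := \poly_(l < N.+1) x (false, inord l); pose V := \poly_(l < N.+1) x (true, inord l).
exists U, V; split.
- by rewrite !size_poly.
- apply: contrapT => /negP; rewrite negb_or !negbK => /andP[/eqP U0 /eqP V0].
  move/eqP: xs; apply; case: s => -[] i.
    by have := congr1 (fun p : {poly int} => p`_i) V0; rewrite coef_poly ltn_ord inord_val coef0.
  by have := congr1 (fun p : {poly int} => p`_i) U0; rewrite coef_poly ltn_ord inord_val coef0.
- by move=> j; rewrite !coef_poly; case: ifP => _; rewrite ?normr0 ?xB.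
(* With ['X] in place of [alpha], the conditions of order [j] at all roots are the values of one
   integer polynomial. *)
- move=> i j jk; pose P := U^`N(j) - 'X * V^`N(j).
  have PE i' : (map_poly intr P).[alpha i'] = \sum_s cf i' j s * (x s)%:~R.
    rewrite -(@nderivn_alpha i' j x U V) // /P rmorphB rmorphM /= map_polyX !nderivn_map.
    by rewrite hornerD hornerN hornerM hornerX.
  suff : (map_poly intr P).[alpha i] = 0.
    rewrite PE -(@nderivn_alpha i j x U V) // => /eqP.
    by rewrite subr_eq0 => /eqP.
  apply: (@HI (N.+1 - j)%N P).
    rewrite (leq_trans (size_polyD _ _)) // size_polyN geq_max.
    have szd (Q : {poly int}) : (size Q <= N.+1)%N -> (size Q^`N(j) <= N.+1 - j)%N.
      by move=> h; rewrite (leq_trans (size_poly _ _)) // leq_sub2r.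
    have sU := szd U (size_poly _ _); have sV := szd V (size_poly _ _).
    rewrite (leq_trans sU) //=; apply: (leq_trans (size_polyMleq _ _)).
    by rewrite size_polyX /= ltnS.
  pose t0 := Ordinal jk; pose D := (N.+1 - j)%N.
  have bound i' : cn ((map_poly intr P).[alpha i']) <=
      2 * (B%:R * (2 ^+ N.+2 * mu i' ^+ D) / (l (i', t0))%:R).
    rewrite mulr2n mulrDl mul1r PE.
    apply: le_trans (cn_le_parts (i := i') (z' := \sum_s cf (c i') j s * (x s)%:~R) _ _) _.
    + rewrite -!PE alphaJ -[in RHS]horner_map /= -map_poly_comp /=.
      by congr (_.[_]); apply: eq_map_poly => z /=; rewrite rmorph_int.
    + by move=> ->.
    + rewrite !part_sum; apply: lerD; first exact: ltW (xsmall (i', t0)).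
      by rewrite -mu_c; apply: ltW (xsmall (c i', t0)).
  have L_gt : expR (lX j) < (l (i, t0))%:R := l_gt (i, t0).
  have {}bound i' : cn ((map_poly intr P).[alpha i']) <=
      2 * (B%:R * (2 ^+ N.+2 * mu i' ^+ D) / (l (i, t0))%:R) := bound i'.
  move: ((l (i, t0))%:R : R) L_gt bound => L L_gt bound.
  have L0 : 0 < L := lt_trans (expR_gt0 _) L_gt.
  have le1 : (2 ^+ N.+3 * B%:R / L) ^+ n * expR (D%:R * lnMM) < 1.
    rewrite expr_div_n mulrAC ltr_pdivrMr ?exprn_gt0 // mul1r.
    have -> : (2 ^+ N.+3 * B%:R) ^+ n * expR (D%:R * lnMM) = expR (lX j) ^+ n.
      rewrite -expRM_natl (_ : n%:R * lX j = n%:R * (N.+3%:R * ln 2 + ln B%:R) + D%:R * lnMM).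
        by rewrite expRD; congr (_ * _); rewrite expRM_natl expRD expRM_natl !lnK ?posrE.
      by rewrite /lX -/D; field; rewrite gt_eqF.
    by rewrite ltr_pXn2r // ?nnegrE ?expR_ge0 // ltW.
  apply: le_lt_trans le1.
  apply: (@le_trans _ _ (\prod_(i' < n) (2 ^+ N.+3 * B%:R / L * (cn (a i') * mu i') ^+ D))).
    apply: ler_prod => i' _; rewrite mulr_ge0 ?exprn_ge0 ?cn_ge0 //=.
    apply: le_trans (ler_wpM2l _ (bound i')) _; first by rewrite exprn_ge0 ?cn_ge0.
    rewrite exprMn [2 ^+ N.+3]exprS -/D.
    move: (cn (a i') ^+ D) (mu i' ^+ D) (2 ^+ N.+2) (L^-1) => X1 X2 X3 X4.
    by rewrite le_eqVlt; apply/orP; left; apply/eqP; ring.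
  rewrite big_split /= prodr_const card_ord ler_wpM2l //.
    by rewrite exprn_ge0 // divr_ge0 ?(ltW L0) // mulr_ge0 ?exprn_ge0 ?ler0n.
  rewrite prodrXl expRM_natl lerXn2r ?nnegrE ?expR_ge0 //.
    by apply: prodr_ge0 => i' _; rewrite mulr_ge0 ?cn_ge0 // ltW ?mu_gt0.
  rewrite expR_sum le_eqVlt; apply/orP; left; apply/eqP; apply: eq_bigr => i' _.
  by rewrite lnK // posrE mulr_gt0 ?cn_gt0 ?mu_gt0.
Qed.

End Form.
End Siegel.

(** * Thue's method for a pair of solutions *)

Section ThueGap.
Variable R : realType.
Local Notation C := R[i].

Lemma nderivn_XsubC_exp (A : comNzRingType) (z : A) l j :
  (('X - z%:P) ^+ l)^`N(j) = ('X - z%:P) ^+ (l - j) *+ 'C(l, j).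
Proof.
elim: l j => [|l IH] [|j].
- by rewrite nderivn0 bin0.
- by rewrite expr0 -polyC1 nderivnC /= bin0n.
- by rewrite nderivn0 bin0 subn0.
- have e (p : {poly A}) : (p * ('X - z%:P))^`N(j.+1) = p^`N(j) + p^`N(j.+1) * ('X - z%:P).
    have -> : p * ('X - z%:P) = (p * 'X + 0%:P) - z *: p by rewrite -mul_polyC; ring.
    by rewrite nderivnB nderivnMXaddC nderivnZ -mul_polyC; ring.
  rewrite exprSr e !IH subSS binS mulrnDr addrC; congr (_ + _).
  case: (ltnP j l) => jl.
    by rewrite mulrnAl -exprSr subnSK.
  by rewrite bin_small // !mulr0n mul0r.
Qed.

Section Eval.
Variables (N B : nat) (U V : {poly int}).
Hypotheses (sU : (size U <= N.+1)%N) (sV : (size V <= N.+1)%N).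
Hypothesis hB : forall l, `|U`_l| <= B%:Z /\ `|V`_l| <= B%:Z.
Local Notation PC p := (map_poly (intr : int -> C) p).

Let sUC : (size (PC U) <= N.+1)%N. Proof. by rewrite (leq_trans (size_poly _ _)). Qed.
Let sVC : (size (PC V) <= N.+1)%N. Proof. by rewrite (leq_trans (size_poly _ _)). Qed.

Let cnU l : cn (PC U)`_l <= B%:R.
Proof. by rewrite coef_map /= cn_int; have [+ _] := hB l; rewrite -(ler_int R). Qed.
Let cnV l : cn (PC V)`_l <= B%:R.
Proof. by rewrite coef_map /= cn_int; have [_] := hB l; rewrite -(ler_int R). Qed.

Variables (x1 y1 x2 y2 : int).
Hypotheses (y10 : y1 != 0) (y20 : y2 != 0).
Let z : C := x1%:~R / y1%:~R.
Let Y : C := x2%:~R / y2%:~R.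

Let y1C : (y1%:~R : C) != 0. Proof. by rewrite intr_eq0. Qed.
Let y2C : (y2%:~R : C) != 0. Proof. by rewrite intr_eq0. Qed.

Lemma eval_scaled (p : {poly int}) j : (size p <= N.+1)%N -> (j <= N)%N ->
  (y1%:~R : C) ^+ (N - j) * ((PC p)^`N(j)).[z] =
  (\sum_(l < N.+1) p`_l * 'C(l, j)%:R * (x1 ^+ (l - j) * y1 ^+ (N - l)))%:~R.
Proof.
move=> sp jN.
rewrite (horner_nderivn_sum _ _ (_ : (size (PC p) <= N.+1)%N)); last first.
  by rewrite (leq_trans (size_poly _ _)).
rewrite mulr_sumr rmorph_sum /=; apply: eq_bigr => l _.
rewrite coef_map /= !rmorphM /= rmorph_nat; case: (ltnP l j) => lj.
  by rewrite bin_small // !(mulr0, mul0r).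
have -> : (N - j = (N - l) + (l - j))%N by rewrite addnBA // subnK // -ltnS.
rewrite exprD expr_div_n !rmorphXn /=.
have : (y1%:~R : C) ^+ (l - j) != 0 by rewrite expf_neq0.
move: ((y1%:~R : C) ^+ (l - j)) => w w0; field; exact: w0.
Qed.

(** The factors in [y1] and [y2] clear the denominators and leave the modulus of a nonzero
    integer. *)
Lemma eval_ge1 j : (j <= N)%N ->
  ((PC U)^`N(j)).[z] - Y * ((PC V)^`N(j)).[z] != 0 ->
  1 <= cn y1%:~R ^+ (N - j) * cn y2%:~R * cn (((PC U)^`N(j)).[z] - Y * ((PC V)^`N(j)).[z]).
Proof.
move=> jN q0; rewrite -cnX -!cnM.
have E : (y1%:~R : C) ^+ (N - j) * y2%:~R * (((PC U)^`N(j)).[z] - Y * ((PC V)^`N(j)).[z]) =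
   (y2 * (\sum_(l < N.+1) U`_l * 'C(l, j)%:R * (x1 ^+ (l - j) * y1 ^+ (N - l))) -
    x2 * (\sum_(l < N.+1) V`_l * 'C(l, j)%:R * (x1 ^+ (l - j) * y1 ^+ (N - l))))%:~R.
  rewrite rmorphB !rmorphM /= -!eval_scaled // /Y.
  by move: (_.[z]) (_.[z]) => *; field.
have : (y1%:~R : C) ^+ (N - j) * y2%:~R * (((PC U)^`N(j)).[z] - Y * ((PC V)^`N(j)).[z]) != 0.
  by rewrite !mulf_neq0 // expf_neq0.
rewrite E intr_eq0 cn_int ler1z; move: (_ - _) => t t0; lia.
Qed.

Lemma eval_V_le j (K : R) : (j <= N)%N -> 1 <= K -> cn x1%:~R <= K -> cn y1%:~R <= K ->
  cn y1%:~R ^+ (N - j) * cn ((PC V)^`N(j)).[z] <= B%:R * 2 ^+ N.+1 * K ^+ N.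
Proof.
move=> jN K1 xK yK; have K0 : 0 <= K by rewrite (le_trans ler01).
rewrite (horner_nderivn_sum _ _ sVC).
apply: le_trans (ler_wpM2l _ (cn_sum _ _ _)) _; first by rewrite exprn_ge0 ?cn_ge0.
apply: (@le_trans _ _ (\sum_(l < N.+1) B%:R * 2 ^+ l * K ^+ N)); last first.
  rewrite -!mulr_suml -mulr_sumr ler_wpM2r ?exprn_ge0 // ler_wpM2l ?ler0n //.
  exact: sum_exp2.
rewrite mulr_sumr; apply: ler_sum => l _; rewrite !cnM cn_nat cnX.
case: (ltnP l j) => lj.
  by rewrite bin_small // mulr0 mul0r mulr0 !mulr_ge0 ?exprn_ge0 ?ler0n.
rewrite mulrCA ler_pM ?mulr_ge0 ?exprn_ge0 ?cn_ge0 ?ler0n //.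
  rewrite ler_pM ?cn_ge0 ?ler0n //.
  by rewrite -natrX ler_nat bin_le_exp2.
have -> : (N - j = (N - l) + (l - j))%N by rewrite addnBA // subnK // -ltnS.
rewrite exprD -mulrA -exprMn -cnM (_ : y1%:~R * z = x1%:~R); last by rewrite /z; field.
apply: (@le_trans _ _ (K ^+ (N - j))).
  have -> : (N - j = (N - l) + (l - j))%N by rewrite addnBA // subnK // -ltnS.
  rewrite exprD ler_pM ?exprn_ge0 ?cn_ge0 //;
    by rewrite lerXn2r ?nnegrE ?cn_ge0.
by rewrite ler_weXn2l // leq_subr.
Qed.

Variables (alpha : C) (k J : nat) (kap : R).
Hypothesis vanish : forall j, (j < k)%N -> ((PC U)^`N(j)).[alpha] = alpha * ((PC V)^`N(j)).[alpha].
Hypothesis kN : (k <= N)%N.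
Hypothesis Jk : (J <= k)%N.
Let m : R := Num.max 1 (cn alpha).
Let dlt : R := cn (x1%:~R - alpha * y1%:~R).
Hypothesis kap1 : 1 <= kap.
Hypothesis kap_ge : m * cn y1%:~R <= kap.
Hypothesis dlt1 : dlt <= 1.

Let m1 : 1 <= m. Proof. by rewrite le_max lexx. Qed.
Let m0 : 0 <= m. Proof. exact: le_trans m1. Qed.

Lemma coef_taylor_le l : (l <= N)%N ->
  cn ((PC U - alpha *: PC V)^`N(l)).[alpha] <= B%:R * (2 ^+ N.+2 * m ^+ (N.+1 - l)).
Proof.
move=> lN; rewrite nderivnB nderivnZ hornerD hornerN hornerZ.
rewrite (horner_nderivn_sum _ _ sUC) (horner_nderivn_sum _ _ sVC).
have S (p : {poly C}) : (forall i, cn p`_i <= B%:R) ->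
   cn (\sum_(i < N.+1) p`_i * 'C(i, l)%:R * alpha ^+ (i - l)) * m <= B%:R * (2 ^+ N.+1 * m ^+ (N.+1 - l)).
  move=> hp; apply: le_trans (ler_wpM2r m0 (cn_sum _ _ _)) _; rewrite mulr_suml.
  apply: (@le_trans _ _ (B%:R * \sum_(i < N.+1) 'C(i, l)%:R * cn alpha ^+ (i - l) * m)).
    rewrite mulr_sumr; apply: ler_sum => i _; rewrite !cnM cn_nat cnX -!mulrA.
    by rewrite ler_wpM2r // !mulr_ge0 ?exprn_ge0 ?cn_ge0 ?ler0n.
  rewrite ler_wpM2l ?ler0n //.
  by apply: sum_bin_pow; rewrite ?cn_ge0 // ?(leq_trans lN) // le_max lexx orbT.
apply: (le_trans (cnB _ _)).
have -> : 2 ^+ N.+2 * m ^+ (N.+1 - l) = 2 ^+ N.+1 * m ^+ (N.+1 - l) + 2 ^+ N.+1 * m ^+ (N.+1 - l).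
  by rewrite [2 ^+ N.+2]exprS; ring.
rewrite mulrDr; apply: lerD.
  by apply: le_trans (S _ cnU); rewrite ler_peMr ?cn_ge0.
by apply: le_trans (S _ cnV); rewrite cnM mulrC ler_wpM2l ?cn_ge0 // le_max lexx orbT.
Qed.

(** Taylor expansion at [alpha]: terms of order below [k] vanish, and in the others the powers of
    [y1] turn [z - alpha] into [dlt <= 1], to a power of at least [k - J]. *)
Lemma eval_UV_le j : (j <= J)%N ->
  cn y1%:~R ^+ (N - j) * cn ((PC U - alpha *: PC V)^`N(j)).[z] <=
  B%:R * 2 ^+ N.+2 * 2 ^+ N.+1 * m * kap ^+ (N - k) * dlt ^+ (k - J).
Proof.
move=> jJ; set W := PC U - alpha *: PC V.
have sW : (size W <= N.+1)%N.
  rewrite (leq_trans (size_polyD _ _)) // size_polyN geq_max sUC /=.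
  by rewrite (leq_trans (size_scale_leq _ _)).
have d0 : 0 <= dlt by rewrite cn_ge0.
have kap0 : 0 <= kap by rewrite (le_trans ler01).
have -> : (W^`N(j)).[z] = \sum_(l < N.+1) (W^`N(l)).[alpha] * ((z - alpha) ^+ (l - j) * 'C(l, j)%:R).
  rewrite {1}(taylor_poly alpha sW) linear_sum /= horner_sum; apply: eq_bigr => l _.
  by rewrite linearZ /= nderivn_XsubC_exp hornerZ hornerMn horner_exp hornerXsubC mulr_natr.
apply: le_trans (ler_wpM2l _ (cn_sum _ _ _)) _; first by rewrite exprn_ge0 ?cn_ge0.
set Q := m * kap ^+ (N - k) * dlt ^+ (k - J).
have Q0 : 0 <= Q by rewrite !mulr_ge0 ?exprn_ge0.
apply: (@le_trans _ _ (\sum_(l < N.+1) B%:R * 2 ^+ N.+2 * 2 ^+ l * Q)); last first.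
  apply: (@le_trans _ _ (B%:R * 2 ^+ N.+2 * 2 ^+ N.+1 * Q)); last by rewrite /Q !mulrA.
  rewrite -mulr_suml -mulr_sumr ler_wpM2r //.
  by apply: ler_wpM2l; [rewrite mulr_ge0 ?exprn_ge0 ?ler0n | exact: sum_exp2].
rewrite mulr_sumr; apply: ler_sum => l _.
have Q2 : 0 <= B%:R * 2 ^+ N.+2 * 2 ^+ l * Q
  by apply: mulr_ge0 Q0; apply: mulr_ge0; rewrite ?exprn_ge0 // mulr_ge0 ?exprn_ge0 ?ler0n.
case: (ltnP l k) => lk.
  rewrite (_ : (W^`N(l)).[alpha] = 0) ?mul0r ?cn0 ?mulr0 //.
  by rewrite /W nderivnB nderivnZ hornerD hornerN hornerZ vanish // subrr.
have lN : (l <= N)%N by rewrite -ltnS.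
have jl : (j <= l)%N by rewrite (leq_trans jJ) // (leq_trans Jk).
rewrite !cnM cn_nat cnX.
have E : cn y1%:~R ^+ (N - j) * cn (z - alpha) ^+ (l - j) = cn y1%:~R ^+ (N - l) * dlt ^+ (l - j).
  have -> : (N - j = (N - l) + (l - j))%N by rewrite addnBA // subnK.
  rewrite exprD -mulrA -exprMn -cnM; congr (_ * cn _ ^+ _).
  by rewrite /z; field.
rewrite mulrCA [X in _ * X]mulrA E.
apply: (@le_trans _ _ (B%:R * (2 ^+ N.+2 * m ^+ (N.+1 - l)) * (cn y1%:~R ^+ (N - l) * dlt ^+ (l - j) * 2 ^+ l))).
  rewrite ler_pM ?cn_ge0 ?coef_taylor_le //; first by rewrite !mulr_ge0 ?exprn_ge0 ?cn_ge0 ?ler0n.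
  rewrite ler_wpM2l ?mulr_ge0 ?exprn_ge0 ?cn_ge0 //.
  by rewrite -natrX ler_nat bin_le_exp2.
have -> : B%:R * (2 ^+ N.+2 * m ^+ (N.+1 - l)) * (cn y1%:~R ^+ (N - l) * dlt ^+ (l - j) * 2 ^+ l) =
   B%:R * 2 ^+ N.+2 * 2 ^+ l * (m * (m * cn y1%:~R) ^+ (N - l) * dlt ^+ (l - j)).
  by rewrite subSn // [m ^+ _.+1]exprS exprMn; ring.
apply: ler_wpM2l.
  by apply: mulr_ge0; rewrite ?exprn_ge0 // mulr_ge0 ?exprn_ge0 ?ler0n.
have my0 : 0 <= m * cn (y1%:~R : C) by rewrite mulr_ge0 ?cn_ge0.
rewrite /Q; apply: ler_pM; [by rewrite mulr_ge0 ?exprn_ge0|by rewrite exprn_ge0|..].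
  rewrite ler_wpM2l //; apply: (@le_trans _ _ (kap ^+ (N - l))).
    by rewrite lerXn2r ?nnegrE.
  by rewrite ler_weXn2l // leq_sub2l.
by rewrite ler_wiXn2l // leq_sub.
Qed.

(** In [U - Y V = (U - alpha V) + (alpha - Y) V] the first term is small by the first solution and
    the second by the second one. *)
Lemma eval_le (K : R) j : (j <= J)%N -> 1 <= K -> cn x1%:~R <= K -> cn y1%:~R <= K ->
  ((PC U)^`N(j)).[z] - Y * ((PC V)^`N(j)).[z] != 0 ->
  1 <= cn (x2%:~R - alpha * y2%:~R) * (B%:R * 2 ^+ N.+1 * K ^+ N) +
       cn y2%:~R * (B%:R * 2 ^+ N.+2 * 2 ^+ N.+1 * m * kap ^+ (N - k) * dlt ^+ (k - J)).
Proof.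
move=> jJ K1 xK yK q0.
have jN : (j <= N)%N by rewrite (leq_trans jJ) // (leq_trans Jk).
apply: le_trans (eval_ge1 jN q0) _.
have -> : ((PC U)^`N(j)).[z] - Y * ((PC V)^`N(j)).[z] =
   ((PC U - alpha *: PC V)^`N(j)).[z] + (alpha - Y) * ((PC V)^`N(j)).[z].
  by rewrite nderivnB nderivnZ hornerD hornerN hornerZ; ring.
apply: le_trans (ler_wpM2l _ (cnD _ _)) _.
  by rewrite mulr_ge0 ?exprn_ge0 ?cn_ge0.
rewrite mulrDr addrC; apply: lerD; last first.
  rewrite [cn y1%:~R ^+ _ * _]mulrC -[leLHS]mulrA.
  by apply: ler_wpM2l; [exact: cn_ge0 | exact: eval_UV_le].
rewrite cnM.
have -> : cn (x2%:~R - alpha * y2%:~R) = cn y2%:~R * cn (alpha - Y).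
  by rewrite -cnM -cnN; congr cn; rewrite /Y; field.
rewrite [leLHS](_ : _ = cn y2%:~R * cn (alpha - Y) * (cn y1%:~R ^+ (N - j) * cn ((PC V)^`N(j)).[z])).
  by rewrite ler_wpM2l ?mulr_ge0 ?cn_ge0 // eval_V_le.
by ring.
Qed.

End Eval.
End ThueGap.

(** * Two good approximations of one root exclude each other *)

Section ThueContradiction.
Variable R : realType.
Local Notation C := R[i].
Lemma sum_nat_sub_ord (m l : nat) : (l <= m.+1)%N ->
  \sum_(j < l) (m.+1 - j)%:R = l%:R * (m%:R + 3 / 2 - l%:R / 2) :> R.
Proof.
elim: l => [|l IH] lm; first by rewrite big_ord0 mul0r.
by rewrite big_ord_recr /= IH 1?ltnW // natrB 1?ltnW // -!natr1; field.
Qed.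

(** The value of [ln B] required by [siegel_form] when [N.+1 = n p + u] and [k = 2 p]: the unknowns
    exceed the conditions by [2 u], and [G] bounds the Mahler measure. *)
Definition siegel_exponent (n p u N : nat) (G : R) : R :=
  p%:R / u%:R * (n%:R * N.+4%:R * ln 2 + (N%:R + 3 / 2 - p%:R) * G).

(** The two numerical hypotheses put both terms of [eval_le] below [1 / 2]. [J = 2 u + n - 3] is the
    least value that the zero estimate, used with [k.-1], allows. *)
Lemma thue_contradiction (n : nat) (a alpha : 'I_n -> C) (c : 'I_n -> 'I_n)
    (i : 'I_n) (x1 y1 x2 y2 : int) (K mm Y2 G : R) (p u N k J : nat) :
  (3 <= n)%N -> norm_integral a alpha -> (forall i, c (c i) = i) ->
  (forall i, alpha (c i) = ((alpha i)^*)%C) -> (forall i, a i != 0) ->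
  injective alpha -> 0 <= lnMM a alpha -> y1 != 0 -> y2 != 0 ->
  (forall j, x1%:~R - alpha j * y1%:~R != 0) -> x2%:~R - alpha i * y2%:~R != 0 ->
  1 <= K -> cn (x1%:~R : C) <= K -> cn (y1%:~R : C) <= K ->
  mu alpha i <= mm -> cn (y2%:~R : C) <= Y2 ->
  cn (x1%:~R - alpha i * y1%:~R) <= 1 -> lnMM a alpha <= G ->
  (0 < u)%N -> (2 * u + n <= 2 * p + 3)%N ->
  (N.+1 = n * p + u)%N -> (k = 2 * p)%N -> (J + 3 = 2 * u + n)%N ->
  ln (cn (x2%:~R - alpha i * y2%:~R)) + siegel_exponent n p u N G
    + (N%:R + 3) * ln 2 + N%:R * ln K < 0 ->
  ln Y2 + siegel_exponent n p u N G + (2 * N%:R + 5) * ln 2 + ln mm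
   + (N%:R - k%:R) * (ln 2 + ln K)
   + (k%:R - J%:R) * ln (cn (x1%:~R - alpha i * y1%:~R)) < 0 -> False.
Proof.
move=> n3 HI cc alphaJ a0 inja MM0 y10 y20 L1 L2 K1 x1K y1K mu_le y2Y d1 MMG u0 pu NE kE JE.
set dlt1 := cn (x1%:~R - _) in d1 *; set dlt2 := cn (x2%:~R - _).
set se := siegel_exponent n p u N G => ha hb.
have np3 : (3 * p <= n * p)%N by rewrite leq_mul2r n3 orbT.
have k0 : (0 < k)%N by move: kE JE pu u0 n3; clear; lia.
have kN : (k <= N)%N by move: np3 NE kE u0; clear; lia.
have Jk : (J <= k)%N by move: JE kE pu; clear; lia.
have ln2 : 0 < ln 2 :> R by rewrite ln_gt0 // ltr1n.
have uR : 0 < u%:R :> R by rewrite ltr0n.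
have pR : 0 <= p%:R :> R by rewrite ler0n.
have pN : p%:R <= N%:R :> R by rewrite ler_nat; move: np3 NE u0; clear; lia.
have b0 : 0 <= se.
  rewrite /se /siegel_exponent mulr_ge0 ?divr_ge0 ?ler0n // addr_ge0 //.
    by rewrite !mulr_ge0 ?ler0n // ltW.
  by apply: mulr_ge0; [move: pN; clear; lra | exact: le_trans MM0 MMG].
(* Rounding [expR se] up to an integer costs at most [ln 2], as [se >= 0]. *)
have [B [Bn lB1 lB2]] : exists B : nat,
    [/\ (0 < B)%N, se <= ln (B%:R : R) & ln (B%:R : R) <= se + ln 2].
  have t1 := truncnS_gt (expR se).
  have : (Num.truncn (expR se))%:R <= expR se.
    by rewrite truncn_le expR_ge0.
  have e1 : 1 <= expR se by rewrite -expR0 ler_expR.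
  move: (Num.truncn _) t1 => T t1 t2; exists T.+1; split => //.
    by rewrite -ler_expR lnK ?posrE ?ltr0n // ltW.
  rewrite -ler_expR lnK ?posrE ?ltr0n // expRD lnK ?posrE //.
  by rewrite -natr1; move: t2 e1; clear; lra.
have B0 : 0 < B%:R :> R by rewrite ltr0n.
have NER : N.+1%:R = n%:R * p%:R + u%:R :> R by rewrite -natrM -natrD NE.
have kER : k%:R = 2 * p%:R :> R by rewrite kE natrM.
have hS : (k * n)%:R * (N.+4%:R * ln 2 + ln B%:R) + (\sum_(j < k) (N.+1 - j)%:R) * lnMM a alpha
    <= 2 * N.+1%:R * ln B%:R.
  rewrite sum_nat_sub_ord 1?leqW // natrM kER NER.
  have hG : (N%:R + 3 / 2 - p%:R) * lnMM a alpha <= (N%:R + 3 / 2 - p%:R) * G.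
    by apply: ler_wpM2l => //; move: pN; clear; lra.
  have : p%:R * (n%:R * N.+4%:R * ln 2 + (N%:R + 3 / 2 - p%:R) * G) <= u%:R * ln B%:R.
    have : u%:R * se <= u%:R * ln B%:R by rewrite ler_wpM2l // ltW.
    apply: le_trans; rewrite /se /siegel_exponent le_eqVlt; apply/orP; left; apply/eqP.
    by field; rewrite gt_eqF.
  have := ler_wpM2l pR hG; clear; lra.
have [U [V [[sU sV] UV0 hB vanish]]] :=
  siegel_form (ltn_trans (isT : 0 < 2)%N n3) HI cc alphaJ (leqW kN) Bn MM0 a0 hS.
pose PC q := map_poly (intr : int -> C) q.
have PC0 q : PC q = 0 -> q = 0.
  move=> h; apply/polyP => l; have /eqP := congr1 (fun r : {poly C} => r`_l) h.
  by rewrite coef_map !coef0 /= intr_eq0 => /eqP.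
have y1C : (y1%:~R : C) != 0 by rewrite intr_eq0.
have [j jJ q0] : exists2 j, (j <= J)%N & ((PC U)^`N(j)).[x1%:~R / y1%:~R]
     - (x2%:~R / y2%:~R) * ((PC V)^`N(j)).[x1%:~R / y1%:~R] != 0.
  apply: (@wronskian_zero_estimate _ n alpha (PC U) (PC V) N k.-1) => //.
  - move=> j; apply: contra (L1 j) => /eqP e.
    by rewrite -e divfK // subrr.
  - by rewrite (leq_trans (size_poly _ _)).
  - by rewrite (leq_trans (size_poly _ _)).
  - by case/orP: UV0 => h; apply/orP; [left|right]; apply: contra h => /eqP/PC0 ->.
  - move=> j; apply: dvdp_XsubC_exp => l lk.
    rewrite nderivnB nderivnZ hornerD hornerN hornerZ vanish ?subrr //.
    by rewrite -(prednK k0).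
  - rewrite prednK // -subn1 mulnBl mul1n kE mulnCA.
    by move: np3 NE pu u0 n3; clear; lia.
  - rewrite -(subn1 k) mulnBr muln1 kE mulnCA.
    by move: np3 NE JE pu u0 n3; clear; lia.
pose kap := 2 * K.
have al_le : cn (alpha i) * cn (y1%:~R : C) <= kap.
  rewrite -cnM (_ : alpha i * y1%:~R = x1%:~R - (x1%:~R - alpha i * y1%:~R)); last by ring.
  by rewrite (le_trans (cnB _ _)) // -/dlt1 /kap; move: d1 x1K K1; clear; lra.
have kap1 : 1 <= kap by rewrite /kap; move: K1; clear; lra.
have kap_ge : Num.max 1 (cn (alpha i)) * cn (y1%:~R : C) <= kap.
  by rewrite maxr_pMl ?cn_ge0 // ge_max al_le mul1r andbT /kap; move: y1K K1; clear; lra.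
have := eval_le sU sV hB y10 y20 (fun j => @vanish i j) kN Jk kap1 kap_ge d1 jJ K1 x1K y1K q0.
rewrite -/dlt1 -/dlt2.
have K0 : 0 < K by rewrite (lt_le_trans ltr01).
have D1 : 0 < dlt1 by rewrite cn_gt0.
have D2 : 0 < dlt2 by rewrite cn_gt0.
have m0 : 0 < mu alpha i by rewrite mu_gt0.
have mm0 : 0 < mm := lt_le_trans m0 mu_le.
have y2R : 0 < cn (y2%:~R : C) by rewrite cn_gt0 intr_eq0.
have Y20 : 0 < Y2 := lt_le_trans y2R y2Y.
have p2 l : 0 < (2 : R) ^+ l by rewrite exprn_gt0.
have lh : ln (1 / 2) = - ln 2 :> R by rewrite lnDiv // ln1 sub0r.
have lt_half (x : R) : 0 < x -> ln x < - ln 2 -> x < 1 / 2.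
  by move=> x0; rewrite -lh ltr_ln ?posrE // divr_gt0.
have pK l : 0 < K ^+ l by rewrite exprn_gt0.
have kp0 : 0 < kap by rewrite (lt_le_trans ltr01).
have pk l : 0 < kap ^+ l by rewrite exprn_gt0.
have pD l : 0 < dlt1 ^+ l by rewrite exprn_gt0.
have T2 : dlt2 * (B%:R * 2 ^+ N.+1 * K ^+ N) < 1 / 2.
  have g1 := mulr_gt0 B0 (p2 N.+1); have g2 := mulr_gt0 g1 (pK N).
  apply: lt_half; first exact: mulr_gt0 D2 g2.
  rewrite (lnMp D2 g2) (lnMp g1 (pK N)) (lnMp B0 (p2 _)) !lnX // -natr1.
  by move: ha lB2; clear; lra.
have T1 : cn (y2%:~R : C) * (B%:R * 2 ^+ N.+2 * 2 ^+ N.+1 * mu alpha i * kap ^+ (N - k) * dlt1 ^+ (k - J)) < 1 / 2.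
  have g1 := mulr_gt0 B0 (p2 N.+2); have g2 := mulr_gt0 g1 (p2 N.+1).
  have g3 := mulr_gt0 g2 m0; have g4 := mulr_gt0 g3 (pk (N - k)%N).
  have g5 := mulr_gt0 g4 (pD (k - J)%N).
  apply: lt_half; first exact: mulr_gt0 y2R g5.
  rewrite (lnMp y2R g5) (lnMp g4 (pD _)) (lnMp g3 (pk _)) (lnMp g2 m0) (lnMp g1 (p2 _)).
  rewrite (lnMp B0 (p2 _)) !lnX // !natrB // /kap (lnMp _ K0) //.
  have := le_ln y2R y2Y; have := le_ln m0 mu_le.
  by rewrite -[N.+2%:R]natr1 -[N.+1%:R]natr1; move: hb lB2; clear; lra.
move: T1 T2; rewrite /mu; clear; lra.
Qed.

End ThueContradiction.

(** * Choice of the degrees in Thue's method *)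

Section Numerics.
Variable R : realType.

(* The parameters [p], [u] of the auxiliary polynomials: [p] is chosen so that
   [(nu + 2.06) p X] is just below [nu Z], and [u] is [p / 10] rounded up. *)
Lemma thue_parameters_core (nu eta s X Z P u : R) :
  3 <= nu -> 0 < s -> s <= eta -> nu * (64 / 5 * eta + 256 / 5 * s) <= X ->
  10 <= P -> 1 <= u -> P <= 10 * u -> 10 * u <= P + 9 -> u <= P - 9 ->
  (nu + 103 / 50) * P * X <= nu * Z ->
  nu * Z < (nu + 103 / 50) * (P + 1) * X ->
  (2 * nu ^+ 2 + nu) * u + nu ^+ 3 - 2 * nu ^+ 2 + 103 / 50
    < P * (nu ^+ 2 - 491 / 500 * nu - 103 / 50) ->
  forall (l2 lt N : R), 0 <= l2 -> 0 <= lt ->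
  (nu + 1) * l2 <= 10 / 9 * s -> (nu + 1) * lt <= 3 / 4 * s ->
  N = (nu + 1) * P + u - 1 ->
  let se := P / u * ((nu + 1) * (N + 4) * l2 + (N + 3 / 2 - P) * (eta + (nu + 1) * lt)) in
  - (nu * (Z - 9 / 10 * s) + (nu - 10 / 9) * s) + se + (N + 3) * l2
     + N * (lt + (X + eta - 9 / 10 * s)) < 0 /\
  (Z + eta - 9 / 10 * s) + se + (2 * N + 5) * l2 + (lt + eta)
    + (N - 2 * P) * (l2 + (lt + (X + eta - 9 / 10 * s)))
    - (2 * P - (2 * u + nu - 2)) * (nu * (X - 9 / 10 * s) + (nu - 10 / 9) * s) < 0.
Proof.
move=> nu3 s0 seta hX P10 u1 Pu1 Pu2 Pu3.
have nu0 : 0 < nu by clear -nu3; lra.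
have P0 : 0 < P by clear -P10; lra.
have u0 : 0 < u by clear -u1; lra.
have eta0 : 0 < eta := lt_le_trans s0 seta.
have X0 : 0 < X.
  by apply: lt_le_trans hX; apply: mulr_gt0 => //; clear -eta0 s0; lra.
have nuP : 3 * P <= nu * P by apply: ler_wpM2r => //; exact: ltW.
have Pns : 0 <= P * nu * s by rewrite !mulr_ge0 // ltW.
have Pne : 0 <= P * nu * eta by rewrite !mulr_ge0 // ltW.
have PX : 0 <= P * X by rewrite mulr_ge0 // ltW.
have c11 : 0 <= 119 / 125 * P by clear -P0; lra.
have c12 : 0 <= 3 / 100 * P by clear -P0; lra.
have hX1 := ler_wpM2l c11 hX; have hX2 := ler_wpM2l c12 hX.
move=> hZ1 hZ2 hQ l2 lt N l20 lt0 hl2 hlt NE se.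
have N0 : 0 <= N by rewrite NE; clear -nuP P10 u1; lra.
have NP : 0 <= N + 3 / 2 - P by rewrite NE; clear -nuP P10 u1; lra.
have Nk : 0 <= N - 2 * P by rewrite NE; clear -nuP P10 u1; lra.
have l2s : l2 <= 5 / 18 * s by have := ler_wpM2r l20 nu3; clear -hl2; lra.
have lts : lt <= 3 / 16 * s by have := ler_wpM2r lt0 nu3; clear -hlt; lra.
have nl : 0 <= (nu + 1) * lt by apply: mulr_ge0 => //; clear -nu0; lra.
have N4 : 0 <= N + 4 by clear -N0; lra.
have se_le : se <= 10 * (10 / 9 * (N + 4) * s + (N + 3 / 2 - P) * (eta + 3 / 4 * s)).
  have b1 : (nu + 1) * (N + 4) * l2 <= 10 / 9 * (N + 4) * s.
    by have := ler_wpM2l N4 hl2; clear; lra.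
  have b2 : (N + 3 / 2 - P) * (eta + (nu + 1) * lt) <= (N + 3 / 2 - P) * (eta + 3 / 4 * s).
    by apply: ler_wpM2l => //; rewrite lerD2l.
  have b3 : 0 <= (nu + 1) * (N + 4) * l2 + (N + 3 / 2 - P) * (eta + (nu + 1) * lt).
    apply: addr_ge0; last by apply: mulr_ge0 => //; rewrite addr_ge0 // ltW.
    by apply: mulr_ge0 => //; apply: mulr_ge0 => //; clear -nu0; lra.
  have b4 : P / u <= 10 by rewrite ler_pdivrMr.
  have b5 : 0 <= P / u by rewrite divr_ge0 // ltW.
  by rewrite /se; apply: ler_pM => //; apply: lerD.
clearbody se.
(* Nearly all of [64 / 5] is used here. With the [11 / 10] of [e3] below, [119 / 125] adds up to
   [513 / 250], just under the [103 / 50] in the choice of [P]. *)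
have hS : se + N * eta <= 119 / 125 * P * X.
  have c1 : 10 * (N + 3 / 2 - P) + N <= 609 / 50 * (nu * P).
    by rewrite NE; clear -nuP P10 Pu2; lra.
  have c2 : 10 * (10 / 9 * (N + 4) + 3 / 4 * (N + 3 / 2 - P)) <= 48 * (nu * P).
    by rewrite NE; clear -nuP P10 Pu2; lra.
  have d1 := ler_wpM2r (ltW eta0) c1; have d2 := ler_wpM2r (ltW s0) c2.
  by clear -se_le d1 d2 hX1 Pns Pne; lra.
split.
  have N3 : 0 <= N + 3 by clear -N0; lra.
  have e1 := ler_wpM2l N3 l2s; have e2 := ler_wpM2l N0 lts.
  have e3 : N * X <= ((nu + 11 / 10) * P - 1 / 10) * X.
    by apply: ler_wpM2r; [exact: ltW | rewrite NE; clear -Pu2; lra].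
  have e4 : 39 * s <= N * s.
    by apply: ler_wpM2r; [exact: ltW | rewrite NE; clear -nuP P10 u1; lra].
  have e5 := ler_wpM2r (ltW s0) nu3.
  by clear -hS e1 e2 e3 e4 e5 PX s0 X0 hZ1; lra.
have kJ : 2 * P - (2 * u + nu - 2) <= 2 * P by clear -u1 nu3; lra.
have kJ0 : 0 <= 2 * P - (2 * u + nu - 2).
  rewrite -(pmulr_rge0 _ (exprn_gt0 2 nu0)).
  have e1 : 0 <= P * nu ^+ 2 by apply: mulr_ge0; [exact: ltW | exact: sqr_ge0].
  have e2 : 0 <= nu * u by rewrite mulr_ge0 // ltW.
  have e3 : 0 <= P * nu by rewrite mulr_ge0 // ltW.
  by clear -e1 e2 e3 hQ P0; lra.
have NPb : N <= (nu + 11 / 10) * P by rewrite NE; clear -Pu2; lra.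
have hc : (2 * N + 5) * l2 + lt + (N - 2 * P) * (l2 + lt - 9 / 10 * s) - 9 / 10 * s
    + (2 * P - (2 * u + nu - 2)) * ((10 / 9 - nu / 10) * s) <= 3 / 100 * P * X.
  have N5 : 0 <= 2 * N + 5 by clear -N0; lra.
  have f1 := ler_wpM2l N5 l2s.
  have f2 : (N - 2 * P) * (l2 + lt - 9 / 10 * s) <= 0.
    by apply: mulr_ge0_le0 => //; clear -l2s lts s0; lra.
  have f3 : (2 * P - (2 * u + nu - 2)) * ((10 / 9 - nu / 10) * s)
     <= (2 * P - (2 * u + nu - 2)) * (41 / 50 * s).
    by apply: ler_wpM2l => //; apply: ler_wpM2r; [exact: ltW | clear -nu3; lra].
  have s1 : 0 <= 41 / 50 * s by clear -s0; lra.
  have f4 := ler_wpM2r s1 kJ.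
  have f5 := ler_wpM2r (ltW s0) NPb.
  have f6 := ler_wpM2r (ltW s0) P10.
  have f7 := ler_wpM2r (ltW s0) nuP.
  by clear -f1 f2 f3 f4 f5 f6 f7 hX2 Pne Pns lts; lra.
(* The factor [nu] lets [hZ2] replace [nu * Z]; the remaining margin is [hQ] times [X], in [g3]. *)
rewrite -(pmulr_rlt0 _ nu0).
have g1 := ler_wpM2l (ltW nu0) hS.
have g2 := ler_wpM2l (ltW nu0) hc.
have g3 : 0 < (P * (nu ^+ 2 - 491 / 500 * nu - 103 / 50) -
   ((2 * nu ^+ 2 + nu) * u + nu ^+ 3 - 2 * nu ^+ 2 + 103 / 50)) * X by rewrite mulr_gt0 // subr_gt0.
have g4 : 0 <= nu * ((2 * P - 2) * eta).
  by rewrite !mulr_ge0 ?(ltW eta0) ?(ltW nu0) //; clear -P10; lra.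
have g5 : 0 <= nu * X by rewrite mulr_ge0 // ltW.
have NX : N * X = ((nu + 1) * P + u - 1) * X by rewrite NE.
have NnX : nu * N * X = nu * ((nu + 1) * P + u - 1) * X by rewrite NE.
by clear -hZ2 g1 g2 g3 g4 g5 NX NnX; lra.
Qed.

End Numerics.

Section NumericsExistence.
Variable R : realType.

(** [X] and [Z] stand for the shifted logarithmic heights that [rel_gap] multiplies by [n - 1], and
    [s] for [l0]; the two conclusions are the numerical hypotheses of [thue_contradiction]. *)
Lemma thue_parameters (n : nat) (eta s X Z : R) : (4 <= n)%N ->
  0 < s -> s <= eta -> (n%:R - 1) * (64 / 5 * eta + 256 / 5 * s) <= X ->
  (n = 4%N -> 27 * X <= Z) -> ((5 <= n)%N -> (n%:R - 1) ^+ 2 * X <= Z) ->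
  exists p u : nat, [/\ (0 < u)%N, (2 * u + n <= 2 * p + 3)%N &
  forall (l2 lt : R) (N k J : nat), 0 <= l2 -> 0 <= lt ->
  n%:R * l2 <= 10 / 9 * s -> n%:R * lt <= 3 / 4 * s ->
  (N.+1 = n * p + u)%N -> (k = 2 * p)%N -> (J + 3 = 2 * u + n)%N ->
  let se := p%:R / u%:R * (n%:R * N.+4%:R * l2 + (N%:R + 3 / 2 - p%:R) * (eta + n%:R * lt)) in
  - ((n%:R - 1) * (Z - 9 / 10 * s) + (n%:R - 19 / 9) * s) + se + (N%:R + 3) * l2
     + N%:R * (lt + (X + eta - 9 / 10 * s)) < 0 /\
  (Z + eta - 9 / 10 * s) + se + (2 * N%:R + 5) * l2 + (lt + eta)
    + (N%:R - k%:R) * (l2 + (lt + (X + eta - 9 / 10 * s)))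
    - (k%:R - J%:R) * ((n%:R - 1) * (X - 9 / 10 * s) + (n%:R - 19 / 9) * s) < 0].
Proof.
move=> n4 s0 seta hX Z4 Z5; set nu : R := n%:R - 1.
have nE : n%:R = nu + 1 :> R by rewrite /nu; ring.
have n4R : 4 <= n%:R :> R by rewrite ler_nat.
have nu3 : 3 <= nu by rewrite /nu; clear -n4R; lra.
have nu0 : 0 < nu by clear -nu3; lra.
have eta0 : 0 < eta := lt_le_trans s0 seta.
rewrite -/nu in hX; have X0 : 0 < X.
  by apply: lt_le_trans hX; apply: mulr_gt0 => //; clear -eta0 s0; lra.
have nu2 : 0 < nu + 103 / 50 by clear -nu0; lra.
pose D := (nu + 103 / 50) * X.
have D0 : 0 < D by rewrite /D mulr_gt0.
have Z0 : 0 <= Z.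
  case: (ltngtP n 4) => [| n5 | /Z4]; [by rewrite ltnNge n4 | | clear -X0; lra].
  by rewrite (le_trans _ (Z5 n5)) // mulr_ge0 ?sqr_ge0 // ltW.
have r0 : 0 <= nu * Z / D by rewrite divr_ge0 ?mulr_ge0 // ltW.
have [p hp1 [hp2 pge]] : exists2 p : nat, p%:R * D <= nu * Z & nu * Z < (p%:R + 1) * D /\
    forall q : nat, q%:R * D <= nu * Z -> q%:R <= p%:R :> R.
  exists (Num.truncn (nu * Z / D)).
    by have := truncn_itv r0; rewrite -natr1 ler_pdivlMr // => /andP[].
  split; first by have := truncn_itv r0; rewrite -natr1 ltr_pdivrMr // => /andP[].
  by move=> q h; rewrite ler_nat truncn_ge_nat // ler_pdivlMr.
clear r0 Z0.
have sq5 : 5 <= nu -> 5 * nu <= nu ^+ 2 /\ 5 * nu ^+ 2 <= nu * nu ^+ 2.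
  move=> nu5; split; first by rewrite expr2; apply: ler_wpM2r => //; exact: ltW.
  by apply: ler_wpM2r => //; exact: sqr_ge0.
(* For [n = 4], [hQ] with [10 u <= p + 9] requires [p >= 16]. This is barely met by [Z >= 27 X], as
   [16 * 253 / 50 < 81]; the ratio [9] of two gap steps could leave [p = 5]. Hence a third step for
   quartic forms. *)
have cases : (nu = 3 /\ 16 <= p%:R :> R) \/ (nu = 4 /\ 10 <= p%:R :> R) \/
    (5 <= nu /\ 10 <= p%:R :> R /\ 17 / 5 * nu <= p%:R + 1 :> R).
  have [n6|n5] := ltnP 5 n; [right; right | case: (ltngtP n 4) => [|n5'|n4']].
  - have n6R : 6 <= n%:R :> R by rewrite ler_nat.
    have nu5 : 5 <= nu by rewrite /nu; clear -n6R; lra.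
    have [sq cu] := sq5 nu5.
    have Z5' := Z5 (ltnW n6); rewrite -/nu in Z5'.
    have h1 : nu * nu ^+ 2 * X <= nu * Z by rewrite -mulrA ler_wpM2l // ltW.
    split=> //; split.
      apply: (pge 10%N); apply: le_trans h1; rewrite /D mulrA ler_wpM2r ?(ltW X0) //.
      by clear -sq cu nu5; lra.
    have h2 : nu * nu ^+ 2 < (p%:R + 1) * (nu + 103 / 50).
      by rewrite -(ltr_pM2r X0) -[ltRHS]mulrA; apply: le_lt_trans hp2.
    rewrite leNgt; apply/negP => h3.
    by move: h3; rewrite -(ltr_pM2r nu2); clear -h2 sq cu nu5; lra.
  - by rewrite ltnNge n4.
  - right; left; have n5e : n = 5%N by clear -n5 n5'; lia.
    have nu4 : nu = 4 by rewrite /nu n5e; clear; lra.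
    split=> //; apply: (pge 10%N).
    by have := Z5 n5'; rewrite -/nu /D nu4 expr2; clear -X0; lra.
  - left; have nu3' : nu = 3 by rewrite /nu n4'; clear; lra.
    split=> //; apply: (pge 16%N).
    by have := Z4 n4'; rewrite /D nu3'; clear -X0; lra.
have p10 : 10 <= p%:R :> R by clear -cases; move: (p%:R) cases => P; lra.
have p10n : (10 <= p)%N by rewrite -(ler_nat R).
have [u [u1 u2 u3 u4]] : exists u : nat,
    [/\ (1 <= u)%N, (p <= 10 * u)%N, (10 * u <= p + 9)%N & (u + 9 <= p)%N].
  by exists ((p + 9) %/ 10)%N; clear -p10n; split; lia.
have u1R : 1 <= u%:R :> R by rewrite ler1n.
have {}u2 : p%:R <= 10 * u%:R :> R by rewrite -natrM ler_nat.
have {}u3 : 10 * u%:R <= p%:R + 9 :> R by rewrite -natrM -(natrD _ p 9) ler_nat.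
have {}u4 : u%:R + 9 <= p%:R :> R by rewrite -(natrD _ u 9) ler_nat.
have hQ : (2 * nu ^+ 2 + nu) * u%:R + nu ^+ 3 - 2 * nu ^+ 2 + 103 / 50
    < p%:R * (nu ^+ 2 - 491 / 500 * nu - 103 / 50).
  clear -cases u1R u2 u3 u4 sq5; move: (u%:R : R) (p%:R : R) u1R u2 u3 u4 cases => U P u1 u2 u3 u4.
  case=> [[-> h]|[[-> h]|[h1 [h2 h3]]]]; [by clear -h u3; lra | by clear -h u3 u4; lra |].
  have [sq cu] := sq5 h1.
  have q0 : 0 <= 2 * nu ^+ 2 + nu by clear -sq h1; lra.
  have q1 := ler_wpM2l q0 u3.
  have q2 : 0 <= (P - 16 / 5 * nu) * (4 / 5 * nu ^+ 2 - 541 / 500 * nu - 103 / 50).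
    by apply: mulr_ge0; [clear -h1 h3; lra | clear -sq h1; lra].
  rewrite (_ : nu ^+ 3 = nu * nu ^+ 2) ?exprS //.
  by clear -sq cu q1 q2 h1; lra.
exists p, u; split => //.
- rewrite -(ler_nat R) (natrD _ (2 * u) n) (natrD _ (2 * p) 3) !natrM nE.
  clear -cases u3; move: (u%:R : R) (p%:R : R) u3 cases => U P u3.
  by case=> [[-> h]|[[-> h]|[h1 [h2 h3]]]]; [clear -u3 h; lra | clear -u3 h; lra | clear -u3 h1 h2 h3; lra].
move=> l2 lt N k J l20 lt0 hl2 hlt NE kE JE.
have NR : N%:R = (nu + 1) * p%:R + u%:R - 1 :> R.
  by rewrite -nE -natrM -natrD -NE -natr1; ring.
have kR : k%:R = 2 * p%:R :> R by rewrite kE natrM.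
have JR : J%:R = 2 * u%:R + nu - 2 :> R.
  have := congr1 (fun t : nat => t%:R : R) JE; rewrite (natrD _ J 3) (natrD _ (2 * u) n) natrM nE; clear.
  by move: (J%:R : R) (u%:R : R) => ? ?; lra.
have N4 : N.+4%:R = N%:R + 4 :> R by rewrite -!natr1; ring.
rewrite nE N4 kR JR (_ : nu + 1 - 19 / 9 = nu - 10 / 9); last by field.
rewrite nE in hl2 hlt.
have u4' : u%:R <= p%:R - 9 :> R by rewrite lerBrDr.
apply: thue_parameters_core => //.
- by rewrite mulrAC -/D mulrC.
- by rewrite (_ : _ * X = (p%:R + 1) * D) // /D; ring.
Qed.

End NumericsExistence.

(** * Small solutions *)

Section Chains.
Variable R : realType.

Lemma seq_argmax (T : eqType) (f : T -> R) (s : seq T) : s != [::] ->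
  exists2 w, w \in s & forall v, v \in s -> f v <= f w.
Proof.
elim: s => // x [|y s] IH _.
  by exists x; rewrite ?mem_head // => v; rewrite inE => /eqP ->.
have [w ws hw] := IH isT; case: (leP (f w) (f x)) => h.
  exists x; rewrite ?mem_head // => v; rewrite inE => /orP[/eqP ->//|/hw].
  by move=> h'; apply: le_trans h.
exists w; first by rewrite inE ws orbT.
by move=> v; rewrite inE => /orP[/eqP ->|/hw //]; apply: ltW.
Qed.

(** In increasing order of [ly] each gain is at most the step to the next element, so the sum
    telescopes; the last element [w] has no next one. *)
Lemma chain_sum (T : eqType) (ly g : T -> R) (s : seq T) : uniq s ->
  (forall v, v \in s -> 0 <= ly v) ->
  (forall v v', v \in s -> v' \in s -> v != v' -> ly v <= ly v' -> ly v + g v <= ly v') ->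
  forall w, w \in s -> (forall v, v \in s -> ly v <= ly w) ->
  \sum_(v <- s | v != w) g v <= ly w.
Proof.
move: {2}(size s) (leqnn (size s)) => k; elim: k s => [|k IH] s hk us ly0 hg w ws hw.
  by move: hk; rewrite leqn0 size_eq0 => /eqP s0; rewrite s0 in ws.
rewrite -big_filter -rem_filter //.
have us' : uniq (rem w s) by rewrite rem_uniq.
have sub v : v \in rem w s -> v \in s by apply: mem_rem.
have [->|ne] := eqVneq (rem w s) [::]; first by rewrite big_nil ly0.
have [w' w's hw'] := seq_argmax ly ne.
rewrite (bigD1_seq w') //=.
have ne' : w' != w by move: w's; rewrite mem_rem_uniq // inE => /andP[].
have := hg w' w (sub _ w's) ws ne' (hw _ (sub _ w's)); apply: le_trans.
rewrite addrC lerD2r; apply: IH => //.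
- by rewrite size_rem // -ltnS (leq_trans _ hk) // prednK //; case: (s) ws.
- by move=> v /sub; apply: ly0.
- by move=> v v' /sub vs /sub vs'; apply: hg.
Qed.

Lemma uniq_fixed_image (I : finType) (T : eqType) (P : pred I) (f : I -> option T) (s : seq T) :
  uniq s -> (count (fun v => [exists i, P i && (f i == Some v)]) s <= #|P|)%N.
Proof.
move=> us; rewrite -size_filter.
set s' := filter _ s.
have us' : uniq s' by rewrite filter_uniq.
have sub : {subset map Some s' <= [seq f i | i <- enum P]}.
  move=> o /mapP[v]; rewrite mem_filter => /andP[/existsP[i /andP[Pi /eqP fi]] _] ->.
  by apply/mapP; exists i; rewrite ?mem_enum.
have := uniq_leq_size _ sub; rewrite map_inj_uniq ?size_map; last by move=> ? ? [].
by rewrite cardE; apply.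
Qed.

End Chains.

Section SmallSolutions.
Variable R : realType.
Local Notation C := R[i].

Definition tw : R := Num.sqrt (5 / 2).

Lemma tw_gt0 : 0 < tw. Proof. by rewrite sqrtr_gt0; lra. Qed.
Lemma tw2 : tw * tw = 5 / 2. Proof. by rewrite -expr2 sqr_sqrtr //; lra. Qed.
Lemma tw_ge1 : 1 <= tw. Proof. by rewrite -[1]sqrtr1 ler_wsqrtr //; lra. Qed.
Lemma ln_tw : 2 * ln tw = ln (5 / 2).
Proof. by rewrite -tw2 lnMp ?tw_gt0 //; ring. Qed.

Definition sa n (a : 'I_n -> C) i : C := tw%:C%C * a i.
Definition sb n (b : 'I_n -> C) i : C := b i / tw%:C%C.
Definition lf n (a b : 'I_n -> C) (v : int * int) i : C := a i * v.1%:~R - b i * v.2%:~R.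
Definition hgt (v : int * int) : R := Num.max (`|v.1|%:~R / tw) (tw * `|v.2|%:~R).
Definition cross (v w : int * int) : int := v.1 * w.2 - v.2 * w.1.

Lemma cn_sa n (a : 'I_n -> C) i : cn (sa a i) = tw * cn (a i).
Proof. by rewrite /sa cnM cn_real gtr0_norm ?tw_gt0. Qed.

Lemma cn_sb n (b : 'I_n -> C) i : cn (sb b i) = cn (b i) / tw.
Proof. by rewrite /sb cnM cnV cn_real gtr0_norm ?tw_gt0. Qed.

Lemma centered_residue (v y : int) : y != 0 -> exists k : int, 2 * `|v + k * y| <= `|y|.
Proof.
move=> y0; have := modz_ge0 v y0; have := ltz_mod v y0; have E := divz_eq v y.
set q := (v %/ y)%Z in E; set r := (v %% y)%Z in E *.
move=> h1 h2; case: (lerP (2 * r) `|y|) => h.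
  by exists (- q); rewrite (_ : v + - q * y = r); [lia | rewrite E; ring].
exists (- q - Num.sg y); rewrite (_ : v + (- q - Num.sg y) * y = r - `|y|).
  by lia.
by rewrite {1}E normrEsg; ring.
Qed.

(** A completion can be shifted by multiples of [v]; the centered residue bounds the ratio
    [w.2 / v.2] by [1 / 2], as [eta_le_gain] needs. *)
Lemma basis_completion (v : int * int) : coprimez v.1 v.2 -> v.2 != 0 ->
  exists w : int * int, cross v w = 1 /\ 2 * `|w.2| <= `|v.2|.
Proof.
case: v => x y /= cxy y0.
have [[s t] /= e] := coprimezP x y cxy.
have [k hk] := centered_residue s y0.
exists (- t + k * x, s + k * y); rewrite /cross /=; split => //.
rewrite -e; ring.
Qed.

Section Form.
Variables (n : nat) (a b : 'I_n -> C).
Hypothesis a0 : forall i, a i != 0.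

Local Notation A := (ht (sa a) (sb b)).
Local Notation et := (eta (sa a) (sb b)).
Definition la : R := \sum_i ln (cn (a i)).


Lemma A_gt0 i : 0 < A i.
Proof. by apply: ht_gt0 => j; rewrite mulf_neq0 // -cn_gt0 cn_real gtr0_norm tw_gt0. Qed.

Lemma A_ge_a i : tw * cn (a i) <= A i.
Proof. by rewrite -cn_sa cn_a_le. Qed.
Lemma A_ge_b i : cn (b i) <= tw * A i.
Proof.
have := cn_b_le (sa a) (sb b) i; rewrite cn_sb ler_pdivrMr ?tw_gt0 //.
by rewrite mulrC.
Qed.

Lemma cn_a_le_A i : cn (a i) <= A i.
Proof. by apply: le_trans (A_ge_a i); rewrite ler_peMl ?cn_ge0 ?tw_ge1. Qed.

Lemma la_le_eta : la <= et.
Proof. by apply: ler_sum => i _; rewrite le_ln ?cn_gt0 ?cn_a_le_A. Qed.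

Lemma ratio_le_eta i : 0 <= la -> ln (A i) - ln (cn (a i)) <= et.
Proof.
move=> la_ge0; rewrite lerBlDr /eta (bigD1 i) //= -addrA lerDl; apply: le_trans la_ge0 _.
rewrite /la (bigD1 i) //= addrC lerD2r; apply: ler_sum => j _.
by rewrite le_ln ?cn_gt0 ?cn_a_le_A.
Qed.

(** [|x - alpha y| <= 1 / (2 |y|)], Legendre's condition for a convergent; [gain] is the logarithm
    of the factor by which it is bettered. *)
Definition near i (v : int * int) : bool :=
  cn (lf a b v i) * (2 * `|v.2|%:~R) <= cn (a i).
Definition gain i (v : int * int) : R :=
  if near i v then ln (cn (a i)) - ln (2 * `|v.2|%:~R) - ln (cn (lf a b v i)) else 0.

Lemma abs_int_gt0 (y : int) : y != 0 -> 0 < `|y|%:~R :> R.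
Proof. by move=> y0; rewrite ltr0z normr_gt0. Qed.

Lemma gain_ge0 i v : v.2 != 0 -> lf a b v i != 0 -> 0 <= gain i v.
Proof.
move=> y0 L0; rewrite /gain; case: ifP => // nr.
have y1 := abs_int_gt0 y0; have l1 : 0 < cn (lf a b v i) by rewrite cn_gt0.
have p2 : 0 < 2 * `|v.2|%:~R :> R by rewrite mulr_gt0.
by have := le_ln (mulr_gt0 l1 p2) nr; rewrite lnMp //; lra.
Qed.

(** With [w] from [basis_completion], [L_i(w) = (w.2 / v.2) L_i(v) - a_i / v.2], so both entries of
    the maximum are at most [t |L_i(v)|], up to the gain if [v] is near root [i]. What remains is
    [n ln t] and [ln (19 / 10)]. *)
Lemma eta_le_gain v : (4 <= n)%N -> (forall w, cross v w = 1 ->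
    et <= ln (19 / 10) + \sum_i ln (Num.max (tw * cn (lf a b v i)) (cn (lf a b w i) / tw))) ->
  coprimez v.1 v.2 -> v.2 != 0 -> (forall i, lf a b v i != 0) ->
  et <= n%:R / 2 * ln (7 / 2) + ln (\prod_i cn (lf a b v i)) + \sum_i gain i v.
Proof.
move=> n4 reduced cv y0 L0; have [w [vw wv]] := basis_completion cv y0.
have yR := abs_int_gt0 y0.
have yC : (v.2%:~R : C) != 0 by rewrite intr_eq0.
have l1 i : 0 < cn (lf a b v i) by rewrite cn_gt0.
have step i : ln (Num.max (tw * cn (lf a b v i)) (cn (lf a b w i) / tw)) <=
   ln tw + ln (cn (lf a b v i)) + gain i v.
  have E : lf a b w i = (w.2%:~R / v.2%:~R) * lf a b v i - a i / v.2%:~R.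
    have := congr1 (fun z : int => z%:~R : C) vw; rewrite /cross rmorphB !rmorphM /= => e.
    have e' : v.2%:~R * lf a b w i = w.2%:~R * lf a b v i - a i.
      rewrite -[X in _ - X]mulr1 -[X in _ - _ * X](_ : v.1%:~R * w.2%:~R - v.2%:~R * w.1%:~R = 1).
        by rewrite /lf; ring.
      by rewrite e.
    by apply: (mulfI yC); rewrite e'; field.
  have Lw : cn (lf a b w i) <= cn (lf a b v i) / 2 + cn (a i) / `|v.2|%:~R.
    rewrite E (le_trans (cnB _ _)) // !cnM !cnV !cn_int lerD2r mulrC ler_wpM2l ?cn_ge0 //.
    rewrite ler_pdivrMr // mulrC ler_pdivlMr //.
    by rewrite -(intrM R _ 2) ler_int mulrC.
  have t0 := tw_gt0; have t2 := tw2.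
  have lt1 : 0 < cn (a i) by rewrite cn_gt0.
  set r := cn (a i) / `|v.2|%:~R in Lw.
  have rE : cn (a i) = r * `|v.2|%:~R by rewrite /r divfK // gt_eqF.
  have mx0 : 0 < Num.max (tw * cn (lf a b v i)) (cn (lf a b w i) / tw).
    by rewrite lt_max mulr_gt0.
  (* [t^2 = 5 / 2] is exact in both cases: away from the root [r + |L| / 2 < 5 / 2 * |L|], near it
     [r + r / 4 = 5 / 2 * (r / 2)]. *)
  rewrite /gain /near rE; case: ifP => [nr|/negbT]; last first.
    rewrite -ltNge => nr; rewrite addr0 -lnMp //; apply: le_ln => //.
    rewrite ge_max lexx /= ler_pdivrMr // mulrAC t2.
    have : r < cn (lf a b v i) * 2 by rewrite -(ltr_pM2r yR); lra.
    lra.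
  have rr : cn (lf a b v i) * 2 <= r by rewrite -(ler_pM2r yR); lra.
  have r0 : 0 < r by apply: lt_le_trans rr; rewrite mulr_gt0.
  rewrite (lnMp r0 yR) (lnMp (ltr0Sn _ 1) yR).
  have := le_ln mx0 (_ : _ <= tw * (r / 2)); rewrite (lnMp t0) ?divr_gt0 // lnDiv // => h.
  have {}h := h _.
  suff : Num.max (tw * cn (lf a b v i)) (cn (lf a b w i) / tw) <= tw * (r / 2).
    by move/h; lra.
  rewrite ge_max; apply/andP; split; first by rewrite ler_pM2l //; lra.
  rewrite ler_pdivrMr // (_ : tw * (r / 2) * tw = (tw * tw) * (r / 2)); last by ring.
  rewrite t2; lra.
have h := reduced w vw; apply: le_trans h _.
have : \sum_i ln (Num.max (tw * cn (lf a b v i)) (cn (lf a b w i) / tw)) <=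
   \sum_i (ln tw + ln (cn (lf a b v i)) + gain i v) by apply: ler_sum => i _.
rewrite !big_split /= sumr_const card_ord -[ln tw *+ n]mulr_natl ln_prod => [|i _]; last exact: l1.
have l19 : ln (19 / 10) <= 2 * ln (7 / 5) :> R.
  by rewrite -(lnX 2) //; [apply: le_ln; rewrite ?expr2; lra | lra].
have l7 : ln (7 / 2) = ln (7 / 5) + ln (5 / 2) :> R.
  by rewrite -lnMp; [congr ln; field | lra | lra].
have lt75 : 0 <= ln (7 / 5) :> R by apply: ln_ge0; lra.
have n4R : 4 <= n%:R :> R by rewrite ler_nat.
have nt : n%:R * ln tw = n%:R / 2 * ln (5 / 2) by rewrite -ln_tw; field.
rewrite l7; have := ler_wpM2r lt75 n4R; clear -nt l19; lra.
Qed.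

(* If [v'] is a convergent-type approximation of root [i] and [|y| <= |y'|],
   then [1 <= |cross v v'|] forces [|y'|] to grow by the gain of [v]. *)
Lemma near_gap i v v' : v.2 != 0 -> v'.2 != 0 -> lf a b v i != 0 ->
  cross v v' != 0 -> near i v -> near i v' -> `|v.2| <= `|v'.2| ->
  ln (`|v.2|%:~R) + gain i v <= ln (`|v'.2|%:~R) :> R.
Proof.
move=> y0 y0' L0 cr nv nv' yy.
have yR := abs_int_gt0 y0; have yR' := abs_int_gt0 y0'.
have l1 : 0 < cn (lf a b v i) by rewrite cn_gt0.
have la0 : 0 < cn (a i) by rewrite cn_gt0.
have yyR : `|v.2|%:~R <= `|v'.2|%:~R :> R by rewrite ler_int.
have h : cn (a i) <= `|v'.2|%:~R * cn (lf a b v i) + `|v.2|%:~R * cn (lf a b v' i).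
  have -> : `|v'.2|%:~R * cn (lf a b v i) + `|v.2|%:~R * cn (lf a b v' i) =
     cn (v'.2%:~R * lf a b v i) + cn (v.2%:~R * lf a b v' i) by rewrite !cnM !cn_int.
  apply: le_trans (cnB _ _).
  have -> : v'.2%:~R * lf a b v i - v.2%:~R * lf a b v' i = a i * (cross v v')%:~R.
    by rewrite /cross rmorphB !rmorphM /= /lf; ring.
  rewrite cnM cn_int ler_peMr ?cn_ge0 // ler1z; move: cr; lia.
have : cn (a i) <= 2 * `|v'.2|%:~R * cn (lf a b v i).
  have := nv'; rewrite /near => h'.
  have : `|v.2|%:~R * cn (lf a b v' i) <= `|v'.2|%:~R * cn (lf a b v' i).
    by rewrite ler_wpM2r ?cn_ge0.
  lra.
rewrite /gain nv => h2; have := le_ln la0 h2.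
rewrite !lnMp ?mulr_gt0 //; lra.
Qed.

(** Near root [i] the vector [(x, y)] is almost proportional to [(b i, a i)], so [|y|] is about
    [|a i| / A i] times the height; the error [|a i| / 2] becomes the [1 / 2] added to [hgt]. *)
Lemma near_y_le i v : v.2 != 0 -> near i v -> 
  ln (`|v.2|%:~R) <= ln (hgt v + 1 / 2) + ln (cn (a i)) - ln (A i).
Proof.
move=> y0 nv; have yR := abs_int_gt0 y0.
have y1 : 1 <= `|v.2|%:~R :> R by rewrite ler1z; move: y0; lia.
have la0 : 0 < cn (a i) by rewrite cn_gt0.
have t0 := tw_gt0; have t1 := tw_ge1; have AA := A_gt0 i.
have hx : `|v.1|%:~R <= tw * hgt v.
  by rewrite mulrC -ler_pdivrMr // le_max lexx.
have hy : tw * `|v.2|%:~R <= hgt v by rewrite le_max lexx orbT.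
have ty : 0 < tw * `|v.2|%:~R by rewrite mulr_gt0.
have h0 : 0 < hgt v + 1 / 2 by lra.
rewrite lerBrDr -!lnMp //; apply: le_ln; first by rewrite mulr_gt0.
rewrite [A i](_ : _ = Num.max (tw * cn (a i)) (cn (b i) / tw)); last by rewrite /ht cn_sa cn_sb.
rewrite maxr_pMr ?(ltW yR) // ge_max; apply/andP; split.
  rewrite mulrA ler_wpM2r ?(ltW la0) // mulrC; lra.
rewrite mulrA ler_pdivrMr //.
have : cn (b i) * `|v.2|%:~R <= cn (a i) * `|v.1|%:~R + cn (lf a b v i).
  rewrite -!cn_int -!cnM.
  have -> : b i * v.2%:~R = a i * v.1%:~R - lf a b v i by rewrite /lf; ring.
  exact: cnB.
have : cn (lf a b v i) <= cn (a i) / 2.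
  have := nv; rewrite /near => h; rewrite ler_pdivlMr //; apply: le_trans h.
  by rewrite ler_wpM2l ?cn_ge0 //; lra.
have : cn (a i) * `|v.1|%:~R <= cn (a i) * (tw * hgt v) by rewrite ler_wpM2l ?(ltW la0).
have : cn (a i) <= cn (a i) * tw by rewrite ler_peMr ?(ltW la0).
lra.
Qed.

End Form.
End SmallSolutions.

(** * Counting the small solutions *)

Section SmallCount.
Variable R : realType.
Local Notation C := R[i].
Variables (n : nat) (a b : 'I_n -> C) (c : 'I_n -> 'I_n).
Hypothesis n4 : (4 <= n)%N.
Hypothesis a0 : forall i, a i != 0.
Hypothesis cc : forall i, c (c i) = i.
Hypothesis c_norm : forall v i, cn (lf a b v (c i)) / cn (a (c i)) = cn (lf a b v i) / cn (a i).
Local Notation A := (ht (sa a) (sb b)).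
Local Notation et := (eta (sa a) (sb b)).
Hypothesis reduced : forall v w, cross v w = 1 ->
  et <= ln (19 / 10) + \sum_i ln (Num.max (tw R * cn (lf a b v i)) (cn (lf a b w i) / tw R)).
Hypothesis la_ge0 : 0 <= la a.

Lemma near_c i v : near a b (c i) v = near a b i v.
Proof.
have ac j : 0 < cn (a j) by rewrite cn_gt0.
have h j : near a b j v = (cn (lf a b v j) / cn (a j) * (2 * `|v.2|%:~R) <= 1).
  by rewrite /near mulrAC ler_pdivrMr // mul1r.
by rewrite !h c_norm.
Qed.

(** The end of the chain of root [i], where [|y|] is largest. It depends only on the filtered list,
    so conjugate roots pick the same solution and are charged once. *)
Definition nearest (S : seq (int * int)) i : option (int * int) :=
  ohead (sort (fun v w => `|w.2| <= `|v.2|) (filter (near a b i) S)).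

Lemma nearest_c S i : nearest S (c i) = nearest S i.
Proof. by rewrite /nearest (eq_filter (near_c i)). Qed.

Lemma nearest_max S i w : nearest S i = Some w ->
  [/\ w \in S, near a b i w & forall v, v \in S -> near a b i v -> `|v.2| <= `|w.2|].
Proof.
rewrite /nearest; set r := (fun v w : int * int => _); set s := filter _ S.
have tot : total r by move=> x y; rewrite /r; lia.
have tr : transitive r by move=> x y z; rewrite /r; lia.
have := sort_sorted tot s; have := mem_sort r s; case: (sort r s) => // x s' ms so [<-].
have : x \in s by rewrite -ms mem_head.
rewrite mem_filter => /andP[nx xS]; split => // v vS nv.
have : v \in x :: s' by rewrite ms mem_filter nv.
rewrite inE => /orP[/eqP -> //|vs'].
by have /allP /(_ v vs') := order_path_min tr so.
Qed.

Lemma nearest_none S i : nearest S i = None -> forall v, v \in S -> ~~ near a b i v.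
Proof.
rewrite /nearest; set r := (fun v w : int * int => _); set s := filter _ S.
have := mem_sort r s; case: (sort r s) => // ms _ v vS; apply/negP => nv.
by have := ms v; rewrite mem_filter nv vS in_nil.
Qed.

(** Without the end of the chain the gains telescope to its [ln |y|]. If the chain is empty the sum
    is zero, and [et <= lc] makes the bound nonnegative. *)
Lemma gain_sum_le (S : seq (int * int)) (P : pred (int * int)) (lc : R) i :
  uniq S -> (forall v w, v \in S -> w \in S -> v != w -> cross v w != 0) ->
  (forall v, v \in S -> v.2 != 0 /\ forall j, lf a b v j != 0) ->
  (forall v, v \in S -> ln (hgt R v + 1 / 2) <= lc) -> et <= lc ->
  (forall v, P v -> nearest S i != Some v) ->
  \sum_(v <- S | P v) gain a b i v <= lc + ln (cn (a i)) - ln (A i).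
Proof.
move=> uS cr hS hlc elc hP.
case E : (nearest S i) => [w|]; last first.
  rewrite big_seq_cond big1; last first.
    move=> v /andP[vS _]; rewrite /gain ifF //.
    by apply: negbTE; apply: nearest_none vS.
  by have := ratio_le_eta b a0 i la_ge0; lra.
have [wS nw wmax] := nearest_max E; have [w0 _] := hS w wS.
apply: le_trans (_ : ln (`|w.2|%:~R) <= _); last first.
  by apply: (le_trans (near_y_le a0 w0 nw)); rewrite lerD2r lerD2r hlc.
apply: le_trans (_ : \sum_(v <- filter (near a b i) S | v != w) gain a b i v <= _).
  rewrite big_filter_cond big_mkcond [leRHS]big_mkcond /= big_seq [leRHS]big_seq.
  apply: ler_sum => v vS; have [v0 L0] := hS v vS.
  case: ifP => [Pv|_].
    have vw : v != w by apply: contra (hP v Pv) => /eqP ->; rewrite E.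
    by rewrite vw andbT; case: ifP => // nv; rewrite /gain nv.
  by case: ifP => // _; apply: gain_ge0.
apply: (chain_sum (ly := fun v => ln (`|v.2|%:~R : R))).
- by rewrite filter_uniq.
- move=> v; rewrite mem_filter => /andP[_ /hS [v0 _]].
  by apply: ln_ge0; rewrite ler1z -gtz0_ge1 normr_gt0.
- move=> v v'; rewrite !mem_filter => /andP[nv vS] /andP[nv' vS'] vv' h.
  have [v0 L0] := hS v vS; have [v0' _] := hS v' vS'.
  apply: near_gap => //; first exact: cr.
  by move: h; rewrite ler_ln ?posrE ?ltr0z ?normr_gt0 // ler_int.
- by rewrite mem_filter nw.
- move=> v; rewrite mem_filter => /andP[nv vS]; have [v0 _] := hS v vS.
  by apply: le_ln; rewrite ?ltr0z ?normr_gt0 // ler_int wmax.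
Qed.

(** A solution that ends no chain has total gain at least [Del], and all these gains add up to at
    most [n lc + la - et]. The ends of chains are counted by the indices with [i <= c i]. *)
Lemma small_count (S : seq (int * int)) (m lc : R) : 0 < m ->
  uniq S -> (forall v w, v \in S -> w \in S -> v != w -> cross v w != 0) ->
  (forall v, v \in S -> coprimez v.1 v.2 /\ \prod_i cn (lf a b v i) = m) ->
  (forall v, v \in S -> ln (hgt R v + 1 / 2) <= lc) -> et <= lc ->
  ln m + n%:R / 2 * ln (7 / 2) <= et ->
  exists2 k : nat, (size S <= #|[pred i : 'I_n | (i <= c i)%N]| + k)%N &
   k%:R * (et - ln m - n%:R / 2 * ln (7 / 2)) <= n%:R * lc.
Proof.
move=> m0 uS cr hS hlc elc hm.
set Del := et - ln m - _.
have Del0 : 0 <= Del by rewrite /Del; lra.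
pose S1 := [seq v <- S | v.2 != 0]; pose S0 := [seq v <- S | ~~ (v.2 != 0)].
have sz : size S = (size S1 + size S0)%N by rewrite !size_filter count_predC.
have L0 v i : v \in S -> lf a b v i != 0.
  move=> vS; have [_ e] := hS v vS; apply/eqP => z; move: m0; rewrite -e.
  by rewrite (bigD1 i) //= z cn0 mul0r ltxx.
have hS1 v : v \in S1 -> v.2 != 0 /\ forall j, lf a b v j != 0.
  by rewrite mem_filter => /andP[v0 vS]; split => // j; apply: L0.
have sub1 v : v \in S1 -> v \in S by rewrite mem_filter => /andP[].
pose E v := [exists i, [pred i : 'I_n | (i <= c i)%N] i && (nearest S1 i == Some v)].
have uS1 : uniq S1 by rewrite filter_uniq.
have cE := uniq_fixed_image [pred i : 'I_n | (i <= c i)%N] (nearest S1) uS1.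
have notE i v : ~~ E v -> nearest S1 i != Some v.
  rewrite negb_exists => /forallP h; case: (leqP i (c i)) => hi.
    by have := h i; rewrite /= hi.
  by have := h (c i); rewrite /= cc (ltnW hi) nearest_c.
have main : (count (predC E) S1)%:R * Del <= n%:R * lc + la a - et.
  have -> : (count (predC E) S1)%:R * Del = \sum_(v <- S1 | ~~ E v) Del.
    by rewrite big_const_seq iter_addr_0 mulr_natl.
  apply: (@le_trans _ _ (\sum_(v <- S1 | ~~ E v) \sum_i gain a b i v)).
    rewrite big_seq_cond [leRHS]big_seq_cond; apply: ler_sum => v /andP[vS _].
    have [v0 L1] := hS1 v vS; have [cp e] := hS v (sub1 v vS).
    by have := eta_le_gain a0 n4 (fun w => @reduced v w) cp v0 L1; rewrite e /Del; lra.
  rewrite exchange_big /=.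
  apply: (@le_trans _ _ (\sum_i (lc + ln (cn (a i)) - ln (A i)))).
    apply: ler_sum => i _; apply: gain_sum_le => //.
    - by move=> v w /sub1 vS /sub1 wS; apply: cr.
    - by move=> v /sub1; apply: hlc.
    - by move=> v; apply: notE.
  by rewrite sumrB big_split /= sumr_const card_ord -[lc *+ n]mulr_natl lexx.
have szS1 : (size S1 = count E S1 + count (predC E) S1)%N by rewrite count_predC.
have sz0 : (size S0 <= 1)%N.
  have uS0 : uniq S0 by rewrite filter_uniq.
  case E0 : S0 => [|v [|w s]] //.
  have vS : v \in S0 by rewrite E0 mem_head.
  have wS : w \in S0 by rewrite E0 !inE eqxx orbT.
  have vw : v != w by move: uS0; rewrite E0 /= inE negb_or => /andP[/andP[]].
  move: vS wS; rewrite !mem_filter !negbK => /andP[/eqP v0 vS] /andP[/eqP w0 wS].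
  by have := cr v w vS wS vw; rewrite /cross v0 w0 mulr0 mul0r subrr eqxx.
have la_le := la_le_eta b a0.
case E0 : S0 sz sz0 => [|v0 [|//]] sz _.
  exists (count (predC E) S1); first by rewrite sz szS1 addn0 leq_add2r.
  by apply: le_trans main _; lra.
exists (count (predC E) S1).+1; first by rewrite sz szS1 addn1 addnS ltnS leq_add2r.
have : v0 \in S0 by rewrite E0 mem_head.
rewrite mem_filter negbK => /andP[/eqP y0 vS].
have [cp e] := hS v0 vS.
(* The solution with [y = 0], at most one, has no gain; but it makes [la a] equal to [ln m] instead
   of merely at most [et], and the difference pays for it. *)
have laE : la a = ln m.
  rewrite -e ln_prod; last by move=> i _; rewrite cn_gt0 L0.
  apply: eq_bigr => i _; congr ln; rewrite /lf y0 mulr0 subr0 cnM cn_int.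
  move: cp; rewrite y0 /coprimez gcdz0 => /eqP x1.
  by rewrite (_ : `|v0.1| = 1) ?mulr1 //; move: x1; lia.
have w0 : 0 <= n%:R / 2 * ln (7 / 2) :> R.
  by rewrite !mulr_ge0 ?invr_ge0 ?ler0n // ln_ge0 //; lra.
have DelE : Del = et - ln m - n%:R / 2 * ln (7 / 2) by [].
clearbody Del; rewrite -natr1 mulrDl mul1r; move: main; rewrite laE; lra.
Qed.

End SmallCount.

(** * Large solutions *)

Section BigSolutions.
Variable R : realType.
Local Notation C := R[i].

Lemma growth_pair (T : eqType) (f : T -> R) (s : seq T) (nu z0 : R) (p q : nat) :
  uniq s -> 0 <= nu -> (forall v, v \in s -> z0 <= f v) ->
  (forall v w, v \in s -> w \in s -> v != w -> f v <= f w -> nu * f v <= f w) ->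
  (p + q < size s)%N ->
  exists v w, [/\ v \in s, w \in s, nu ^+ p * z0 <= f v & nu ^+ q * f v <= f w].
Proof.
move=> us nu0 hz hg hs.
pose r (v w : T) := f v <= f w.
have tot : total r by move=> x y; apply: le_total.
have tr : transitive r by move=> x y z; apply: le_trans.
pose t := sort r s.
have st : size t = size s by rewrite size_sort.
have mt v : (v \in t) = (v \in s) by rewrite mem_sort.
have ut : uniq t by rewrite sort_uniq.
have [x0 _] : exists x0, x0 \in t by case: (t) st => [|x t'] st; [rewrite -st in hs | exists x; rewrite mem_head].
have so : sorted r t by apply: sort_sorted.
have inS j : (j < size t)%N -> nth x0 t j \in s by move=> h; rewrite -mt mem_nth.
have step j : (j.+1 < size t)%N -> nu * f (nth x0 t j) <= f (nth x0 t j.+1).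
  move=> h; have h1 := ltnW h; apply: hg; [exact: inS | exact: inS | |].
    by rewrite nth_uniq // neq_ltn ltnSn.
  by move/(sortedP x0): so => /(_ j h).
have steps j k : (j + k < size t)%N -> nu ^+ k * f (nth x0 t j) <= f (nth x0 t (j + k)).
  elim: k => [|k IH] h; first by rewrite addn0 mul1r.
  have h' : (j + k < size t)%N by apply: leq_ltn_trans h; rewrite addnS.
  rewrite addnS in h *; apply: le_trans (step _ h).
  by rewrite exprS -mulrA ler_wpM2l // IH.
rewrite -st in hs.
have hp : (p < size t)%N by apply: leq_ltn_trans hs; rewrite leq_addr.
exists (nth x0 t p), (nth x0 t (p + q)); split; rewrite ?inS ?steps //.
apply: le_trans (steps 0%N p _); rewrite ?add0n //.
by rewrite ler_wpM2l ?exprn_ge0 // hz // inS // (leq_ltn_trans _ hp).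
Qed.

Lemma ln2_le : 9 * ln 2 <= 5 * ln (7 / 2) :> R.
Proof. by rewrite -!lnX //; [apply: le_ln; [exact: exprn_gt0 | lra] | lra]. Qed.

Lemma ln52_le : 4 * ln (5 / 2) <= 3 * ln (7 / 2) :> R.
Proof. by rewrite -!lnX; [apply: le_ln; [apply: exprn_gt0 |] | |]; lra. Qed.

Lemma ln72_ge : 5 / 7 <= ln (7 / 2) :> R.
Proof.
have : ln (1 + (2 / 7 - 1)) <= 2 / 7 - 1 :> R by apply: le_ln1Dx; lra.
have -> : 1 + (2 / 7 - 1) = 1 / (7 / 2) :> R by field.
by rewrite lnDiv ?ln1; lra.
Qed.

Section Form.
Variables (n : nat) (a b : 'I_n -> C) (m e : R).
Hypothesis n4 : (4 <= n)%N.
Hypothesis a0 : forall i, a i != 0.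
Hypothesis d0 : forall i j, i != j -> dt a b i j != 0.

Local Notation A := (ht (sa a) (sb b)).
Local Notation et := (eta (sa a) (sb b)).
Local Notation l0 := (ell (sa a) (sb b)).
Local Notation W := (n%:R / 2 * @ln R (7 / 2)).
Local Notation t := (tw R).

Hypothesis m0 : 0 < m.
Hypothesis hm : ln m + W <= l0.
Hypothesis Wl0 : W <= l0.

Lemma twC0 : t%:C%C != 0.
Proof. by rewrite -cn_gt0 cn_real gtr0_norm tw_gt0. Qed.

Lemma sa_neq0 i : sa a i != 0. Proof. by rewrite mulf_neq0 ?twC0. Qed.

Lemma dt_scaled i j : dt (sa a) (sb b) i j = dt a b i j.
Proof. by rewrite /dt /sa /sb; field; exact: twC0. Qed.

Lemma d0s i j : i != j -> dt (sa a) (sb b) i j != 0.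
Proof. by rewrite dt_scaled; apply: d0. Qed.

Definition xs (v : int * int) : C := v.1%:~R / t%:C%C.
Definition ys (v : int * int) : C := t%:C%C * v.2%:~R.

Lemma hgtE v : hgt R v = Num.max (cn (xs v)) (cn (ys v)).
Proof. by rewrite /hgt /xs /ys !cnM cnV !cn_int !cn_real (gtr0_norm (tw_gt0 R)). Qed.

Lemma lformE v i : lform (sa a) (sb b) (xs v) (ys v) i = lf a b v i.
Proof. by rewrite /lform /lf /sa /sb /xs /ys; field; exact: twC0. Qed.

Definition sol v := coprimez v.1 v.2 /\ \prod_i cn (lf a b v i) = m.
Definition rel v i := forall j, cn (lf a b v i) / A i <= cn (lf a b v j) / A j.

Lemma sol_L0 v i : sol v -> lf a b v i != 0.
Proof.
case=> _ E; apply/eqP => z; move: m0; rewrite -E.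
by rewrite (bigD1 i) //= z cn0 mul0r ltxx.
Qed.

Lemma n4R : 4 <= n%:R :> R. Proof. by rewrite ler_nat. Qed.

Lemma W_gt0 : 0 < W.
Proof. by have := n4R; have := ln72_ge => *; rewrite mulr_gt0 ?divr_gt0 //; lra. Qed.

Lemma l0_gt0 : 0 < l0. Proof. exact: lt_le_trans W_gt0 Wl0. Qed.

Lemma l0_le_eta : l0 <= et.
Proof. by apply: ell_le_eta; [exact: sa_neq0 | exact: d0s | exact: leq_trans n4]. Qed.

Lemma nln2_le_W : n%:R * ln 2 <= 10 / 9 * W.
Proof.
have n0 : 0 <= n%:R / 2 :> R by rewrite divr_ge0 ?ler0n.
by have := ler_wpM2l n0 ln2_le; lra.
Qed.

Lemma nln2_le : n%:R * ln 2 <= 10 / 9 * l0.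
Proof. by have := nln2_le_W; move: Wl0; lra. Qed.

Lemma nlnt_le : n%:R * ln t <= 3 / 4 * l0.
Proof.
have n0 : 0 <= n%:R / 2 :> R by rewrite divr_ge0 ?ler0n.
by have := ler_wpM2l n0 ln52_le; rewrite -ln_tw; move: Wl0; lra.
Qed.

Lemma ln2_ge0 : 0 <= ln 2 :> R. Proof. by rewrite ln_ge0 // ler1n. Qed.

Lemma lnlam_le v i : sol v -> rel v i -> 0 < hgt R v ->
  ln (cn (lf a b v i)) - ln (A i) <= - (n%:R - 1) * (ln (hgt R v) - et) - et - (n%:R - 19 / 9) * l0 - ln 2.
Proof.
move=> sv rv h0.
have n1 : (1 < n)%N by rewrite (leq_trans _ n4).
have H0 : 0 < Num.max (cn (xs v)) (cn (ys v)) by rewrite -hgtE.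
have L0 j : lform (sa a) (sb b) (xs v) (ys v) j != 0 by rewrite lformE sol_L0.
have im j : cn (lform (sa a) (sb b) (xs v) (ys v) i) / A i <=
            cn (lform (sa a) (sb b) (xs v) (ys v) j) / A j by rewrite !lformE.
have := lnL_min_le sa_neq0 d0s n1 H0 L0 im.
rewrite /lnL lformE -hgtE.
rewrite (eq_bigr (fun j => cn (lf a b v j))) => [|j _]; last by rewrite lformE.
have [_ ->] := sv.
by have := nln2_le_W; have := ln2_ge0; move: hm Wl0; lra.
Qed.

(** [cross_le] with both values estimated by [lnlam_le]. The shift by [9 / 10 * l0 - et] absorbs all
    constants, so that the gap becomes a pure multiplication by [n - 1]. *)
Lemma rel_gap v w i : sol v -> sol w -> rel v i -> rel w i -> cross v w != 0 ->
  0 < hgt R v -> hgt R v <= hgt R w ->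
  (n%:R - 1) * (ln (hgt R v) - et + 9 / 10 * l0) <= ln (hgt R w) - et + 9 / 10 * l0.
Proof.
move=> sv sw rv rw cr h0 hh; have h0' : 0 < hgt R w := lt_le_trans h0 hh.
have lv := lnlam_le sv rv h0; have lw := lnlam_le sw rw h0'.
have AA : 0 < A i by apply: A_gt0.
have Lv : 0 < cn (lf a b v i) by rewrite cn_gt0 sol_L0.
have Lw : 0 < cn (lf a b w i) by rewrite cn_gt0 sol_L0.
have hln : ln (hgt R v) <= ln (hgt R w) by apply: le_ln.
have key : A i <= hgt R v * cn (lf a b w i) + hgt R w * cn (lf a b v i).
  have := cross_le (sa a i) (sb b i) (xs v) (ys v) (xs w) (ys w).
  rewrite -!hgtE -/(lform (sa a) (sb b) (xs w) (ys w) i) -/(lform (sa a) (sb b) (xs v) (ys v) i).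
  rewrite !lformE; apply: le_trans.
  have -> : xs v * ys w - ys v * xs w = (cross v w)%:~R.
    by rewrite /cross rmorphB !rmorphM /= /xs /ys; field; exact: twC0.
  rewrite cn_int ler_peMl ?(ltW AA) // ler1z -gtz0_ge1 normr_gt0 //.
have n4' := n4R; have l0' := l0_gt0.
have nl0 : 4 * l0 <= n%:R * l0 by apply: ler_wpM2r => //; exact: ltW.
(* If the other term dominates, the heights appear exchanged, and [hln] leads back to the same
   inequality. *)
case: (lerP (hgt R v * cn (lf a b w i)) (hgt R w * cn (lf a b v i))) => cmp.
  have : A i <= 2 * (hgt R w * cn (lf a b v i)) by lra.
  by move/(le_ln AA); rewrite !lnMp ?mulr_gt0 //; lra.
have : A i <= 2 * (hgt R v * cn (lf a b w i)) by lra.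
move/(le_ln AA); rewrite !lnMp ?mulr_gt0 // => k2.
have n2 : 0 <= n%:R - 2 :> R by lra.
by have := ler_wpM2l n2 hln; lra.
Qed.

Lemma pair_le v i ci : sol v -> rel v i -> 0 < hgt R v -> ci != i ->
  cn (lf a b v ci) / A ci = cn (lf a b v i) / A i ->
  n%:R * ln (hgt R v) <= (2 * n%:R - 3) * et - (2 * n%:R - 5) * l0.
Proof.
move=> sv rv h0 ci_i Ec.
have n1 : (1 < n)%N by rewrite (leq_trans _ n4).
have H0 : 0 < Num.max (cn (xs v)) (cn (ys v)) by rewrite -hgtE.
have L0 j : lform (sa a) (sb b) (xs v) (ys v) j != 0 by rewrite lformE sol_L0.
have im j : cn (lform (sa a) (sb b) (xs v) (ys v) i) / A i <=
            cn (lform (sa a) (sb b) (xs v) (ys v) j) / A j by rewrite !lformE.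
have := @lnH_pair_le _ _ _ _ sa_neq0 d0s n1 _ _ H0 L0 _ im ci ci_i.
rewrite !lformE -hgtE => /(_ Ec).
rewrite (eq_bigr (fun j => cn (lf a b v j))) => [|j _]; last by rewrite lformE.
have [_ ->] := sv.
by have := nln2_le_W; have := ln2_ge0; have := l0_gt0; move: hm Wl0; lra.
Qed.

(** The threshold is set on [hgt + 1 / 2] because of [near_y_le]; beyond it the [1 / 2] costs at
    most [l0 / 10], since [l0 >= 10 / 7]. *)
Lemma big_hgt v (lc : R) : et <= lc -> lc < ln (hgt R v + 1 / 2) -> 0 < hgt R v + 1 / 2 ->
  11 < hgt R v /\ lc - 1 / 10 * l0 <= ln (hgt R v).
Proof.
move=> elc big hp.
have w2 : 2 * ln (7 / 2) <= W :> R.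
  by have := n4R; have := ln72_ge => h1 h2; apply: ler_wpM2r; lra.
have h1 : ln ((7 / 2) ^+ 2) < ln (hgt R v + 1 / 2).
  rewrite lnX; last lra.
  apply: le_lt_trans big; apply: le_trans elc; apply: le_trans l0_le_eta.
  exact: le_trans w2 Wl0.
rewrite ltr_ln ?posrE // in h1; last by rewrite exprn_gt0 //; lra.
have hbig : 11 < hgt R v by rewrite expr2 in h1; lra.
split=> //.
have h0 : 0 < hgt R v by lra.
have E : hgt R v + 1 / 2 = hgt R v * (1 + 1 / 2 / hgt R v) by field; rewrite gt_eqF.
have d0' : 0 < 1 / 2 / hgt R v by rewrite divr_gt0 //; lra.
have d1 : 1 / 2 / hgt R v <= 1 / 10 * (10 / 7).
  by rewrite ler_pdivrMr //; lra.
have d2 : ln (1 + 1 / 2 / hgt R v) <= 1 / 2 / hgt R v by apply: le_ln1Dx; lra.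
move: big; rewrite E lnMp //; last lra.
by have := ln72_ge; move: Wl0; lra.
Qed.

Hypothesis la0 : 0 <= la a.

Let alpha i := b i / a i.
Variable c : 'I_n -> 'I_n.
Hypothesis HI : norm_integral a alpha.
Hypothesis cc : forall i, c (c i) = i.
Hypothesis alphaJ : forall i, alpha (c i) = ((alpha i)^*)%C.

Lemma alpha_inj : injective alpha.
Proof.
move=> i j E; apply/eqP; apply: contrapT => /negP /d0; rewrite /dt.
have -> : b j = b i / a i * a j by rewrite -/(alpha i) E divfK.
have E0 : a i * (b i / a i * a j) - a j * b i = 0 by field; rewrite a0.
by rewrite E0 eqxx.
Qed.

Lemma lf_alpha v i : v.1%:~R - alpha i * v.2%:~R = lf a b v i / a i.
Proof. by rewrite /lf /alpha; field; rewrite a0. Qed.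

Lemma c_norm v i : cn (lf a b v (c i)) / cn (a (c i)) = cn (lf a b v i) / cn (a i).
Proof.
rewrite -!cnV -!cnM -!lf_alpha alphaJ -cn_conj; congr cn.
by rewrite rmorphB rmorphM /= !rmorph_int /= conjcK.
Qed.

Lemma A_ratio i : A i / cn (a i) = Num.max t (cn (alpha i) / t).
Proof.
have ai : 0 < cn (a i) by rewrite cn_gt0.
rewrite /ht cn_sa cn_sb maxr_pMl ?invr_ge0 ?cn_ge0 // mulfK ?gt_eqF //.
by rewrite /alpha cnM cnV mulrAC.
Qed.

Lemma rel_c v i : cn (lf a b v (c i)) / A (c i) = cn (lf a b v i) / A i.
Proof.
have ai j : cn (a j) != 0 by rewrite gt_eqF // cn_gt0.
have Ai j : A j != 0 by rewrite gt_eqF // A_gt0.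
have h j : cn (lf a b v j) / A j = (cn (lf a b v j) / cn (a j)) / (A j / cn (a j)).
  by field; rewrite ai Ai.
by rewrite !h c_norm !A_ratio alphaJ cn_conj.
Qed.

End Form.
End BigSolutions.

(** * Thue's method in terms of reduced heights *)

Section ThuePair.
Variable R : realType.
Local Notation C := R[i].

(** [thue_contradiction] with [K = t * hgt v], [Y2 = hgt w] and [G = et + n ln t]; the term [n ln t]
    undoes the scaling by [t] in the Mahler measure. *)
Lemma thue_pair (n : nat) (a b : 'I_n -> C) (m : R) (c : 'I_n -> 'I_n)
    (v w : int * int) (i : 'I_n) :
  let alpha i := b i / a i in
  let A := ht (sa a) (sb b) in let et := eta (sa a) (sb b) in
  let l0 := ell (sa a) (sb b) in let t := tw R in
  (4 <= n)%N -> (forall i, a i != 0) -> (forall i j, i != j -> dt a b i j != 0) ->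
  0 < m -> ln m + n%:R / 2 * ln (7 / 2) <= l0 -> n%:R / 2 * ln (7 / 2) <= l0 ->
  0 <= la a -> norm_integral a alpha -> (forall i, c (c i) = i) ->
  (forall i, alpha (c i) = ((alpha i)^*)%C) ->
  sol a b m v -> sol a b m w -> rel a b v i -> rel a b w i ->
  11 < hgt R v -> 11 < hgt R w ->
  (n%:R - 1) * (64 / 5 * et + 256 / 5 * l0) <= ln (hgt R v) - et + 9 / 10 * l0 ->
  (n = 4%N -> 27 * (ln (hgt R v) - et + 9 / 10 * l0) <= ln (hgt R w) - et + 9 / 10 * l0) ->
  ((5 <= n)%N -> (n%:R - 1) ^+ 2 * (ln (hgt R v) - et + 9 / 10 * l0)
     <= ln (hgt R w) - et + 9 / 10 * l0) -> False.
Proof.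
move=> alpha A et l0 t n4 a0 d0 m0 hm Wl0 la0 HI cc alphaJ.
have l0p : 0 < l0 := l0_gt0 n4 Wl0.
have l0e : l0 <= et := l0_le_eta n4 a0 d0.
have n2l : n%:R * ln 2 <= 10 / 9 * l0 := nln2_le Wl0.
have ntl : n%:R * ln t <= 3 / 4 * l0 := nlnt_le Wl0.
have l20 : 0 <= ln 2 :> R := ln2_ge0 R.
move=> sv sw rv rw hv hw hX Z4 Z5.
have [p [u [u0 pu H]]] := thue_parameters n4 l0p l0e hX Z4 Z5.
have t0 := tw_gt0 R; have t1 := tw_ge1 R.
have lt0 : 0 <= ln t by rewrite ln_ge0.
have np : (0 < n * p + u)%N by rewrite addn_gt0 u0 orbT.
have [Ha Hb] := H (ln 2) (ln t) (n * p + u).-1 (2 * p)%N (2 * u + n - 3)%N l20 lt0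
  n2l ntl (prednK np) erefl (subnK (leq_trans (isT : 3 <= 4)%N (leq_trans n4 (leq_addl _ _)))).
have y0 z : sol a b m z -> 11 < hgt R z -> z.2 != 0.
  move=> [cp _] hz; apply/eqP => z0; move: hz; rewrite /hgt z0 normr0 mulr0.
  move: cp; rewrite /coprimez z0 gcdz0 => /eqP x1.
  have -> : `|z.1| = 1 by move: x1; clear; lia.
  rewrite lt_max => /orP[|]; rewrite ?ltr_pdivlMr //; move: t1; rewrite -/t; clear; lra.
have ai : 0 < cn (a i) by rewrite cn_gt0.
have AA : 0 < A i := A_gt0 b a0 i.
have hx z : cn (z.1%:~R : C) <= t * hgt R z.
  by rewrite cn_int mulrC -ler_pdivrMr // le_max lexx.
have hy z : cn (z.2%:~R : C) <= hgt R z.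
  apply: (@le_trans _ _ (t * cn (z.2%:~R : C))); first by rewrite ler_peMl ?cn_ge0.
  by rewrite cn_int le_max lexx orbT.
have dE z : cn (z.1%:~R - alpha i * z.2%:~R) = cn (lf a b z i) / cn (a i).
  by rewrite (lf_alpha b a0) cnM cnV.
have lnd z : sol a b m z -> rel a b z i -> 11 < hgt R z -> ln (cn (z.1%:~R - alpha i * z.2%:~R)) <=
   - ((n%:R - 1) * (ln (hgt R z) - et) + (n%:R - 19 / 9) * l0).
  move=> sz rz hz; have hz0 : 0 < hgt R z by clear -hz; lra.
  have Lz0 : 0 < cn (lf a b z i) by rewrite cn_gt0; apply: (@sol_L0 _ _ a b m).
  have := lnlam_le n4 a0 d0 m0 hm Wl0 sz rz hz0; rewrite dE lnDiv //.
  by have := ratio_le_eta b a0 i la0; move: l20; rewrite -/A -/et -/l0; clear; lra.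
have hv0 : 0 < hgt R v by clear -hv; lra.
have lnd1 := lnd v sv rv hv; have lnd2 := lnd w sw rw hw.
have n4' : 4 <= n%:R :> R by rewrite ler_nat.
have l0' := l0p; have e0 := l0e.
have D1 : 0 <= (n%:R - 1) * (ln (hgt R v) - et) + (n%:R - 19 / 9) * l0.
  have x0 : 0 <= ln (hgt R v) - et + 9 / 10 * l0.
    by apply: le_trans hX; rewrite mulr_ge0 //; [clear -n4'; lra | clear -l0' e0; lra].
  have x1 : 0 <= ln (hgt R v) - et.
    have xx : 3 * (64 / 5 * et + 256 / 5 * l0) <= (n%:R - 1) * (64 / 5 * et + 256 / 5 * l0).
      by apply: ler_wpM2r; [clear -l0' e0; lra | clear -n4'; lra].
    by move: xx hX l0' e0; clear; lra.
  by rewrite addr_ge0 // mulr_ge0 //; clear -n4' l0' x1; lra.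
have Lz z j : sol a b m z -> z.1%:~R - alpha j * z.2%:~R != 0.
  by move=> sz; rewrite (lf_alpha b a0) mulf_neq0 ?invr_eq0 //; apply: (@sol_L0 _ _ a b m).
have d1 : cn (v.1%:~R - alpha i * v.2%:~R) <= 1.
  by rewrite -ler_ln ?posrE ?cn_gt0 ?Lz // ln1 (le_trans lnd1) // oppr_le0.
have lMM : la a <= lnMM a alpha.
  by apply: ler_sum => j _; apply: le_ln; rewrite ?cn_gt0 // ler_peMr ?cn_ge0 ?mu_ge1.
have lMM2 : lnMM a alpha <= et + n%:R * ln t.
  rewrite mulr_natl -[n in ln t *+ n]card_ord -sumr_const -big_split /=.
  apply: ler_sum => j _; have aj : 0 < cn (a j) by rewrite cn_gt0.
  have Aj := A_gt0 b a0 j; rewrite -lnMp //; apply: le_ln.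
    by rewrite mulr_gt0 ?mu_gt0.
  rewrite /mu maxr_pMr ?cn_ge0 // mulr1 ge_max; apply/andP; split.
    by apply: (@le_trans _ _ (ht (sa a) (sb b) j)); [exact: cn_a_le_A | rewrite ler_peMr // ltW].
  by rewrite /alpha cnM cnV mulrC divfK ?gt_eqF // mulrC A_ge_b.
have mm : mu alpha i <= t * (A i / cn (a i)).
  rewrite (A_ratio b a0) maxr_pMr ?(ltW t0) // /mu ge_max !le_max; apply/andP; split.
    by rewrite tw2; apply/orP; left; clear; lra.
  by apply/orP; right; rewrite mulrC divfK ?gt_eqF.
have K1 : 1 <= t * hgt R v by rewrite -[1]mulr1 ler_pM //; clear -hv; lra.
have y1K : cn (v.2%:~R : C) <= t * hgt R v.
  by rewrite (le_trans (hy v)) // ler_peMl // ltW.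
have nR : (3 <= n)%N by rewrite ltnW.
have Nn : ((n * p + u).-1.+1 = n * p + u)%N := prednK np.
have Jn : (2 * u + n - 3 + 3 = 2 * u + n)%N by rewrite subnK // (leq_trans nR) // leq_addl.
apply: (@thue_contradiction R n a alpha c i v.1 v.2 w.1 w.2 (t * hgt R v)
  (t * (A i / cn (a i))) (hgt R w) (et + n%:R * ln t) p u _ _ _ nR HI cc alphaJ a0
  (alpha_inj a0 d0) (le_trans la0 lMM) (y0 v sv hv) (y0 w sw hw) (fun j => Lz v j sv) (Lz w i sw)
  K1 (hx v) y1K mm (hy w) d1 lMM2 u0 pu Nn erefl Jn).
  rewrite lnMp // /siegel_exponent; move: Ha lnd2; clear; lra.
have hw0 : 0 < hgt R w by clear -hw; lra.
have kJ : (2 * u + n - 3 <= 2 * p)%N by move: pu; clear; lia.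
have kJR : 0 <= (2 * p)%:R - (2 * u + n - 3)%:R :> R by rewrite subr_ge0 ler_nat.
have := ler_wpM2l kJR lnd1.
have := ratio_le_eta b a0 i la0.
rewrite (lnMp t0) ?divr_gt0 // lnDiv // lnMp // /siegel_exponent.
rewrite -/(A i) -/et -/t; move: Hb.
move: (ln (cn (v.1%:~R - _))) ((2 * p)%:R - (2 * u + n - 3)%:R : R) => L KJ.
by clear; lra.
Qed.


End ThuePair.

(** * Counting the large solutions *)

Section CountReduced.
Variable R : realType.
Local Notation C := R[i].

(** What the counting retains of [F]; all of it survives a change of basis. [c] is complex
    conjugation on the roots. *)
Record form_data n (a b : 'I_n -> C) (c : 'I_n -> 'I_n) : Prop := FormData {
  fd_a0 : forall i, a i != 0;
  fd_d0 : forall i j, i != j -> dt a b i j != 0;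
  fd_HI : norm_integral a (fun i => b i / a i);
  fd_cc : forall i, c (c i) = i;
  fd_J : forall i, b (c i) / a (c i) = ((b i / a i)^*)%C
}.

Definition nreal n (c : 'I_n -> 'I_n) := #|[pred i | c i == i]|.
Definition npair n (c : 'I_n -> 'I_n) := #|[pred i : 'I_n | (i < c i)%N]|.

Lemma card_le_c n (c : 'I_n -> 'I_n) :
  #|[pred i : 'I_n | (i <= c i)%N]| = (nreal c + npair c)%N.
Proof.
rewrite /nreal /npair -(cardID [pred i | c i == i]); congr (_ + _)%N.
  by apply: eq_card => i; rewrite !inE -(inj_eq val_inj); case: ltngtP.
by apply: eq_card => i; rewrite !inE -(inj_eq val_inj) /=; case: ltngtP.
Qed.

Lemma card_c n (c : 'I_n -> 'I_n) : (forall i, c (c i) = i) ->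
  (nreal c + 2 * npair c = n)%N.
Proof.
move=> cc; have E : npair c = #|[pred i : 'I_n | (c i < i)%N]|.
  rewrite /npair -!sum1_card (reindex_inj (inv_inj cc)) /=.
  by apply: eq_bigl => i; rewrite !inE cc.
have := card_le_c c; have := cardC [pred i : 'I_n | (i <= c i)%N]; rewrite card_ord.
have -> : #|[predC [pred i : 'I_n | (i <= c i)%N]]| = #|[pred i : 'I_n | (c i < i)%N]|.
  by apply: eq_card => i; rewrite !inE -ltnNge.
by rewrite -E => h1 h2; rewrite -[RHS]h1 h2 mul2n -addnn addnA.
Qed.

Lemma size_sum_count (T : eqType) (I : finType) (f : T -> I) (s : seq T) :
  size s = (\sum_(i : I) count (fun v => f v == i) s)%N.
Proof.
elim: s => [|x s IH] /=; first by rewrite big1.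
rewrite big_split /= -IH (bigD1 (f x)) //= eqxx big1 ?addn0 // => i.
by rewrite eq_sym => /negbTE ->.
Qed.

(** [5 + 3] gap steps for [n = 4] and [4 + 2] for [n >= 5]: the first ones bring [X] to the size
    that [thue_parameters] requires, the last ones produce the ratio of [Z] to [X]. *)
Definition big_bound n : nat := if n == 4%N then 8 else 6.

(** [norm_integral] for the constant polynomial [1], which has no root. *)
Lemma la_ge0_form n (a alpha : 'I_n -> C) : (0 < n)%N -> (forall i, a i != 0) ->
  norm_integral a alpha -> 0 <= la a.
Proof.
move=> n0 a0 HI; rewrite leNgt; apply/negP => la0.
have h : \prod_i (cn (a i) ^+ 1 * cn ((map_poly (intr : int -> C) 1).[alpha i])) < 1.
  rewrite (eq_bigr (fun i => cn (a i))) => [|i _]; last first.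
    by rewrite expr1 rmorph1 hornerC cn1 mulr1.
  rewrite -ltr_ln ?posrE ?ltr01 ?prodr_gt0 // => [|i _]; last by rewrite cn_gt0.
  by rewrite ln_prod ?ln1 // => i _; rewrite cn_gt0.
have := HI 1%N 1; rewrite size_poly1 => /(_ isT h (Ordinal n0)).
by rewrite rmorph1 hornerC => /eqP; rewrite oner_eq0.
Qed.

(** At a real root too many solutions yield a pair excluded by [thue_pair]. At a nonreal root a
    second one would, after a single gap step, exceed the bound of [pair_le]; the last hypothesis
    expresses this. *)
Lemma big_count (n : nat) (a b : 'I_n -> C) (m : R) (c : 'I_n -> 'I_n)
    (S : seq (int * int)) (lc rho : R) :
  let et := eta (sa a) (sb b) in let l0 := ell (sa a) (sb b) in
  (4 <= n)%N -> form_data a b c ->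
  0 < m -> ln m + n%:R / 2 * ln (7 / 2) <= l0 -> n%:R / 2 * ln (7 / 2) <= l0 ->
  uniq S -> (forall v w, v \in S -> w \in S -> v != w -> cross v w != 0) ->
  (forall v, v \in S -> sol a b m v /\ lc < ln (hgt R v + 1 / 2)) ->
  lc = (1 + rho) * et -> 0 <= rho ->
  ((exists i, c i == i) -> 1 / n%:R <= rho) ->
  (n%:R - 3) * et < n%:R * (n%:R - 1) * rho * et
     + (4 / 5 * n%:R ^+ 2 + 3 / 10 * n%:R - 5) * l0 ->
  (size S <= big_bound n * nreal c + npair c)%N.
Proof.
move=> et l0 n4 [a0 d0 HI cc cJ] m0 hm Wl0 uS cr hS lcE rho0 hr hq.
have n0 : (0 < n)%N by rewrite (leq_trans _ n4).
have la0 := la_ge0_form n0 a0 HI.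
have l0p : 0 < l0 := l0_gt0 n4 Wl0.
have l0e : l0 <= et := l0_le_eta n4 a0 d0.
have et0 : 0 < et := lt_le_trans l0p l0e.
have elc : et <= lc by rewrite lcE mulrDl mul1r lerDl mulr_ge0 // ltW.
have n4R : 4 <= n%:R :> R by rewrite ler_nat.
have hp v : 0 < hgt R v + 1 / 2.
  have h1 : 0 <= tw R * `|v.2|%:~R.
    by apply: mulr_ge0; [exact: ltW (tw_gt0 R) | rewrite ler0z].
  have h2 : tw R * `|v.2|%:~R <= hgt R v by rewrite le_max lexx orbT.
  by clear -h1 h2; lra.
have big v : v \in S -> 11 < hgt R v /\ lc - 1 / 10 * l0 <= ln (hgt R v).
  by move=> /hS [_ h]; apply: (big_hgt n4 a0 d0 Wl0).
pose f v := ln (hgt R v) - et + 9 / 10 * l0.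
pose z0 := rho * et + 4 / 5 * l0.
have fz v : v \in S -> z0 <= f v.
  by move=> /big [_]; rewrite lcE /f /z0; clear; lra.
pose A := ht (sa a) (sb b).
pose idx v := [arg min_(i < Ordinal n0) (cn (lf a b v i) / A i)]%O.
have relidx v : rel a b v (idx v).
  by rewrite /idx; case: arg_minP => // i _ h j; apply: h.
(* A nonreal root ties with its conjugate by [rel_c], so the smaller index can represent both. *)
pose rep v := if (idx v <= c (idx v))%N then idx v else c (idx v).
have relrep v : rel a b v (rep v).
  rewrite /rep; case: ifP => // _ j; rewrite (rel_c a0 cJ); exact: relidx.
have repc v : (rep v <= c (rep v))%N.
  by rewrite /rep; case: ifP => // /negbT; rewrite -ltnNge cc => /ltnW.
have gap i v w : v \in S -> w \in S -> rep v = i -> rep w = i -> v != w -> f v <= f w ->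
    (n%:R - 1) * f v <= f w.
  move=> vS wS rv rw vw fvw; have [hv _] := big v vS; have [hw _] := big w wS.
  have [sv _] := hS v vS; have [sw _] := hS w wS.
  have hv0 : 0 < hgt R v by clear -hv; lra.
  have hw0 : 0 < hgt R w by clear -hw; lra.
  have hh : hgt R v <= hgt R w.
    by rewrite -ler_ln ?posrE //; move: fvw; rewrite /f; clear; lra.
  have relv : rel a b v i by rewrite -rv.
  have relw : rel a b w i by rewrite -rw.
  exact: (rel_gap n4 a0 d0 m0 hm Wl0 sv sw relv relw (cr v w vS wS vw) hv0 hh).
pose T i := [seq v <- S | rep v == i].
have uT i : uniq (T i) by rewrite filter_uniq.
have subT i v : v \in T i -> v \in S /\ rep v = i by rewrite mem_filter => /andP[/eqP -> ->].
have growth i p q : (p + q < size (T i))%N -> exists v w,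
    [/\ v \in T i, w \in T i, (n%:R - 1) ^+ p * z0 <= f v & (n%:R - 1) ^+ q * f v <= f w].
  apply: growth_pair => //; first by clear -n4R; lra.
    by move=> v /subT [vS _]; apply: fz.
  by move=> v w /subT [vS rv] /subT [wS rw]; apply: (gap i).
have realT i : c i == i -> (size (T i) <= big_bound n)%N.
  move=> ci; rewrite leqNgt; apply/negP => hsz.
  have rn : 1 / n%:R <= rho by apply: hr; exists i.
  have rnet : et <= n%:R * rho * et.
    rewrite -[leLHS]mul1r ler_wpM2r ?(ltW et0) //.
    by move: rn; rewrite ler_pdivrMr ?ltr0n // mulrC.
  have nu0 : 0 <= n%:R - 1 :> R by clear -n4R; lra.
  have contra (p q : nat) : (p + q)%N = big_bound n ->
     (64 / 5 * et + 256 / 5 * l0 <= (n%:R - 1) ^+ p.-1 * z0) -> (0 < p)%N ->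
     (n = 4%N -> q = 3%N) -> ((5 <= n)%N -> q = 2%N) -> False.
    move=> pq hz p0 q3 q2; rewrite -pq in hsz.
    have [v [w [vT wT h1 h2]]] := growth i p q hsz.
    have [vS rv] := subT i v vT; have [wS rw] := subT i w wT.
    have [sv _] := hS v vS; have [sw _] := hS w wS.
    have relv : rel a b v i by rewrite -rv.
    have relw : rel a b w i by rewrite -rw.
    have [hv _] := big v vS; have [hw _] := big w wS.
    apply: (thue_pair n4 a0 d0 m0 hm Wl0 la0 HI cc cJ sv sw relv relw hv hw).
    - apply: le_trans h1; rewrite -(prednK p0) exprS -[leRHS]mulrA.
      by apply: ler_wpM2l.
    - move=> n4e; move: h2; rewrite (q3 n4e).
      have -> : (n%:R - 1) ^+ 3 = 27 :> R; last by [].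
      by rewrite (_ : n%:R = 4 :> R) ?n4e //; rewrite !exprS expr0; clear; lra.
    - by move=> n5; move: h2; rewrite (q2 n5).
  case: (ltngtP n 4) => [|n5|n4e]; first by rewrite ltnNge n4.
    apply: (contra 4%N 2%N) => //; first by rewrite /big_bound gtn_eqF.
      have n5R : 5 <= n%:R :> R by rewrite ler_nat.
      have nu4 : 4 <= n%:R - 1 :> R by clear -n5R; lra.
      have cube : 16 * (n%:R - 1) <= (n%:R - 1) ^+ 3 :> R.
        rewrite exprSr ler_wpM2r // expr2; apply: le_trans (ler_pM _ _ nu4 nu4) => //.
        by clear; lra.
      (* For [n >= 5] and [n * rho >= 1], three of the four steps turn [z0] into at least
         [16 * 4 / 5 * et + 64 * 4 / 5 * l0]: the origin of [64 / 5] and [256 / 5]. *)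
      have c64 : 64 * l0 <= (n%:R - 1) ^+ 3 * l0.
        by rewrite ler_wpM2r ?(ltW l0p) // (le_trans _ cube) //; clear -nu4; lra.
      have key : 64 / 5 * et <= (n%:R - 1) ^+ 3 * (rho * et).
        have r1 : 0 <= rho * et by rewrite mulr_ge0 // ltW.
        apply: le_trans (ler_wpM2r r1 cube).
        have : 4 * (n%:R * rho * et) <= 5 * ((n%:R - 1) * (rho * et)).
          have := ler_wpM2r r1 n5R; clear; lra.
        by move: rnet; clear; lra.
      by rewrite /z0 mulrDr; move: key c64; clear; lra.
    by move=> n4e; move: n5; rewrite n4e.
  apply: (contra 5%N 3%N) => //; first by rewrite /big_bound n4e eqxx.
    have n4R' : n%:R = 4 :> R by rewrite n4e.
    have -> : (n%:R - 1) ^+ 5.-1 = 81 :> R by rewrite n4R' /= !exprS expr0; clear; lra.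
    by move: rnet et0 l0p; rewrite /z0 n4R'; clear; lra.
  by move=> n5; move: n4e n5; clear; lia.
have cplxT i : c i != i -> (size (T i) <= 1)%N.
  move=> ci; rewrite leqNgt; apply/negP => hsz.
  have [v [w [vT wT h1 h2]]] := growth i 0%N 1%N hsz.
  have [wS rw] := subT i w wT; have [sw _] := hS w wS; have [hw _] := big w wS.
  have relw : rel a b w i by rewrite -rw.
  have hw0 : 0 < hgt R w by clear -hw; lra.
  have := pair_le n4 a0 d0 m0 hm Wl0 sw relw hw0 ci (rel_c a0 cJ w i).
  move: h1 h2; rewrite expr0 mul1r expr1 => h1 h2; rewrite -/et -/l0 => h3.
  have h4 : (n%:R - 1) * z0 <= f w.
    by apply: le_trans h2; apply: ler_wpM2l => //; clear -n4R; lra.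
  have h5 := ler_wpM2l (ler0n R n) h4; move: h5; rewrite /z0 /f => h5.
  have nl : 4 * l0 <= n%:R * l0 by rewrite ler_wpM2r // ltW.
  by move: h3 h5 hq nl l0p; clear; lra.
rewrite (size_sum_count rep S).
have bnd i : (count (fun v => rep v == i) S <=
    (if c i == i then big_bound n else 0) + (if (i < c i)%N then 1 else 0))%N.
  rewrite -size_filter -/(T i); case: ifP => [ci|/negbT ci].
    by rewrite (leq_trans (realT i ci)) // leq_addr.
  case: ifP => [_|/negbT]; first exact: cplxT.
  rewrite -leqNgt => cle; rewrite leqn0 size_eq0; apply/eqP.
  case ET : (T i) => [//|v s]; exfalso.
  have [_ rv] : v \in S /\ rep v = i by apply: subT; rewrite ET mem_head.
  have := repc v; rewrite rv => le2; move/eqP: ci; apply; apply: val_inj.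
  by apply/eqP; rewrite eqn_leq cle.
apply: leq_trans (leq_sum _ (fun i _ => bnd i)) _.
rewrite big_split /= -!big_mkcond /= sum_nat_const sum_nat_const muln1 mulnC.
by rewrite /nreal /npair; apply: leq_add; rewrite ?leq_mul2l ?leqnn ?orbT.
Qed.

End CountReduced.

(** * The threshold between small and large solutions *)

Section CountReducedAll.
Variable R : realType.
Local Notation C := R[i].

(** The threshold [lc = (1 + rho) * et] must be low enough for the count of small solutions and high
    enough for the hypotheses of [big_count]. *)
Lemma count_reduced n (a b : 'I_n -> C) (m e : R) (c : 'I_n -> 'I_n) (S : seq (int * int)) :
  let et := eta (sa a) (sb b) in let l0 := ell (sa a) (sb b) in
  (4 <= n)%N -> form_data a b c ->
  (forall v w, cross v w = 1 -> et <= ln (19 / 10) +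
     \sum_i ln (Num.max (tw R * cn (lf a b v i)) (cn (lf a b w i) / tw R))) ->
  1 <= m -> 0 < e -> e < 1 -> ln m <= (1 - e) * l0 - n%:R / 2 * ln (7 / 2) ->
  uniq S -> (forall v w, v \in S -> w \in S -> v != w -> cross v w != 0) ->
  (forall v, v \in S -> sol a b m v) ->
  (size S)%:R <= ((big_bound n).+1 * nreal c + 2 * npair c)%:R
     + 2 * (nreal c + npair c)%:R / e.
Proof.
move=> et l0 n4 fd red m1 e0 e1 hm uS cr hS.
have [a0 d0 HI cc cJ] := fd.
have n0 : (0 < n)%N by rewrite (leq_trans _ n4).
have m0 : 0 < m by apply: lt_le_trans m1.
have lm0 : 0 <= ln m by apply: ln_ge0.
have n4R : 4 <= n%:R :> R by rewrite ler_nat.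
have W0 : 0 < n%:R / 2 * ln (7 / 2) :> R.
  by have := ln72_ge R => h; rewrite mulr_gt0 //; move: n4R h; clear; lra.
have l0p : 0 < l0.
  have : 0 < (1 - e) * l0 by move: hm lm0 W0; clear; lra.
  by rewrite pmulr_rgt0 // subr_gt0.
have el0 : 0 < e * l0 by apply: mulr_gt0.
have Wl0 : n%:R / 2 * ln (7 / 2) <= l0 by move: hm lm0 el0; clear; lra.
have hm' : ln m + n%:R / 2 * ln (7 / 2) <= l0 by move: hm el0; clear; lra.
have l0e : l0 <= et := l0_le_eta n4 a0 d0.
have et0 : 0 < et := lt_le_trans l0p l0e.
have la0 := la_ge0_form n0 a0 HI.
have cN := c_norm a0 cJ.
have nE := card_c cc.
set r := nreal c in nE *; set q := npair c in nE *.
suff main lc rho : lc = (1 + rho) * et -> 0 <= rho ->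
    ((exists i, c i == i) -> 1 / n%:R <= rho) ->
    (n%:R - 3) * et < n%:R * (n%:R - 1) * rho * et
      + (4 / 5 * n%:R ^+ 2 + 3 / 10 * n%:R - 5) * l0 ->
    (forall k : nat, k%:R * (et - (1 - e) * l0) <= n%:R * lc -> k%:R <= 2 * (r + q)%:R / e) ->
    (size S)%:R <= ((big_bound n).+1 * r + 2 * q)%:R + 2 * (r + q)%:R / e.
- have nr2 : n%:R + r%:R = 2 * (r + q)%:R :> R.
    by rewrite -natrD -natrM; congr _%:R; move: nE; clear; lia.
  have [r0|r0] := posnP r; last first.
    have r1R : 1 <= r%:R :> R by rewrite ler1n.
    have nV : 0 < n%:R^-1 :> R by rewrite invr_gt0 ltr0n.
    have rn : n%:R * (r%:R / n%:R) = r%:R :> R.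
      by rewrite mulrC divfK // pnatr_eq0 -lt0n.
    (* This [rho] makes [n lc = (n + r) et = 2 (r + q) et], exactly the target. *)
    apply: (main ((1 + r%:R / n%:R) * et) (r%:R / n%:R)) => //.
    + by rewrite divr_ge0 ?ler0n.
    + by move=> _; rewrite ler_pM2r.
    + have -> : n%:R * (n%:R - 1) * (r%:R / n%:R) = (n%:R - 1) * r%:R :> R.
        by rewrite mulrAC rn mulrC.
      have h1 : (n%:R - 1) * et <= (n%:R - 1) * r%:R * et.
        apply: ler_wpM2r; first exact: ltW.
        by rewrite ler_peMr //; move: n4R; clear; lra.
      have h2 : 0 <= (4 / 5 * n%:R ^+ 2 + 3 / 10 * n%:R - 5) * l0.
        by rewrite mulr_ge0 ?(ltW l0p) // expr2; move: n4R; clear; nra.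
      by move: h1 h2 et0; clear; lra.
    + move=> k hk; rewrite -nr2 ler_pdivlMr //.
      have : k%:R * (e * et) <= k%:R * (et - (1 - e) * l0).
        apply: ler_wpM2l; first exact: ler0n.
        have : (1 - e) * l0 <= (1 - e) * et by apply: ler_wpM2l => //; move: e1; clear; lra.
        by clear; lra.
      move=> h; have := le_trans h hk; rewrite mulrA [n%:R * _]mulrA mulrDr mulr1 rn.
      by rewrite ler_pM2r.
  have noreal : ~ exists i, c i == i.
    move=> [i ci]; move: r0; rewrite /r /nreal.
    by move=> /card0_eq /(_ i); rewrite !inE ci.
  have nr0 : 2 * (r + q)%:R = n%:R :> R by rewrite -nr2 r0 addr0.
  (* Without real roots the target is [n / e], which leaves no room for [rho]. For small [et] the
     term in [l0] allows [rho = 0]. *)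
  have [small|large] := lerP et ((4 / 5 * n%:R + 2) * l0).
    apply: (main et 0) => //; first by rewrite addr0 mul1r.
      rewrite mulr0 mul0r add0r.
      have h1 : (n%:R - 3) * et <= (n%:R - 3) * ((4 / 5 * n%:R + 2) * l0).
        by apply: ler_wpM2l => //; move: n4R; clear; lra.
      apply: le_lt_trans h1 _; rewrite mulrA ltr_pM2r // expr2.
      by move: n4R; clear; nra.
    move=> k hk; rewrite nr0 ler_pdivlMr //.
    have : k%:R * (e * et) <= k%:R * (et - (1 - e) * l0).
      apply: ler_wpM2l; first exact: ler0n.
      have : (1 - e) * l0 <= (1 - e) * et by apply: ler_wpM2l => //; move: e1; clear; lra.
      by clear; lra.
    by move=> h; have := le_trans h hk; rewrite mulrA ler_pM2r.
  have n10 : n%:R != 0 :> R by rewrite pnatr_eq0 -lt0n.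
  have n11 : 0 < n%:R - 1 :> R by move: n4R; clear; lra.
  (* For large [et], [rho = th / n] solves [n (n - 1) rho = n - 3]. The excess [th < 1] is harmless:
     a count above [n / e] is an integer, so at least [n + 1], and this would force
     [(1 - th) * et <= l0]. *)
  pose th : R := (n%:R - 3) / (n%:R - 1).
  have th1 : th * (n%:R - 1) = n%:R - 3 by rewrite /th divfK // gt_eqF.
  have th0 : 0 <= th by rewrite divr_ge0 ?(ltW n11) //; move: n4R; clear; lra.
  apply: (main ((1 + th / n%:R) * et) (th / n%:R)) => //.
  + by rewrite divr_ge0 ?ler0n.
  + have -> : n%:R * (n%:R - 1) * (th / n%:R) = n%:R - 3.
      by rewrite -th1; field.
    rewrite ltrDl mulr_gt0 // expr2; move: n4R; clear; nra.
  + move=> k hk; rewrite nr0 ler_pdivlMr // leNgt; apply/negP => hn.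
    have lcE : n%:R * ((1 + th / n%:R) * et) = (n%:R + th) * et by field.
    rewrite lcE in hk.
    have kn : n%:R < k%:R :> R.
      by apply: lt_le_trans hn _; rewrite ler_piMr ?ler0n // ltW.
    have kn1 : n%:R + 1 <= k%:R :> R by rewrite natr1 ler_nat -(ltr_nat R).
    have h1 : (k%:R - n%:R - th) * et <= (k%:R - k%:R * e) * l0.
      by move: hk; clear; lra.
    have h2 : (k%:R - k%:R * e) * l0 <= (k%:R - n%:R) * l0.
      by apply: ler_wpM2r; [exact: ltW | move: hn; clear; lra].
    have h3 : 2 / (n%:R - 1) = 1 - th by rewrite /th; field; rewrite gt_eqF.
    have h4 : 0 < 1 - th by rewrite -h3 divr_gt0.
    have h5 : (1 - th) * (k%:R - n%:R) <= k%:R - n%:R - th.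
      have : 0 <= th * (k%:R - n%:R - 1) by apply: mulr_ge0 => //; move: kn1; clear; lra.
      by clear; lra.
    have h6 : (1 - th) * (k%:R - n%:R) * et <= (k%:R - n%:R) * l0.
      by apply: le_trans h2; apply: le_trans h1; apply: ler_wpM2r => //; apply: ltW.
    have h7 : (1 - th) * et <= l0.
      have kp : 0 < k%:R - n%:R :> R by rewrite subr_gt0.
      by rewrite -(ler_pM2l kp); move: h6; clear; lra.
    have h8 : (1 - th) * ((4 / 5 * n%:R + 2) * l0) < l0.
      by apply: lt_le_trans h7; rewrite ltr_pM2l.
    have h9 : 2 * ((4 / 5 * n%:R + 2) * l0) < (n%:R - 1) * l0.
      have x2 : (n%:R - 1) * (1 - th) = 2 by rewrite -h3 mulrC divfK // gt_eqF.
      by have := h8; rewrite -(ltr_pM2l n11) [X in X < _]mulrA x2.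
    have n4l : 4 * l0 <= n%:R * l0 by rewrite ler_wpM2r // ltW.
    by move: h9 l0p n4l; clear; lra.
move=> lcE rho0 hr hq hk.
have elc : et <= lc by rewrite lcE mulrDl mul1r lerDl mulr_ge0 // ltW.
pose P v := ln (hgt R v + 1 / 2) <= lc.
have subP v : v \in filter P S -> v \in S by rewrite mem_filter => /andP[].
have subC v : v \in filter (predC P) S -> v \in S by rewrite mem_filter => /andP[].
have hb : (size (filter (predC P) S) <= big_bound n * r + q)%N.
  apply: (big_count (lc := lc) (rho := rho) (m := m) n4 fd) => //.
  + exact: filter_uniq.
  + by move=> v w /subC vS /subC wS; apply: cr.
  + by move=> v hv; split; [apply: hS; apply: subC | move: hv; rewrite mem_filter /= /P -ltNge => /andP[]].
have [k h1 h2] : exists2 k, (size (filter P S) <= r + q + k)%N &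
    k%:R * (et - (1 - e) * l0) <= n%:R * lc.
  have [k h1 h2] : exists2 k : nat,
      (size (filter P S) <= #|[pred i : 'I_n | (i <= c i)%N]| + k)%N &
      k%:R * (et - ln m - n%:R / 2 * ln (7 / 2)) <= n%:R * lc.
    apply: (small_count n4 a0 cc cN red la0 m0) => //.
    + exact: filter_uniq.
    + by move=> v w /subP vS /subP wS; apply: cr.
    + by move=> v /subP; apply: hS.
    + by move=> v; rewrite mem_filter => /andP[].
    + exact: le_trans l0e.
  exists k; first by rewrite -card_le_c.
  apply: le_trans h2; apply: ler_wpM2l; first exact: ler0n.
  by move: hm; rewrite -/et; clear; lra.
have sz : (size S <= (big_bound n).+1 * r + 2 * q + k)%N.
  rewrite -(count_predC P S) -!size_filter; move: hb h1; rewrite mulSn; clear.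
  move: (size _) (size _) (_ * _)%N => x y z; lia.
apply: le_trans (_ : ((big_bound n).+1 * r + 2 * q + k)%:R <= _); first by rewrite ler_nat.
by rewrite natrD lerD2l; apply: hk.
Qed.

End CountReducedAll.

(** * Reduction under GL2(Z) *)

Section Reduction.
Variable R : realType.
Local Notation C := R[i].
Variables (n : nat) (a b : 'I_n -> C) (c : 'I_n -> 'I_n).
Hypothesis n4 : (4 <= n)%N.
Hypothesis fd : form_data a b c.

Let a0 := fd_a0 fd.
Let d0 := fd_d0 fd.

Definition comb (v w u : int * int) : int * int :=
  (u.1 * v.1 + u.2 * w.1, u.1 * v.2 + u.2 * w.2).

Lemma lf_comb v w u i :
  lf (lf a b v) (fun i => - lf a b w i) u i = lf a b (comb v w u) i.
Proof. by rewrite /lf /comb /= !rmorphD !rmorphM /=; ring. Qed.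

Lemma cross_comb v w x y : cross (comb v w x) (comb v w y) = cross v w * cross x y.
Proof. by rewrite /cross /comb /=; ring. Qed.

Lemma comb_cross v w u : cross v w = 1 -> comb v w (cross u w, cross v u) = u.
Proof.
move=> vw; have h1 : (comb v w (cross u w, cross v u)).1 = u.1 * cross v w.
  by rewrite /comb /cross /=; ring.
have h2 : (comb v w (cross u w, cross v u)).2 = u.2 * cross v w.
  by rewrite /comb /cross /=; ring.
by rewrite [LHS]surjective_pairing h1 h2 vw !mulr1 -surjective_pairing.
Qed.

Lemma coprime_comb v w u : coprimez (comb v w u).1 (comb v w u).2 -> coprimez u.1 u.2.
Proof.
move=> /coprimezP [[s t] /= e]; apply/coprimezP.
exists (s * v.1 + t * v.2, s * w.1 + t * w.2) => /=.
by rewrite -e; ring.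
Qed.

(** A zero at one root of [v.1 - v.2 X] would by [norm_integral] be a zero at all roots, which are
    distinct. *)
Lemma lf_neq0 v i : v != (0, 0) -> lf a b v i != 0.
Proof.
move=> v0; apply/eqP => z.
pose P : {poly int} := v.1%:P - v.2%:P * 'X.
have sP : (size P <= 2)%N.
  rewrite (leq_trans (size_polyD _ _)) // geq_max size_polyN.
  rewrite (leq_trans (size_polyC_leq1 _)) //=.
  by rewrite (leq_trans (size_polyMleq _ _)) // size_polyX addn2 /= ltnS size_polyC_leq1.
have ev j : (map_poly (intr : int -> C) P).[b j / a j] = lf a b v j / a j.
  by rewrite /P rmorphB rmorphM /= !map_polyC map_polyX !hornerE /= /lf; field; rewrite a0.
have h : \prod_j (cn (a j) ^+ 1 * cn ((map_poly (intr : int -> C) P).[b j / a j])) < 1.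
  by rewrite (bigD1 i) //= ev z mul0r cn0 mulr0 mul0r ltr01.
have all0 j : lf a b v j = 0.
  have := fd_HI fd sP h j; rewrite ev => /eqP; rewrite mulf_eq0 invr_eq0 (negbTE (a0 j)) orbF.
  by move/eqP.
have n0 : (0 < n)%N by rewrite (leq_trans _ n4).
have n1 : (1 < n)%N by rewrite (leq_trans _ n4).
pose i0 := Ordinal n0; pose i1 := Ordinal n1.
have i01 : i0 != i1 by [].
have := d0 i01; have e0 := all0 i0; have e1 := all0 i1; rewrite /lf in e0 e1.
have h1 : dt a b i0 i1 * v.1%:~R = 0.
  rewrite /dt (_ : _ * _ = b i1 * (a i0 * v.1%:~R - b i0 * v.2%:~R)
     - b i0 * (a i1 * v.1%:~R - b i1 * v.2%:~R)); last by ring.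
  by rewrite e0 e1 !mulr0 subr0.
have h2 : dt a b i0 i1 * v.2%:~R = 0.
  rewrite /dt (_ : _ * _ = a i1 * (a i0 * v.1%:~R - b i0 * v.2%:~R)
     - a i0 * (a i1 * v.1%:~R - b i1 * v.2%:~R)); last by ring.
  by rewrite e0 e1 !mulr0 subr0.
move=> dn; move/eqP: h1; move/eqP: h2; rewrite !mulf_eq0 !(negbTE dn) /= !intr_eq0.
by move=> /eqP v2 /eqP v1; move/eqP: v0; apply; rewrite [v]surjective_pairing v1 v2.
Qed.

(** The main point is [norm_integral]: a polynomial [P] at the new roots pulls back to
    [Q = lv^d P(lw / lv)], again integral of degree at most [d] and with the same normalized
    values. *)
Lemma form_data_comb v w : cross v w = 1 ->
  form_data (lf a b v) (fun i => - lf a b w i) c.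
Proof.
move=> vw.
have v0 : v != (0, 0) by apply/eqP => v0; move: vw; rewrite v0 /cross /= !mul0r subrr.
have L0 i : lf a b v i != 0 by apply: lf_neq0.
split => //.
- move=> i j ij; have := d0 ij.
  have -> : dt (lf a b v) (fun i => - lf a b w i) i j = dt a b i j * (cross v w)%:~R.
    by rewrite /dt /lf /cross rmorphB !rmorphM /=; ring.
  by rewrite vw mulr1.
- move=> d P sP hP.
  pose lv : {poly int} := v.1%:P - v.2%:P * 'X.
  pose lw : {poly int} := w.2%:P * 'X - w.1%:P.
  have s2 (x y : int) : (size (x%:P - y%:P * 'X)%R <= 2)%N.
    rewrite (leq_trans (size_polyD _ _)) // geq_max size_polyN.
    rewrite (leq_trans (size_polyC_leq1 _)) //=.
    by rewrite (leq_trans (size_polyMleq _ _)) // size_polyX addn2 /= ltnS size_polyC_leq1.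
  pose Q := \sum_(k < d.+1) P`_k *: (lw ^+ k * lv ^+ (d - k)).
  have sQ : (size Q <= d.+1)%N.
    rewrite (leq_trans (size_sum _ _ _)) //; apply/bigmax_leqP => k _.
    rewrite (leq_trans (size_scale_leq _ _)) // (leq_trans (size_polyMleq _ _)) //.
    have h1 := size_poly_exp_leq lw k; have h2 := size_poly_exp_leq lv (d - k).
    have l1 : (size lw <= 2)%N by rewrite -size_polyN /lw opprB s2.
    have l2 : (size lv <= 2)%N by rewrite s2.
    have kd : (k <= d)%N by rewrite -ltnS.
    have m1 : ((size lw).-1 * k <= k)%N by rewrite -[leqRHS]mul1n leq_mul2r -subn1 leq_subLR l1 orbT.
    have m2 : ((size lv).-1 * (d - k) <= d - k)%N.
      by rewrite -[leqRHS]mul1n leq_mul2r -subn1 leq_subLR l2 orbT.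
    by move: h1 h2 m1 m2 kd; clear; lia.
  have ev i : a i ^+ d * (map_poly (intr : int -> C) Q).[b i / a i]
      = lf a b v i ^+ d * (map_poly (intr : int -> C) P).[- lf a b w i / lf a b v i].
    rewrite (horner_coef_wide _ (_ : (size (map_poly _ P) <= d.+1)%N)); last first.
      by rewrite (leq_trans (size_poly _ _)).
    rewrite /Q rmorph_sum /= horner_sum !mulr_sumr; apply: eq_bigr => k _.
    have kd : (k <= d)%N by rewrite -ltnS.
    rewrite coef_map /= map_polyZ rmorphM !rmorphXn /= hornerZ hornerM !horner_exp.
    rewrite /lw /lv !rmorphB !rmorphM /= !map_polyC map_polyX !hornerE /=.
    have sp (z : C) : z ^+ d = z ^+ k * z ^+ (d - k) by rewrite -exprD subnKC.
    have e1 : w.2%:~R * b i / a i - w.1%:~R = - lf a b w i / a i.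
      by rewrite /lf; field; rewrite a0.
    have e2 : v.1%:~R - v.2%:~R * b i / a i = lf a b v i / a i.
      by rewrite /lf; field; rewrite a0.
    rewrite e1 e2 (sp (a i)) (sp (lf a b v i)) !exprMn !exprVn.
    have x1 : a i ^+ k != 0 by rewrite expf_neq0.
    have x2 : a i ^+ (d - k) != 0 by rewrite expf_neq0.
    have x3 : lf a b v i ^+ k != 0 by rewrite expf_neq0.
    by field; rewrite x1 x2 x3.
  have : \prod_i (cn (a i) ^+ d * cn ((map_poly (intr : int -> C) Q).[b i / a i])) < 1.
    apply: le_lt_trans hP; rewrite le_eqVlt; apply/orP; left; apply/eqP.
    by apply: eq_bigr => i _; rewrite -!cnX -!cnM ev.
  move=> /(fd_HI fd sQ) h i; have := ev i; rewrite h mulr0 => /esym /eqP.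
  by rewrite mulf_eq0 expf_eq0 (negbTE (L0 i)) andbF => /eqP.
- exact: fd_cc fd.
- move=> i.
  have e u j : lf a b u j = a j * (u.1%:~R - b j / a j * u.2%:~R).
    by rewrite /lf; field; rewrite a0.
  have q j : - lf a b w j / lf a b v j =
     - (w.1%:~R - b j / a j * w.2%:~R) / (v.1%:~R - b j / a j * v.2%:~R).
    have := L0 j; rewrite !e mulf_eq0 negb_or => /andP[h1 h2].
    by rewrite -mulrN invfM mulrACA divff // mul1r.
  have J u : u.1%:~R - b (c i) / a (c i) * u.2%:~R
      = ((u.1%:~R - b i / a i * u.2%:~R)^*)%C.
    by rewrite (fd_J fd); move: (b i / a i) => al; rewrite rmorphB rmorphM /= !rmorph_int.
  rewrite !q !J; move: (_ - _) (v.1%:~R - _) => x y.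
  by rewrite -[LHS]/((- conjc x) * (conjc y)^-1) -fmorphV -rmorphN -rmorphM.
Qed.

Definition spread v w : R :=
  \sum_i ln (Num.max (tw R * cn (lf a b v i)) (cn (lf a b w i) / tw R)).

Lemma eta_comb v w : eta (sa (lf a b v)) (sb (fun i => - lf a b w i)) = spread v w.
Proof. by apply: eq_bigr => i _; rewrite /ht cn_sa cn_sb cnN. Qed.

Lemma spread_ge0 v w : cross v w = 1 -> 0 <= spread v w.
Proof.
move=> vw; have [a0' d0' HI' _ _] := form_data_comb vw.
have n0 : (0 < n)%N by rewrite (leq_trans _ n4).
rewrite -eta_comb; apply: le_trans (la_le_eta _ a0'); exact: la_ge0_form HI'.
Qed.

(** Working up to the factor [19 / 10] only requires the infimum to be finite; whether it is
    attained need not be decided. *)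
Lemma reduced_basis : exists v w, cross v w = 1 /\
  forall x y, cross x y = 1 -> spread v w <= ln (19 / 10) + spread x y.
Proof.
pose E := [set r : R | exists v w, cross v w = 1 /\ r = spread v w].
have hE : has_inf E.
  split; first by exists (spread (1, 0) (0, 1)), (1, 0), (0, 1).
  by exists 0 => r [v [w [vw ->]]]; apply: spread_ge0.
have e0 : 0 < ln (19 / 10) :> R by rewrite ln_gt0 //; lra.
have [r [v [w [vw ->]]] hr] := inf_adherent e0 hE.
exists v, w; split => // x y xy; apply: le_trans (ltW hr) _; rewrite addrC lerD2l.
by apply: ge_inf; [exact: hE.2 | exists x, y].
Qed.

(** [g] gives the coordinates in the near-minimal basis; it keeps [cross] and the values of the
    linear factors, and the new form has the same [ell]. *)
Lemma count_ge4 (m e : R) (S : seq (int * int)) :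
  1 <= m -> 0 < e -> e < 1 -> ln m <= (1 - e) * ell a b - n%:R / 2 * ln (7 / 2) ->
  uniq S -> (forall v w, v \in S -> w \in S -> v != w -> cross v w != 0) ->
  (forall v, v \in S -> sol a b m v) ->
  (size S)%:R <= ((big_bound n).+1 * nreal c + 2 * npair c)%:R
     + 2 * (nreal c + npair c)%:R / e.
Proof.
move=> m1 e0 e1 hm uS cr hS; have [v [w [vw min]]] := reduced_basis.
have fd' := form_data_comb vw.
pose g u := (cross u w, cross v u).
have gK u : comb v w (g u) = u by apply: comb_cross.
have gi : injective g by apply: can_inj gK.
have crg x y : cross (g x) (g y) = cross x y.
  by rewrite -{2}(gK x) -{2}(gK y) cross_comb vw mul1r.
rewrite -(size_map g S).
apply: (count_reduced (m := m) n4 fd') => //.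
- move=> x y xy; rewrite eta_comb.
  have := min (comb v w x) (comb v w y); rewrite cross_comb vw mul1r => /(_ xy).
  by rewrite /spread; under [X in _ -> _ <= _ + X]eq_bigr do rewrite !lf_comb.
- suff -> : ell (sa (lf a b v)) (sb (fun i => - lf a b w i)) = ell a b by [].
  rewrite /ell; congr ((_ - _) / _); apply: eq_bigr => i _; apply: eq_bigr => j _.
  rewrite dt_scaled; congr (ln (cn _)).
  have -> : dt (lf a b v) (fun i => - lf a b w i) i j = dt a b i j * (cross v w)%:~R.
    by rewrite /dt /lf /cross rmorphB !rmorphM /=; ring.
  by rewrite vw mulr1.
- by rewrite map_inj_uniq.
- move=> x' y' /mapP[x xS ->] /mapP[y yS ->]; rewrite inj_eq // crg; exact: cr.
- move=> x' /mapP[x xS ->]; have [h1 h2] := hS x xS; split.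
    by apply: (@coprime_comb v w); rewrite gK.
  by rewrite -h2; apply: eq_bigr => i _; rewrite lf_comb gK.
Qed.

End Reduction.

(** * Cubic forms *)

Section CubicSiegel.
Variable R : realType.
Local Notation C := R[i].

(** Binomial coefficients under [x -> N - x], the symmetry that exchanges the exponents [ex s] and
    [ex' s]. *)
Lemma bin_reflect x N j : (x <= N)%N ->
  'C(N - x, j)%:R = \sum_(i < j.+1) (-1) ^+ i * 'C(x, i)%:R * 'C(N - i, j - i)%:R :> int.
Proof.
elim: x N j => [|x IH] N j xN.
  rewrite subn0 big_ord_recl /= expr0 bin0 !subn0 !mul1r big1 ?addr0 // => i _.
  by rewrite bin0n mulr0 mul0r.
case: N xN => // N xN; rewrite subSS.
case: j => [|j].
  by rewrite big_ord_recl big_ord0 /= !bin0 expr0 !mul1r addr0.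
have e1 : 'C(N - x, j.+1)%:R = 'C(N.+1 - x, j.+1)%:R - 'C(N - x, j)%:R :> int.
  by rewrite subSn // binS natrD addrK.
rewrite e1 IH 1?leqW // (IH N j) //.
rewrite big_ord_recl [in RHS]big_ord_recl /= !bin0 -addrA; congr (_ + _).
rewrite -sumrB; apply: eq_bigr => i _; rewrite /bump /= !add1n !subSS binS natrD exprS.
by ring.
Qed.

Section Family.
Variable p : nat.
Local Notation N := (3 * p).+1.
(** Since [ex s] is 1 and [ex' s] is 0 modulo 3, the approximation conditions at all three cube
    roots of unity reduce to those at [1]. Since [ex s + ex' s] is constant, the two polynomials are
    reciprocal to each other. *)
Definition ex (s : 'I_p.+1) : nat := (3 * (p - s)).+1.
Definition ex' (s : 'I_p.+1) : nat := (3 * s)%N.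

Lemma ex_sum s : (ex s + ex' s = N)%N.
Proof. by rewrite /ex /ex'; have := ltn_ord s; lia. Qed.

Lemma exE s : ex' s = (N - ex s)%N. Proof. by rewrite -(ex_sum s) addKn. Qed.
Lemma ex'E s : ex s = (N - ex' s)%N. Proof. by rewrite -(ex_sum s) addnK. Qed.
Lemma ex_le s : (ex s <= N)%N. Proof. by rewrite -(ex_sum s) leq_addr. Qed.
Lemma ex'_le s : (ex' s <= N)%N. Proof. by rewrite -(ex_sum s) leq_addl. Qed.

Lemma sum_exp2_ex : (\sum_(s < p.+1) (2 ^ ex s + 2 ^ ex' s) <= 2 ^ N.+1)%N.
Proof.
rewrite big_split /= (reindex_inj rev_ord_inj) /= -big_split /=.
rewrite (eq_bigr (fun s : 'I_p.+1 => 3 * 8 ^ s)%N) => [|s _]; last first.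
  have -> : ex (rev_ord s) = (3 * s).+1.
    by rewrite /ex /= subSS subKn // -ltnS.
  by rewrite /ex' expnS expnM (_ : (2 ^ 3 = 8)%N) //; move: (8 ^ s)%N; clear; lia.
have e q : (\sum_(s < q.+1) 3 * 8 ^ s <= 4 * 8 ^ q)%N.
  elim: q => [|q IH]; first by rewrite big_ord_recl big_ord0.
  by rewrite big_ord_recr /= [(8 ^ q.+1)%N]expnS; move: (\sum_(_ < _) _)%N (8 ^ q)%N IH; clear; lia.
apply: leq_trans (e p) _; rewrite !expnS expnM (_ : (2 ^ 3 = 8)%N) //.
by move: (8 ^ p)%N; clear; lia.
Qed.

Lemma bin_exp2 x j : ('C(x, j) <= 2 ^ x)%N. Proof. exact: bin_le_exp2. Qed.

Lemma sum_bin_ex j : (\sum_(s < p.+1) ('C(ex s, j) + 'C(ex' s, j)) <= 2 ^ N.+1)%N.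
Proof.
by apply: leq_trans sum_exp2_ex; apply: leq_sum => s _; rewrite leq_add // bin_exp2.
Qed.

(** By reflection the condition of even order is minus itself up to lower ones, hence follows from
    them: half of the equations come for free. *)
Lemma antisym_vanish (c : 'I_p.+1 -> int) w :
  (forall t, (t < w)%N ->
     \sum_s c s * ('C(ex s, (2 * t).+1)%:R - 'C(ex' s, (2 * t).+1)%:R) = 0) ->
  forall j, (j <= 2 * w)%N -> \sum_s c s * ('C(ex s, j)%:R - 'C(ex' s, j)%:R) = 0.
Proof.
move=> hodd; pose D j := \sum_s c s * ('C(ex s, j)%:R - 'C(ex' s, j)%:R).
have refl j : - D j = \sum_(i < j.+1) (-1) ^+ i * 'C(N - i, j - i)%:R * D i.
  under eq_bigr do rewrite /D mulr_sumr.
  rewrite exchange_big /= /D -sumrN; apply: eq_bigr => s _.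
  have h1 := bin_reflect j (ex_le s); have h2 := bin_reflect j (ex'_le s).
  rewrite -exE in h1; rewrite -ex'E in h2.
  rewrite -mulrN opprB h1 h2 -sumrB mulr_sumr.
  by apply: eq_bigr => i _; ring.
elim/ltn_ind => j IH jw; case: (boolP (odd j)) => oj.
  have {1 2}-> : j = (2 * j./2).+1 by rewrite -{1}(odd_double_half j) oj mul2n.
  by apply: hodd; rewrite -(odd_double_half j) oj in jw; lia.
have := refl j; rewrite big_ord_recr /= big1 ?add0r => [|i _]; last first.
  by rewrite /D IH ?mulr0 // (leq_trans _ jw) // ltnW.
rewrite subnn bin0 mulr1 -signr_odd (negbTE oj) expr0 mul1r -/(D j).
by move: (D j) => d; lia.
Qed.

(** [w] equations in [w + y + 1] unknowns; integers of modulus below 1 are zero. From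
    [p < 30 (y + 1)] follows [w <= 29 (y + 1)], whence the exponent [29]. *)
Lemma cubic_siegel y w (B : nat) : (w + y = p)%N -> (p < 30 * y.+1)%N ->
  B = (2 ^ (29 * N.+1))%N ->
  exists c : 'I_p.+1 -> int, [/\ exists s, c s != 0, forall s, `|c s| <= B%:Z &
    forall j, (j <= 2 * w)%N -> \sum_s c s * ('C(ex s, j)%:R - 'C(ex' s, j)%:R) = 0].
Proof.
move=> wy py BE.
have B0 : (0 < B)%N by rewrite BE expn_gt0.
pose W (t : 'I_w) : R := 2 ^+ N.+1.
pose wt (t : 'I_w) (s : 'I_p.+1) : R := 'C(ex s, (2 * t).+1)%:R - 'C(ex' s, (2 * t).+1)%:R.
have hW t : \sum_s `|wt t s| <= W t.
  apply: le_trans (_ : \sum_s ('C(ex s, (2 * t).+1) + 'C(ex' s, (2 * t).+1))%:R <= _).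
    apply: ler_sum => s _; rewrite natrD (le_trans (ler_normB _ _)) //.
    by rewrite !ger0_norm ?ler0n.
  by rewrite -natr_sum /W -natrX ler_nat sum_bin_ex.
have [||||c [c0 cB cv]] := @pigeonhole_forms R _ _ wt W B (fun _ => B * 2 ^ N.+1)%N hW.
- by move=> t; rewrite /W exprn_gt0.
- by move=> t; rewrite muln_gt0 B0 expn_gt0.
- exact: B0.
- rewrite prod_nat_const !card_ord.
  apply: (@leq_ltn_trans ((B.+1 * 2 ^ N.+1) ^ w)%N).
    case: (posnP w) => [->|w0]; first by rewrite !expn0.
    rewrite leq_exp2r //.
    by rewrite mulSn -addn1 addnC leq_add2r expn_gt0.
  have -> : (p.+1 = w + y.+1)%N by rewrite addnS wy.
  rewrite expnMn expnD ltn_pmul2l ?expn_gt0 // -expnM.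
  apply: (@leq_ltn_trans (B ^ y.+1)%N); last by rewrite ltn_exp2r.
  rewrite BE -expnM leq_exp2l // mulnAC [(N.+1 * w)%N]mulnC leq_mul2r.
  by apply/orP; right; move: wy py; clear; lia.
exists c; split => //; apply: antisym_vanish => t tw.
have := cv (Ordinal tw); rewrite /W natrM natrX divff; last first.
  by rewrite mulf_neq0 // ?pnatr_eq0 -?lt0n // expf_neq0 // pnatr_eq0.
have -> : \sum_s wt (Ordinal tw) s * (c s)%:~R
   = (\sum_s c s * ('C(ex s, (2 * t).+1)%:R - 'C(ex' s, (2 * t).+1)%:R))%:~R :> R.
  rewrite rmorph_sum /=; apply: eq_bigr => s _.
  by rewrite rmorphM rmorphB /= !rmorph_nat mulrC.
rewrite -intr_norm -[1]/(1%:~R) ltr_int; move: (\sum_(s < _) _) => d; lia.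
Qed.

End Family.
End CubicSiegel.

(** * Approximation of cube roots and conjugate values *)

Section CubicForms.
Variable R : realType.
Local Notation C := R[i].

Definition sqm3 : C := 'i%C * (Num.sqrt (3 : R))%:C%C.
Definition omega : C := (sqm3 - 1) / 2.

Lemma sqm3_sqr : sqm3 * sqm3 = -3.
Proof.
have h : (Num.sqrt (3 : R))%:C%C * (Num.sqrt (3 : R))%:C%C = 3 :> C.
  by rewrite -rmorphM /= -expr2 sqr_sqrtr ?ler0n // rmorph_nat.
have hi : 'i%C * 'i%C = -1 :> C by rewrite -expr2 sqr_i.
by rewrite /sqm3 mulrACA h hi mulN1r.
Qed.

Lemma two_neq0 : (2 : C) != 0. Proof. by rewrite pnatr_eq0. Qed.
Lemma three_neq0 : (3 : C) != 0. Proof. by rewrite pnatr_eq0. Qed.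

Lemma sqm3_omega : sqm3 = 1 + 2 * omega.
Proof. by rewrite /omega mulrC divfK ?two_neq0 //; ring. Qed.

Lemma omega_sum : omega * omega = -1 - omega.
Proof.
have h := sqm3_sqr; rewrite sqm3_omega in h.
have e : 4 * (omega * omega) = 4 * (-1 - omega).
  rewrite (_ : 4 * (omega * omega) = (1 + 2 * omega) * (1 + 2 * omega) - 1 - 4 * omega); last by ring.
  by rewrite h; ring.
by apply: (mulfI _ e); rewrite pnatr_eq0.
Qed.

Lemma omega3 : omega ^+ 3 = 1.
Proof.
rewrite !exprS expr0 mulr1 omega_sum mulrBr mulrN1 omega_sum; ring.
Qed.

Lemma sqm3_neq0 : sqm3 != 0.
Proof.
apply/eqP => z; have := sqm3_sqr; rewrite z mul0r => /esym/eqP.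
by rewrite oppr_eq0 (negbTE three_neq0).
Qed.

Lemma cn_sqm3 : cn sqm3 * cn sqm3 = 3.
Proof. by rewrite -cnM sqm3_sqr cnN cn_nat. Qed.

Lemma cn_sqm3_le2 : cn sqm3 <= 2.
Proof. by have := cn_sqm3; have := cn_ge0 sqm3 => *; nra. Qed.

Lemma cn_omega : cn omega = 1.
Proof.
have := congr1 (@cn R) omega3; rewrite cnX cn1 => h.
have h0 := cn_ge0 omega; apply/eqP; move/eqP: h.
by rewrite -[1 in X in X -> _](expr1n _ 3) eqrXn2 //.
Qed.

Definition cuberoot (i : 'I_3) : C := omega ^+ i.

Lemma cuberoot3 i : cuberoot i ^+ 3 = 1.
Proof. by rewrite /cuberoot -exprM mulnC exprM omega3 expr1n. Qed.

Lemma omega_neq1 : omega != 1.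
Proof.
apply/eqP => e; have := sqm3_sqr; rewrite sqm3_omega e => /eqP.
rewrite -subr_eq0 opprK (_ : _ + _ = 12%:R); last by ring.
by rewrite pnatr_eq0.
Qed.

Lemma omega_neq0 : omega != 0.
Proof. by apply/eqP => e; have := omega3; rewrite e expr0n /= => /eqP; rewrite eq_sym oner_eq0. Qed.

Lemma cuberoot_inj : injective cuberoot.
Proof.
have h01 : omega ^+ 0 != omega ^+ 1 by rewrite expr0 expr1 eq_sym omega_neq1.
have h12 : omega ^+ 1 != omega ^+ 2.
  rewrite expr1 expr2 -{1}[omega]mulr1 (inj_eq (mulfI omega_neq0)) eq_sym; exact: omega_neq1.
have h02 : omega ^+ 0 != omega ^+ 2.
  apply/eqP => e; have := omega3; rewrite exprS -e expr0 mulr1 => /eqP.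
  by rewrite (negbTE omega_neq1).
move=> [i hi] [j hj]; rewrite /cuberoot /= => /eqP e; apply: val_inj => /=.
by move: i j hi hj e => [|[|[|//]]] [|[|[|//]]] // _ _;
  rewrite ?(negbTE h01) ?(negbTE h12) ?(negbTE h02) // eq_sym
    ?(negbTE h01) ?(negbTE h12) ?(negbTE h02).
Qed.

Section Quad.
(** Conjugate elements of [Z[de]], kept as a pair because [de] may itself be an integer, and then a
    value does not determine its conjugate. *)
Definition quadpair (de : C) (z z' : C) :=
  exists al be : int, z = al%:~R + be%:~R * de /\ z' = al%:~R - be%:~R * de.

Variables (de : C) (dd : int).
Hypothesis de2 : de * de = dd%:~R.

Lemma quadpair_int (k : int) : quadpair de k%:~R k%:~R.
Proof. by exists k, 0; rewrite mul0r addr0 subr0. Qed.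

Lemma quadpairM x x' z z' : quadpair de x x' -> quadpair de z z' -> quadpair de (x * z) (x' * z').
Proof.
move=> [a1 [b1 [-> ->]]] [a2 [b2 [-> ->]]].
exists (a1 * a2 + b1 * b2 * dd), (a1 * b2 + a2 * b1).
by rewrite !rmorphD !rmorphM /= -de2; split; ring.
Qed.

Lemma quadpairB x x' z z' : quadpair de x x' -> quadpair de z z' -> quadpair de (x - z) (x' - z').
Proof.
move=> [a1 [b1 [-> ->]]] [a2 [b2 [-> ->]]].
by exists (a1 - a2), (b1 - b2); rewrite !rmorphB /=; split; ring.
Qed.

Lemma quadpair_sym x x' : quadpair de x x' -> quadpair de x' x.
Proof.
move=> [a1 [b1 [-> ->]]]; exists a1, (- b1).
by rewrite !rmorphN /= mulNr opprK.
Qed.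

Lemma quadpairX x x' k : quadpair de x x' -> quadpair de (x ^+ k) (x' ^+ k).
Proof.
move=> h; elim: k => [|k IH]; first by rewrite !expr0; exact: (quadpair_int 1).
by rewrite !exprS; apply: quadpairM.
Qed.

Lemma quadpair_sum (I : finType) (f g : I -> C) : (forall s, quadpair de (f s) (g s)) ->
  quadpair de (\sum_s f s) (\sum_s g s).
Proof.
move=> h; elim/big_ind2: _ => [|x x' z z' h1 h2|s _]; [exact: (quadpair_int 0)| |exact: h].
by move: (quadpairB h1 (quadpairB (quadpair_int 0) h2)); rewrite !sub0r !opprK.
Qed.

(** Either the sum is twice a nonzero integer, or the difference is twice a nonzero integer times
    [de]. *)
Lemma quadpair_ge x x' : 1 <= cn de -> quadpair de x x' -> x != 0 -> 2 <= cn x + cn x'.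
Proof.
move=> de1 [al [be [E E']]] x0.
have h1 : cn (x + x') <= cn x + cn x' := cnD _ _.
have h2 : cn (x - x') <= cn x + cn x' := cnB _ _.
have [al0|al0] := eqVneq al 0.
  have be0 : be != 0 by apply: contra x0 => /eqP b0; rewrite E al0 b0 mul0r addr0.
  apply: le_trans h2; rewrite E E' (_ : _ - _ = 2 * be%:~R * de); last by ring.
  rewrite !cnM cn_nat cn_int.
  have b1 : 1 <= `|be|%:~R :> R by rewrite ler1z; move: be0; lia.
  by rewrite -mulrA -[leLHS]mulr1 ler_wpM2l // -[leLHS]mulr1 ler_pM.
apply: le_trans h1; rewrite E E' (_ : _ + _ = 2 * al%:~R); last by ring.
rewrite !cnM cn_nat cn_int.
have : 1 <= `|al|%:~R :> R by rewrite ler1z; move: al0; lia.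
by lra.
Qed.

End Quad.

Section Family.
Variables (p : nat) (c : 'I_p.+1 -> int) (w y B : nat).
Local Notation N := (3 * p).+1.
Hypothesis c0 : exists s, c s != 0.
Hypothesis cB : forall s, `|c s| <= B%:Z.
Hypothesis cV : forall j, (j <= 2 * w)%N ->
  \sum_s c s * ('C(ex s, j)%:R - 'C(ex' s, j)%:R) = 0.
Hypothesis wy : (w + y = p)%N.
Hypothesis yp : (4 * y <= p)%N.

Let U : {poly C} := \sum_s (c s)%:~R *: 'X^(ex s).
Let V : {poly C} := \sum_s (c s)%:~R *: 'X^(ex' s).

Let size_sumX (e : 'I_p.+1 -> nat) : (forall s, (e s <= N)%N) ->
  (size (\sum_s (c s)%:~R *: 'X^(e s) : {poly C})%R <= N.+1)%N.
Proof.
move=> h; rewrite (leq_trans (size_sum _ _ _)) //; apply/bigmax_leqP => s _.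
by rewrite (leq_trans (size_scale_leq _ _)) // size_polyXn ltnS.
Qed.

Let sumX_deriv (e : 'I_p.+1 -> nat) j (z : C) :
  z ^+ j * ((\sum_s (c s)%:~R *: 'X^(e s))^`N(j)).[z]
    = \sum_s (c s)%:~R * ('C(e s, j)%:R * z ^+ e s).
Proof.
rewrite linear_sum /= horner_sum mulr_sumr; apply: eq_bigr => s _.
rewrite nderivnZ nderivnXn hornerZ hornerMn hornerXn.
case: (ltnP (e s) j) => h; first by rewrite bin_small // mulr0n mul0r !mulr0.
have -> : z ^+ e s = z ^+ j * z ^+ (e s - j) by rewrite -exprD subnKC.
rewrite -mulr_natl; ring.
Qed.

(** The zero estimate at the three cube roots of unity. The order [6 y + 1] is just enough:
    [2 N = 6 p + 2] against [6 w + (6 y + 1) + 2 = 6 p + 3]. *)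
Lemma cubic_nonvanishing (z Y : C) : z != 0 -> z ^+ 3 != 1 ->
  exists2 l, (l <= 6 * y + 1)%N &
   \sum_s (c s)%:~R * ('C(ex s, l)%:R * z ^+ ex s - Y * ('C(ex' s, l)%:R * z ^+ ex' s)) != 0.
Proof.
move=> z0 z3.
have [l lJ h] : exists2 j, (j <= 6 * y + 1)%N & (U^`N(j)).[z] - Y * (V^`N(j)).[z] != 0.
  apply: (@wronskian_zero_estimate _ 3 cuberoot U V N (2 * w)) => //.
  - exact: cuberoot_inj.
  - by move=> i; apply: contra z3 => /eqP ->; rewrite cuberoot3.
  - by apply: size_sumX => s; apply: ex_le.
  - by apply: size_sumX => s; apply: ex'_le.
  - apply/orP; right; have [s cs] := c0; apply/eqP => V0.
    have := congr1 (fun q : {poly C} => q`_(ex' s)) V0; rewrite coef0 coef_sum.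
    rewrite (bigD1 s) //= big1 => [|t ts].
      by rewrite coefZ coefXn eqxx mulr1 addr0 => /eqP; rewrite intr_eq0 (negbTE cs).
    rewrite coefZ coefXn /ex' eqn_mul2l /= (inj_eq val_inj) eq_sym (negbTE ts).
    by rewrite mulr0.
  - move=> i; apply: dvdp_XsubC_exp => j jw.
    set al := cuberoot i; have al3 : al ^+ 3 = 1 := cuberoot3 i.
    have al0 : al != 0 by rewrite expf_neq0 // omega_neq0.
    have aj : al ^+ j != 0 by rewrite expf_neq0.
    apply: (mulfI aj); rewrite mulr0 nderivnB nderivnZ hornerD hornerN hornerZ mulrBr.
    rewrite mulrCA !sumX_deriv mulr_sumr -sumrB.
    have e1 s : al ^+ ex s = al by rewrite /ex exprS exprM al3 expr1n mulr1.
    have e2 s : al ^+ ex' s = 1 by rewrite /ex' exprM al3 expr1n.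
    transitivity (al * (\sum_s c s * ('C(ex s, j)%:R - 'C(ex' s, j)%:R))%:~R); last first.
      by rewrite cV ?mulr0 // -ltnS.
    rewrite rmorph_sum mulr_sumr; apply: eq_bigr => s _.
    by rewrite e1 e2 rmorphM rmorphB /= !rmorph_nat; ring.
  - by move: wy yp; clear; lia.
  - by move: wy yp; clear; lia.
exists l => //; have zl : z ^+ l != 0 by rewrite expf_neq0.
have := mulf_neq0 zl h; rewrite mulrBr mulrCA !sumX_deriv mulr_sumr -sumrB.
by congr (_ != _); apply: eq_bigr => s _; ring.
Qed.

(** The homogenized form of [z^l (U_l(z) - Y V_l(z))] at [z = u / v], [Y = u' / v'], with divided
    derivatives of order [l]. Exchanging [u] with [v] and [u'] with [v'] gives the conjugate
    value. *)
Definition Lam l (u v u' v' : C) : C := \sum_s (c s)%:~R *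
  ('C(ex s, l)%:R * (u ^+ ex s * v ^+ ex' s) * v'
   - 'C(ex' s, l)%:R * (u ^+ ex' s * v ^+ ex s) * u').

Lemma Lam_neq0 (u v u' v' : C) : u != 0 -> v != 0 -> v' != 0 -> u ^+ 3 != v ^+ 3 ->
  exists2 l, (l <= 6 * y + 1)%N & Lam l u v u' v' != 0.
Proof.
move=> u0 v0 v0' uv3.
have z3 : (u / v) ^+ 3 != 1.
  by rewrite expr_div_n; apply: contra uv3 => /eqP e; rewrite -[u ^+ 3](divfK (expf_neq0 3 v0)) e mul1r.
have zn0 : u / v != 0 by rewrite mulf_neq0 // invr_eq0.
have [l lJ h] := cubic_nonvanishing (u' / v') zn0 z3; exists l => //.
have vN : v ^+ N * v' != 0 by rewrite mulf_neq0 // expf_neq0.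
have := mulf_neq0 vN h; rewrite mulr_sumr /Lam; congr (_ != _); apply: eq_bigr => s _.
have sp : v ^+ N = v ^+ ex s * v ^+ ex' s by rewrite -exprD ex_sum.
rewrite sp !expr_div_n.
have x1 : v ^+ ex s != 0 by rewrite expf_neq0.
have x2 : v ^+ ex' s != 0 by rewrite expf_neq0.
by field; rewrite v0' x1 x2.
Qed.

Let cBR s : cn ((c s)%:~R : C) <= B%:R.
Proof. by rewrite cn_int; have := cB s; rewrite -(ler_int R). Qed.

(** As for [eval_le], but expanded at [1], to which [u / v] is close: vanishing to order [2 w + 1]
    leaves at least [t] factors [u - v]. *)
Lemma Lam_le l t K K' d d' (u v u' v' : C) : (l + t = (2 * w).+1)%N -> v != 0 ->
  cn u <= K -> cn v <= K -> cn (u - v) <= d -> d <= K -> 0 < d ->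
  cn v' <= K' -> cn (v' - u') <= d' ->
  cn (Lam l u v u' v') <= K' * (B%:R * 2 ^+ (2 * N + 3) * (K ^+ (N - t) * d ^+ t))
     + d' * (B%:R * 2 ^+ N.+1 * K ^+ N).
Proof.
move=> lt v0 uK vK dK dK0 d0 vK' dd'.
have K0 : 0 < K := lt_le_trans d0 dK0.
have tN : (t <= N)%N by move: lt wy; clear; lia.
pose S1 := \sum_s (c s)%:~R * ('C(ex s, l)%:R * (u ^+ ex s * v ^+ ex' s)
   - 'C(ex' s, l)%:R * (u ^+ ex' s * v ^+ ex s)).
pose S2 := \sum_s (c s)%:~R * ('C(ex' s, l)%:R * (u ^+ ex' s * v ^+ ex s)).
have -> : Lam l u v u' v' = v' * S1 + (v' - u') * S2.
  by rewrite /Lam /S1 /S2 !mulr_sumr -big_split /=; apply: eq_bigr => s _; ring.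
have B0 : 0 <= B%:R :> R by rewrite ler0n.
have powK q q' (a b : C) : (q + q' = N)%N -> cn a <= K -> cn b <= K ->
    cn (a ^+ q * b ^+ q') <= K ^+ N.
  move=> <- aK bK; rewrite cnM !cnX exprD ler_pM ?exprn_ge0 ?cn_ge0 //.
    by rewrite lerXn2r ?nnegrE ?cn_ge0 // ltW.
  by rewrite lerXn2r ?nnegrE ?cn_ge0 // ltW.
have S2le : cn S2 <= B%:R * 2 ^+ N.+1 * K ^+ N.
  apply: le_trans (cn_sum _ _ _) _.
  apply: le_trans (_ : \sum_s B%:R * ('C(ex s, l) + 'C(ex' s, l))%:R * K ^+ N <= _).
    apply: ler_sum => s _; rewrite !cnM cn_nat -mulrA; apply: ler_pM => //.
    + exact: cn_ge0.
    + by rewrite mulr_ge0 ?ler0n // mulr_ge0 ?cn_ge0.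
    + apply: ler_pM; rewrite ?ler0n ?mulr_ge0 ?cn_ge0 //.
        by rewrite ler_nat leq_addl.
      by rewrite -cnM; apply: powK => //; rewrite addnC ex_sum.
  rewrite -mulr_suml -mulr_sumr -natr_sum; apply: ler_wpM2r; first by rewrite exprn_ge0 // ltW.
  by apply: ler_wpM2l => //; rewrite -natrX ler_nat sum_bin_ex.
pose A : {poly C} := U - V.
have sA : (size A <= N.+1)%N.
  rewrite (leq_trans (size_polyD _ _)) // size_polyN geq_max.
  by rewrite !size_sumX // => s; [apply: ex'_le | apply: ex_le].
have A1 j : (A^`N(j)).[1] = \sum_s (c s)%:~R * ('C(ex s, j)%:R - 'C(ex' s, j)%:R).
  rewrite -[LHS]mul1r -{1}(expr1n C j) /A nderivnB hornerD hornerN mulrBr !sumX_deriv -sumrB.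
  by apply: eq_bigr => s _; rewrite !expr1n; ring.
have A1v j : (j <= 2 * w)%N -> (A^`N(j)).[1] = 0.
  move=> jw; rewrite A1; transitivity (((\sum_s c s * ('C(ex s, j)%:R - 'C(ex' s, j)%:R))%:~R) : C).
    by rewrite rmorph_sum; apply: eq_bigr => s _; rewrite rmorphM rmorphB /= !rmorph_nat.
  by rewrite cV.
have A1le j : cn (A^`N(j)).[1] <= B%:R * 2 ^+ N.+1.
  rewrite A1; apply: le_trans (cn_sum _ _ _) _.
  apply: le_trans (_ : \sum_s B%:R * ('C(ex s, j) + 'C(ex' s, j))%:R <= _).
    apply: ler_sum => s _; rewrite cnM; apply: ler_pM; rewrite ?cn_ge0 //.
    by rewrite (le_trans (cnB _ _)) // !cn_nat natrD.
  by rewrite -mulr_sumr -natr_sum; apply: ler_wpM2l => //; rewrite -natrX ler_nat sum_bin_ex.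
have S1E : S1 = \sum_(j < N.+1) (A^`N(j)).[1] * 'C(j, l)%:R *
    (u ^+ l * (u - v) ^+ (j - l) * v ^+ (N - j)).
  have vN : v ^+ N != 0 by rewrite expf_neq0.
  transitivity (v ^+ N * ((u / v) ^+ l * (A^`N(l)).[u / v])).
    rewrite /A nderivnB hornerD hornerN mulrBr !sumX_deriv -sumrB mulr_sumr /S1.
    apply: eq_bigr => s _.
    have -> : v ^+ N = v ^+ ex s * v ^+ ex' s by rewrite -exprD ex_sum.
    have x1 : v ^+ ex s != 0 by rewrite expf_neq0.
    have x2 : v ^+ ex' s != 0 by rewrite expf_neq0.
    by rewrite !expr_div_n; field; rewrite x1 x2.
  rewrite {1}(taylor_poly 1 sA) linear_sum /= horner_sum !mulr_sumr.
  apply: eq_bigr => j _; rewrite nderivnZ nderivn_XsubC_exp hornerZ hornerMn horner_exp hornerXsubC.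
  case: (ltnP j l) => jl; first by rewrite bin_small // mulr0n !mulr0 mul0r.
  have jN : (j <= N)%N by rewrite -ltnS.
  have -> : u / v - 1 = (u - v) / v by field.
  have -> : v ^+ N = v ^+ l * v ^+ (j - l) * v ^+ (N - j).
    by rewrite -!exprD; congr (_ ^+ _); move: jl jN; clear; lia.
  have x1 : v ^+ l != 0 by rewrite expf_neq0.
  have x2 : v ^+ (j - l) != 0 by rewrite expf_neq0.
  rewrite !expr_div_n -mulr_natr; field; by rewrite x1 x2.
have S1le : cn S1 <= B%:R * 2 ^+ (2 * N + 3) * (K ^+ (N - t) * d ^+ t).
  rewrite S1E; apply: le_trans (cn_sum _ _ _) _.
  apply: le_trans (_ : \sum_(j < N.+1) B%:R * 2 ^+ N.+1 * (K ^+ (N - t) * d ^+ t) * 2 ^+ j <= _).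
    apply: ler_sum => j _; case: (leqP j (2 * w)) => jw.
      rewrite A1v // !mul0r cn0.
      have p2 q : 0 <= (2 : R) ^+ q by rewrite exprn_ge0.
      exact: mulr_ge0 (mulr_ge0 (mulr_ge0 B0 (p2 _)) (mulr_ge0 (exprn_ge0 _ (ltW K0))
        (exprn_ge0 _ (ltW d0)))) (p2 _).
    have jN : (j <= N)%N by rewrite -ltnS.
    rewrite !cnM cn_nat -[leRHS]mulrA [_ * 2 ^+ j]mulrC -mulrA; apply: ler_pM.
    + exact: cn_ge0.
    + by rewrite !mulr_ge0 ?ler0n ?cn_ge0.
    + exact: A1le.
    + apply: ler_pM; rewrite ?ler0n ?mulr_ge0 ?cn_ge0 //.
        by rewrite -natrX ler_nat bin_exp2.
      rewrite !cnX.
      have e1 : (j - l = t + (j - (2 * w).+1))%N by move: lt jw; clear; lia.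
      have e2 : (N - t = l + (j - (2 * w).+1) + (N - j))%N by move: lt jw jN tN; clear; lia.
      rewrite e1 e2 !exprD.
      have -> : K ^+ l * K ^+ (j - (2 * w).+1) * K ^+ (N - j) * d ^+ t =
        K ^+ l * (d ^+ t * K ^+ (j - (2 * w).+1)) * K ^+ (N - j) by ring.
      have K00 := ltW K0; have d00 := ltW d0.
      have pw (x z : R) q : 0 <= x -> x <= z -> 0 <= x ^+ q /\ x ^+ q <= z ^+ q.
        move=> x0 xz; split; first exact: exprn_ge0.
        by rewrite lerXn2r ?nnegrE // (le_trans x0).
      have [q1 q2] := pw _ _ l (cn_ge0 u) uK.
      have [q3 q4] := pw _ _ t (cn_ge0 _) dK.
      have [q5 q6] := pw _ _ (j - (2 * w).+1)%N (cn_ge0 _) (le_trans dK dK0).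
      have [q7 q8] := pw _ _ (N - j)%N (cn_ge0 v) vK.
      by apply: ler_pM => //; rewrite ?mulr_ge0 //; apply: ler_pM => //; rewrite ?mulr_ge0 //; apply: ler_pM.
  rewrite -mulr_sumr [X in X <= _]mulrAC; apply: ler_wpM2r.
    by rewrite mulr_ge0 ?exprn_ge0 // ltW.
  rewrite -mulrA; apply: ler_wpM2l => //.
  apply: le_trans (_ : 2 ^+ N.+1 * 2 ^+ N.+1 <= _).
    by apply: ler_wpM2l; rewrite ?exprn_ge0 // sum_exp2.
  by rewrite -exprD; apply: ler_weXn2l; [rewrite ler1n | clear; lia].
apply: le_trans (cnD _ _) _; rewrite !cnM; apply: lerD; apply: ler_pM; rewrite ?cn_ge0 //.
Qed.

(** Every term is a product of [p] cubes and one mixed product [u v'] or [v u']; twice each of these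
    lies in [Z[de]], whence [2 ^+ p.+1]. *)
Lemma Lam_integral (de : C) (dd : int) l (u v u' v' : C) : de * de = dd%:~R ->
  quadpair de (2 * u ^+ 3) (2 * v ^+ 3) -> quadpair de (2 * (u * v')) (2 * (v * u')) ->
  quadpair de (2 ^+ p.+1 * Lam l u v u' v') (2 ^+ p.+1 * Lam l v u v' u').
Proof.
move=> de2 h1 h2; rewrite /Lam !mulr_sumr; apply: quadpair_sum => s.
have key (x z x' z' : C) : 2 ^+ p.+1 * ((c s)%:~R *
    ('C(ex s, l)%:R * (x ^+ ex s * z ^+ ex' s) * z' - 'C(ex' s, l)%:R * (x ^+ ex' s * z ^+ ex s) * x'))
  = (c s)%:~R * (('C(ex s, l) : int)%:~R * ((2 * x ^+ 3) ^+ (p - s) * (2 * z ^+ 3) ^+ s * (2 * (x * z')))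
     - ('C(ex' s, l) : int)%:~R * ((2 * z ^+ 3) ^+ (p - s) * (2 * x ^+ 3) ^+ s * (2 * (z * x')))).
  have -> : (2 : C) ^+ p.+1 = 2 ^+ (p - s) * 2 ^+ s * 2.
    by rewrite -exprD subnK -?exprSr // -ltnS.
  have e1 (t : C) : t ^+ ex s = t * (t ^+ 3) ^+ (p - s) by rewrite /ex exprS exprM.
  have e2 (t : C) : t ^+ ex' s = (t ^+ 3) ^+ s by rewrite /ex' exprM.
  rewrite -!pmulrn !e1 !e2 !exprMn; move: (x ^+ 3) (z ^+ 3) => X Z; ring.
rewrite !key; have h1' := quadpair_sym h1; have h2' := quadpair_sym h2.
apply: (quadpairM de2); first exact: quadpair_int.
apply: quadpairB; apply: (quadpairM de2); try exact: quadpair_int.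
  by apply: (quadpairM de2) => //; apply: (quadpairM de2); apply: (quadpairX de2).
by apply: (quadpairM de2) => //; apply: (quadpairM de2); apply: (quadpairX de2).
Qed.

End Family.
End CubicForms.

(** * Thue's method for cubic forms *)

Section CubicPair.
Variable R : realType.
Local Notation C := R[i].

(** The leading terms are [3 p A - 2 A2] and [A2 - 3 p A + 24 y A]; both are negative when [A2] is
    about [25 / 14 * p A] and [y <= p / 30]. *)
Lemma cubic_numeric (p y t A A2 L lm k : R) :
  4 <= p -> 30 * y <= p -> y = 0 \/ 1 <= y -> 2 * p - 8 * y <= t -> t <= 2 * p + 1 ->
  20 * L + 125 <= A -> 49 / 5 <= L -> lm <= L / 4 -> 0 <= k -> k <= 19 / 25 ->
  p * A <= 14 / 25 * A2 -> 14 / 25 * A2 <= (p + 1) * A ->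
  (p + 2) * k + (2 * k + L / 2 + lm - 2 * A2) + 29 * (3 * p + 2) * k + (3 * p + 2) * k
    + (3 * p + 1) * (k + A) < 0 /\
  (p + 2) * k + (k + A2) + 29 * (3 * p + 2) * k + (2 * (3 * p + 1) + 3) * k
    + (3 * p + 1 - t) * (k + A) + t * (2 * k + L / 2 + lm - 2 * A) < 0.
Proof.
move=> p4 py y01 t1 t2 hA hL hlm k0 k1 h1 h2.
have A0 : 321 <= A by lra.
have F1 : p * k <= p * (19 / 25) by apply: ler_wpM2l => //; lra.
have F2 : p * 321 <= p * A by apply: ler_wpM2l => //; lra.
have F6 : 4 * A <= p * A by apply: ler_wpM2r => //; lra.
have t0 : 0 <= t by case: y01 => [y0|y1]; lra.
have F3 : t * (20 * L) <= t * A by apply: ler_wpM2l => //; lra.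
have F3' : t * lm <= t * (L / 4) by apply: ler_wpM2l.
have F7 : t * k <= (2 * p + 1) * k by apply: ler_wpM2r.
have F4 : (2 * p - 8 * y) * A <= t * A by apply: ler_wpM2r => //; lra.
have F5 : 30 * y * A <= p * A by apply: ler_wpM2r => //; lra.
clear t1 t2 t0 py p4 k0.
split; first by clear F3 F3' F7 F4 F5 y01; lra.
case: y01 => [y0|y1].
  by rewrite y0 in F4 F5; clear F5; lra.
have F8 : 1 * A <= y * A by apply: ler_wpM2r => //; lra.
by lra.
Qed.

Variables (M1 M2 M3 : int * int -> C) (sD : C) (D : int).
Variables (Fv G : int * int -> int) (T : int * int -> int * int -> int).
Hypothesis Msum : forall v, M3 v = - M1 v - M2 v.
Hypothesis Mcross : forall v w, M1 v * M2 w - M2 v * M1 w = sD * (cross v w)%:~R.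
Hypothesis Mprod : forall v, M1 v * M2 v * M3 v = sD * (Fv v)%:~R.
Hypothesis MT : forall v w, M1 v * M1 w + M2 v * M2 w + M3 v * M3 w = (T v w)%:~R.
Hypothesis MG : forall v, (M2 v - M3 v) * (M3 v - M1 v) * (M1 v - M2 v) = (G v)%:~R.
Hypothesis sD2 : sD * sD = D%:~R.
Hypothesis sD0 : sD != 0.

Let om := omega R.
Let sq := sqm3 R.
Let uu v : C := - (1 + om) * M1 v - M2 v.
Let vv v : C := om * M1 v - M2 v.
Let de : C := sq * sD.

Let de2 : de * de = (-3 * D)%:~R.
Proof. by rewrite /de mulrACA sqm3_sqr sD2 rmorphM /= rmorphN. Qed.

Let uvE v : uu v * vv v = M1 v * M1 v + M1 v * M2 v + M2 v * M2 v.
Proof.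
have h := omega_sum R; rewrite -/om in h.
rewrite (_ : uu v * vv v = - (om + om * om) * (M1 v * M1 v) + M1 v * M2 v + M2 v * M2 v).
  by rewrite h; ring.
by rewrite /uu /vv; ring.
Qed.

Let cubes v : quadpair de (2 * uu v ^+ 3) (2 * vv v ^+ 3).
Proof.
have k : sq = 1 + 2 * om := sqm3_omega R.
have hG := MG v; have hF := Mprod v; rewrite !Msum in hG hF.
have d3 : uu v ^+ 3 - vv v ^+ 3 = 3 * (Fv v)%:~R * de.
  rewrite (_ : _ - _ = (uu v - vv v) * ((uu v + vv v) ^+ 2 - uu v * vv v)); last by ring.
  rewrite uvE /de (_ : _ * (sq * sD) = 3 * sq * (sD * (Fv v)%:~R)); last by ring.
  by rewrite -hF k /uu /vv; ring.
have s3 : uu v ^+ 3 + vv v ^+ 3 = - (G v)%:~R.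
  rewrite (_ : _ + _ = (uu v + vv v) * ((uu v + vv v) ^+ 2 - 3 * (uu v * vv v))); last by ring.
  by rewrite uvE -hG /uu /vv; ring.
exists (- G v), (3 * Fv v); rewrite rmorphN rmorphM /= -s3 -[3%:~R]/(3 : C) -d3; split; ring.
Qed.

Let prods v w : quadpair de (2 * (uu v * vv w)) (2 * (vv v * uu w)).
Proof.
have k : sq = 1 + 2 * om := sqm3_omega R.
have h := omega_sum R; rewrite -/om in h.
have s2 : uu v * vv w + vv v * uu w = (T v w)%:~R.
  rewrite (_ : _ + _ = - 2 * (om + om * om) * (M1 v * M1 w) + (M1 v * M2 w + M2 v * M1 w)
     + 2 * (M2 v * M2 w)); last by rewrite /uu /vv; ring.
  by rewrite h -MT !Msum; ring.
have d2 : uu v * vv w - vv v * uu w = (cross v w)%:~R * de.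
  rewrite /de (_ : _ * (sq * sD) = sq * (sD * (cross v w)%:~R)); last by ring.
  by rewrite -Mcross k /uu /vv; ring.
exists (T v w), (cross v w); rewrite -s2 -d2; split; ring.
Qed.

Definition Xi v : R := Num.max (cn (M1 v)) (Num.max (cn (M2 v)) (cn (M3 v))).

Lemma Xi_ge v : [/\ cn (M1 v) <= Xi v, cn (M2 v) <= Xi v & cn (M3 v) <= Xi v].
Proof. by rewrite /Xi !le_max !lexx !orbT. Qed.

Lemma M_tri v : [/\ cn (M1 v) <= cn (M2 v) + cn (M3 v), cn (M2 v) <= cn (M1 v) + cn (M3 v)
  & cn (M3 v) <= cn (M1 v) + cn (M2 v)].
Proof.
have h := Msum v.
have e1 : M1 v = - (M2 v + M3 v) by rewrite h; ring.
have e2 : M2 v = - (M1 v + M3 v) by rewrite h; ring.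
have e3 : M3 v = - (M1 v + M2 v) by rewrite h; ring.
split; first by rewrite {1}e1 cnN cnD.
  by rewrite {1}e2 cnN cnD.
by rewrite {1}e3 cnN cnD.
Qed.

Definition rel1 v := cn (M1 v) <= cn (M2 v) /\ cn (M1 v) <= cn (M3 v).

(** Three numbers with sum zero: the largest modulus is at most twice the middle one. *)
Lemma Xi_half v : rel1 v -> Xi v <= 2 * cn (M2 v) /\ Xi v <= 2 * cn (M3 v).
Proof.
move=> [h1 h2]; have [t1 t2 t3] := M_tri v; have := cn_ge0 (M1 v).
by rewrite /Xi !ge_max; split; apply/and3P; split; lra.
Qed.

Lemma rel1_small v mm : rel1 v -> cn (M1 v * M2 v * M3 v) = cn sD * mm -> 0 < Xi v ->
  cn (M1 v) <= 2 * (cn sD * mm) / (Xi v * Xi v).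
Proof.
move=> rv E X0; have [h2 h3] := Xi_half rv; rewrite ler_pdivlMr ?mulr_gt0 // -E !cnM.
have [g1 g2 g3] := Xi_ge v.
have : Xi v * Xi v <= 2 * (cn (M2 v) * cn (M3 v)).
  have n2 := cn_ge0 (M2 v); have n3 := cn_ge0 (M3 v).
  have : Xi v = cn (M1 v) \/ Xi v = cn (M2 v) \/ Xi v = cn (M3 v).
    rewrite /Xi; case: (leP (cn (M2 v)) (cn (M3 v))) => _;
      by case: leP => _; tauto.
  have [r1 r2] := rv; case=> [e|[e|e]].
  - have e2 : cn (M2 v) = Xi v by apply/eqP; rewrite eq_le g2 e.
    by rewrite e2 mulrCA ler_pM2l.
  - by rewrite -e mulrCA ler_pM2l.
  - by rewrite -e mulrA ler_pM2r.
by move=> /(ler_wpM2l (cn_ge0 (M1 v))); lra.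
Qed.

(** The two conjugate values of [Lam] have the same upper bound [T1 + T2], which even after
    multiplication by [2 ^+ p.+1] is too small for [quadpair_ge]. *)
Lemma cubic_thue_pair (v w : int * int) (mm : R) :
  let L := 2 * ln (cn sD) in
  rel1 v -> rel1 w -> 0 < mm -> 0 < Xi v -> 0 < Xi w ->
  cn (M1 v * M2 v * M3 v) = cn sD * mm -> cn (M1 w * M2 w * M3 w) = cn sD * mm ->
  20 * L + 125 <= ln (Xi v) -> 49 / 5 <= L -> ln mm <= L / 4 ->
  36 / 5 * ln (Xi v) <= ln (Xi w) -> False.
Proof.
move=> L rv rw m0 Xv Xw Ev Ew hA hL hm hAA.
pose A := ln (Xi v); pose A2 := ln (Xi w); pose k : R := ln 2.
have sd0 : 0 < cn sD by rewrite cn_gt0.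
have k0 : 0 <= k by apply: ln2_ge0.
have k1 : k <= 19 / 25.
  have l1 (x : R) : 0 < x -> ln (1 + x) <= x by move=> x0; apply: le_ln1Dx; lra.
  (* A telescoping product, which lets [ln (1 + x) <= x] act on small [x]. *)
  have e2 : 2 = (1 + 1 / 4) * ((1 + 1 / 5) * ((1 + 1 / 6) * (1 + 1 / 7))) :> R by lra.
  have e : k = ln (1 + 1 / 4) + (ln (1 + 1 / 5) + (ln (1 + 1 / 6) + ln (1 + 1 / 7))).
    by rewrite /k {1}e2 !lnMp //; lra.
  have q4 : ln (1 + 1 / 4) <= 1 / 4 :> R by apply: l1; lra.
  have q5 : ln (1 + 1 / 5) <= 1 / 5 :> R by apply: l1; lra.
  have q6 : ln (1 + 1 / 6) <= 1 / 6 :> R by apply: l1; lra.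
  have q7 : ln (1 + 1 / 7) <= 1 / 7 :> R by apply: l1; lra.
  by rewrite e; lra.
have A0 : 0 < A by rewrite /A; lra.
have L0 : 0 < L by lra.
have A20 : 0 <= 14 / 25 * A2 / A by rewrite divr_ge0 // ?ltW // /A2; lra.
have [p [p1 p2]] : exists p, p%:R * A <= 14 / 25 * A2 /\ 14 / 25 * A2 <= (p%:R + 1) * A.
  exists (Num.truncn (14 / 25 * A2 / A)); rewrite -ler_pdivlMr // truncn_le; split => //.
  by rewrite -ler_pdivrMr // natr1 ltW // truncnS_gt.
(* The ratio [36 / 5] is chosen for this: [14 / 25 * 36 / 5 > 4]. *)
have p4n : (4 <= p)%N.
  rewrite -ltnS -(ltr_nat R) -(ltr_pM2r A0) -[p.+1%:R]natr1.
  by apply: lt_le_trans p2; rewrite /A /A2 in A0 *; lra.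
have p4 : 4 <= p%:R :> R by rewrite ler_nat.
have [y [yp30 py]] : exists y, (30 * y <= p)%N /\ (p < 30 * y.+1)%N.
  by exists (p %/ 30)%N; rewrite mulnC leq_trunc_div mulnC ltn_ceil.
have [w0 wy] : exists w0, (w0 + y = p)%N.
  by exists (p - y)%N; rewrite subnK //; move: yp30; clear; lia.
have yp : (4 * y <= p)%N by move: yp30; clear; lia.
have [c [c0 cB cV]] := cubic_siegel R wy py erefl.
set B := (2 ^ _)%N in cB.
pose N := (3 * p).+1.
have kE : sq = 1 + 2 * om := sqm3_omega R.
have oE : om * om = -1 - om := omega_sum R.
have oc : cn om = 1 := cn_omega R.
have uv v' : uu v' - vv v' = - sq * M1 v' by rewrite /uu /vv kE; ring.
have s1 v' : rel1 v' -> 0 < Xi v' -> cn (M1 v' * M2 v' * M3 v') = cn sD * mm ->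
    cn (uu v' - vv v') <= 4 * (cn sD * mm) / (Xi v' * Xi v').
  move=> rv' X' E'; rewrite uv cnM cnN.
  apply: le_trans (ler_pM (cn_ge0 _) (cn_ge0 _) (cn_sqm3_le2 R) (rel1_small rv' E' X')) _.
  by rewrite !mulrA -(natrM _ 2 2).
have ow : cn (- (1 + om)) = 1.
  have -> : - (1 + om) = om * om by rewrite oE; ring.
  by rewrite cnM oc mulr1.
have uK v' : cn (uu v') <= 2 * Xi v'.
  have [g1 g2 _] := Xi_ge v'.
  by apply: le_trans (cnB _ _) _; rewrite cnM ow mul1r; lra.
have vK v' : cn (vv v') <= 2 * Xi v'.
  have [g1 g2 _] := Xi_ge v'.
  by apply: le_trans (cnB _ _) _; rewrite cnM oc mul1r; lra.
have ln4 : ln 4 = 2 * k :> R.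
  by rewrite (_ : 4 = 2 * 2 :> R) ?lnMp //; [rewrite /k; ring | ring].
have lnd v' : 0 < Xi v' -> ln (4 * (cn sD * mm) / (Xi v' * Xi v')) =
    2 * k + L / 2 + ln mm - 2 * ln (Xi v').
  move=> X'; rewrite lnDiv ?mulr_gt0 // !lnMp ?mulr_gt0 // ln4 /L; lra.
have dpos v' : 0 < Xi v' -> 0 < 4 * (cn sD * mm) / (Xi v' * Xi v').
  by move=> X'; rewrite divr_gt0 ?mulr_gt0.
have lt12 v' : rel1 v' -> 0 < Xi v' -> cn (M1 v' * M2 v' * M3 v') = cn sD * mm ->
    A <= ln (Xi v') -> cn (M1 v') < cn (M2 v').
  move=> rv' X' E' hA'; have [h2 _] := Xi_half rv'.
  have r1 := rel1_small rv' E' X'.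
  have d1 : 4 * (cn sD * mm) / (Xi v' * Xi v') < Xi v'.
    by rewrite -ltr_ln ?posrE ?dpos // lnd //; rewrite /A in hA'; lra.
  have e : 4 * (cn sD * mm) / (Xi v' * Xi v') = 2 * (2 * (cn sD * mm) / (Xi v' * Xi v')).
    by rewrite !mulrA -(natrM _ 2 2).
  by rewrite e in d1; lra.
have nz v' : cn (M1 v') < cn (M2 v') -> uu v' != 0 /\ vv v' != 0.
  move=> h; split; apply/eqP => /eqP; rewrite subr_eq0 => /eqP /(congr1 (@cn R)).
    by rewrite cnM ow mul1r => e; rewrite e ltxx in h.
  by rewrite cnM oc mul1r => e; rewrite e ltxx in h.
have AA2 : A <= A2 by rewrite /A /A2 in A0 *; lra.
have [u10 v10] := nz v (lt12 v rv Xv Ev (lexx _)).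
have [u20 v20] := nz w (lt12 w rw Xw Ew AA2).
have c3 : uu v ^+ 3 != vv v ^+ 3.
  rewrite -subr_eq0.
  have -> : uu v ^+ 3 - vv v ^+ 3 = 3 * sq * (M1 v * M2 v * M3 v).
    rewrite (_ : _ - _ = (uu v - vv v) * ((uu v + vv v) ^+ 2 - uu v * vv v)); last by ring.
    by rewrite uvE Msum kE /uu /vv; ring.
  have sq0 : sq != 0 := sqm3_neq0 R.
  have M0 : M1 v * M2 v * M3 v != 0 by rewrite -cn_gt0 Ev mulr_gt0.
  by apply: mulf_neq0 M0; apply: mulf_neq0 sq0; rewrite pnatr_eq0.
have [l lJ Ln] := Lam_neq0 c0 cV wy yp (uu w) u10 v10 v20 c3.
have QP := Lam_integral c l de2 (cubes v) (prods v w).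
have de1 : 1 <= cn de.
  have d2 : 1 <= cn de * cn de.
    rewrite -cnM de2 cn_int ler1z.
    have : D != 0 by rewrite -(intr_eq0 C) -sD2 mulf_neq0.
    by clear; lia.
  have := cn_ge0 de; nra.
have p2n : (2 : C) ^+ p.+1 * Lam c l (uu v) (vv v) (uu w) (vv w) != 0.
  by rewrite mulf_neq0 // expf_neq0 // pnatr_eq0.
have := quadpair_ge de1 QP p2n.
have [t lt] : exists t, (l + t = (2 * w0).+1)%N.
  by exists ((2 * w0).+1 - l)%N; rewrite subnKC //; move: lJ wy yp30 p4n; clear; lia.
pose K := 2 * Xi v; pose K' := 2 * Xi w.
pose d := 4 * (cn sD * mm) / (Xi v * Xi v); pose d' := 4 * (cn sD * mm) / (Xi w * Xi w).
have K0 : 0 < K by rewrite mulr_gt0.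
have dK : d <= K.
  by rewrite -ler_ln ?posrE ?dpos // lnd // /K lnMp // -/k -/A; rewrite -/A in hA; lra.
have s1' v' : cn (vv v' - uu v') = cn (uu v' - vv v') by rewrite cn_dist.
have b1 : cn (Lam c l (uu v) (vv v) (uu w) (vv w)) <=
   K' * (B%:R * 2 ^+ (2 * N + 3) * (K ^+ (N - t) * d ^+ t)) + d' * (B%:R * 2 ^+ N.+1 * K ^+ N).
  apply: (Lam_le cB cV wy lt) => //; try exact: dpos; try exact: s1; try exact: uK; try exact: vK.
  by rewrite s1'; apply: s1.
have b2 : cn (Lam c l (vv v) (uu v) (vv w) (uu w)) <=
   K' * (B%:R * 2 ^+ (2 * N + 3) * (K ^+ (N - t) * d ^+ t)) + d' * (B%:R * 2 ^+ N.+1 * K ^+ N).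
  apply: (Lam_le cB cV wy lt) => //; try exact: dpos; try exact: s1; try exact: uK; try exact: vK.
  by rewrite s1'; apply: s1.
have q2 j : 0 < (2 : R) ^+ j by rewrite exprn_gt0.
have B0 : 0 < B%:R :> R by rewrite ltr0n /B expn_gt0.
have lnB : ln (B%:R : R) = 29 * (3 * p%:R + 2) * k.
  rewrite /B natrX lnX // natrM -[N.+1]addn2 -/k; congr (_ * _).
  by rewrite natrD natrM.
have NR : N%:R = 3 * p%:R + 1 :> R by rewrite /N -natr1 natrM.
have tN : (t <= N)%N by rewrite /N; move: lt wy; clear; lia.
have d0 : 0 < d by exact: dpos.
have d'0 : 0 < d' by exact: dpos.
have K'0 : 0 < K' by rewrite mulr_gt0.
have [na nb] : (p%:R + 2) * k + (2 * k + L / 2 + ln mm - 2 * A2) + 29 * (3 * p%:R + 2) * k + (3 * p%:R + 2) * k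
    + (3 * p%:R + 1) * (k + A) < 0 /\
  (p%:R + 2) * k + (k + A2) + 29 * (3 * p%:R + 2) * k + (2 * (3 * p%:R + 1) + 3) * k
    + (3 * p%:R + 1 - t%:R) * (k + A) + t%:R * (2 * k + L / 2 + ln mm - 2 * A) < 0.
  apply: (@cubic_numeric _ y%:R) => //.
  - by rewrite -natrM ler_nat.
  - by case: (y) => [|y']; [left | right; rewrite ler1n].
  - by rewrite -!natrM lerBlDr -natrD ler_nat; move: lt lJ wy; clear; lia.
  - by rewrite -natrM natr1 ler_nat; move: lt wy; clear; lia.
pose T1 := K' * (B%:R * 2 ^+ (2 * N + 3) * (K ^+ (N - t) * d ^+ t)).
pose T2 := d' * (B%:R * 2 ^+ N.+1 * K ^+ N).
rewrite -/T1 -/T2 in b1 b2.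
have h1 : 2 ^+ (p + 2) * T1 < 1.
  have g1 := mulr_gt0 B0 (q2 (2 * N + 3)%N).
  have g2 : 0 < K ^+ (N - t) * d ^+ t by rewrite mulr_gt0 // exprn_gt0.
  have g3 := mulr_gt0 g1 g2; have g4 := mulr_gt0 K'0 g3; have g5 := mulr_gt0 (q2 (p + 2)%N) g4.
  rewrite -ltr_ln ?posrE ?ltr01 // ln1 /T1 (lnMp (q2 _) g4) (lnMp K'0 g3) (lnMp g1 g2) (lnMp B0 (q2 _)).
  rewrite (lnMp (exprn_gt0 _ K0) (exprn_gt0 _ d0)) !lnX // lnB /K' /K (lnMp _ Xw) // (lnMp _ Xv) //.
  rewrite /d lnd // -/k -/A -/A2 natrB // !natrD natrM NR.
  by move: nb; lra.
have h2 : 2 ^+ (p + 2) * T2 < 1.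
  have g1 := mulr_gt0 B0 (q2 N.+1).
  have g3 := mulr_gt0 g1 (exprn_gt0 N K0); have g4 := mulr_gt0 d'0 g3.
  have g5 := mulr_gt0 (q2 (p + 2)%N) g4.
  rewrite -ltr_ln ?posrE ?ltr01 // ln1 /T2 (lnMp (q2 _) g4) (lnMp d'0 g3) (lnMp g1 (exprn_gt0 _ K0)).
  rewrite (lnMp B0 (q2 _)) !lnX // lnB /K (lnMp _ Xv) //.
  rewrite /d' lnd // -/k -/A -/A2 (natrD _ p 2) -[N.+1%:R]natr1 NR.
  by move: na; lra.
rewrite !cnM cnX cn_nat -mulrDr.
have e2 : (2 : R) ^+ (p + 2) = 2 * 2 ^+ p.+1 by rewrite addn2 exprS.
rewrite !e2 in h1 h2.
have s : cn (Lam c l (uu v) (vv v) (uu w) (vv w)) + cn (Lam c l (vv v) (uu v) (vv w) (uu w))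
   <= 2 * (T1 + T2) by lra.
have := ler_wpM2l (ltW (q2 p.+1)) s.
by lra.
Qed.

End CubicPair.

Section CubicCovariants.
Variable K : comNzRingType.
Implicit Types A B E F x y : K.

(** Over a general ring, so that the same formulas serve over the integers and over [C]. The sign
    matches that of [sDc]. Up to constants, [cubT] polarizes the Hessian covariant and [cubG] is the
    Jacobian of form and Hessian. *)
Definition cubF A B E F x y : K :=
  - (A * x ^+ 3 + B * x ^+ 2 * y + E * x * y ^+ 2 + F * y ^+ 3).
Definition cubT A B E F x y x' y' : K :=
  2 * (B ^+ 2 - 3 * A * E) * (x * x') + (B * E - 9 * A * F) * (x * y' + x' * y)
  + 2 * (E ^+ 2 - 3 * B * F) * (y * y').
Definition cubG A B E F x y : K :=
  (3 * A * x ^+ 2 + 2 * B * x * y + E * y ^+ 2)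
    * ((B * E - 9 * A * F) * x + 2 * (E ^+ 2 - 3 * B * F) * y)
  - (B * x ^+ 2 + 2 * E * x * y + 3 * F * y ^+ 2)
    * (2 * (B ^+ 2 - 3 * A * E) * x + (B * E - 9 * A * F) * y).
Definition cubD A B E F : K := B ^+ 2 * E ^+ 2 - 4 * A * E ^+ 3 - 4 * B ^+ 3 * F
  + 18 * A * B * E * F - 27 * A ^+ 2 * F ^+ 2.

End CubicCovariants.

(** * Counting the solutions of cubic forms *)

Section CubicCount.
Variable R : realType.
Local Notation C := R[i].

Definition o0 : 'I_3 := @Ordinal 3 0 isT.
Definition o1 : 'I_3 := @Ordinal 3 1 isT.
Definition o2 : 'I_3 := @Ordinal 3 2 isT.
Definition nxt (i : 'I_3) : 'I_3 := match val i with 0 => o1 | 1 => o2 | _ => o0 end.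

Lemma ord3 (P : 'I_3 -> Prop) : P o0 -> P o1 -> P o2 -> forall i, P i.
Proof.
move=> h0 h1 h2 [[|[|[|//]]] hi]; [rewrite (_ : Ordinal hi = o0) | rewrite (_ : Ordinal hi = o1)
  | rewrite (_ : Ordinal hi = o2)] => //; exact: val_inj.
Qed.

Lemma ord3_neq (i j : 'I_3) : i != j -> i = nxt j \/ i = nxt (nxt j).
Proof.
by move: i j; apply: ord3; apply: ord3 => // _; try (by left); right.
Qed.

Lemma sum_ord3 (f : 'I_3 -> R) : \sum_i f i = f o0 + f o1 + f o2.
Proof.
rewrite !big_ord_recl big_ord0 addr0 addrA.
by congr (f _ + f _ + f _); apply: val_inj.
Qed.

Lemma prod_ord3 (f : 'I_3 -> R) : \prod_i f i = f o0 * f o1 * f o2.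
Proof.
rewrite !big_ord_recl big_ord0 mulr1 mulrA.
by congr (f _ * f _ * f _); apply: val_inj.
Qed.

Lemma pair_ln (x y X sd mm : R) : 0 < x -> x <= y -> y <= x + x -> 0 < X -> X <= y ->
  0 < sd -> 0 < mm -> x * x * y = sd * mm ->
  3 * ln X <= 2 * ln 2 + ln sd + ln mm.
Proof.
move=> x0 xy yx X0 Xy sd0 m0 P.
have y0 : 0 < y by lra.
have h : X ^+ 3 <= 2 * 2 * (sd * mm).
  rewrite -P; apply: le_trans (_ : y ^+ 3 <= _).
    by apply: lerXn2r => //; rewrite nnegrE; apply: ltW.
  have : y * y <= (x + x) * (x + x) by apply: ler_pM => //; apply: ltW.
  by move=> /(ler_wpM2r (ltW y0)); rewrite !exprS expr0; lra.
have := le_ln (exprn_gt0 _ X0) h; rewrite lnX // !lnMp ?mulr_gt0 //.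
by lra.
Qed.

(** Since [X <= Y], both products in the cross identity obey the bound of the first one; this is the
    gap with exponent [n - 1 = 2]. *)
Lemma gap_real (z1 z2 z3 z4 sD : C) (k : int) (mm X Y : R) :
  z1 * z2 - z3 * z4 = sD * k%:~R -> k != 0 -> 0 < cn sD -> 0 < mm -> 0 < X -> X <= Y ->
  cn z1 <= 2 * (cn sD * mm) / (X * X) -> cn z4 <= 2 * (cn sD * mm) / (Y * Y) ->
  cn z3 <= X -> cn z2 <= Y -> X * X <= 4 * (mm * Y).
Proof.
move=> E k0 sd0 m0 X0 XY h1 h4 h3 h2; have Y0 : 0 < Y by lra.
have k1 : 1 <= `|k|%:~R :> R by rewrite ler1z; move: k0; lia.
have : cn sD <= cn z1 * cn z2 + cn z3 * cn z4.
  apply: le_trans (_ : cn sD * `|k|%:~R <= _); first by rewrite ler_peMr ?cn_ge0.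
  by rewrite -cn_int -cnM -E (le_trans (cnB _ _)) // !cnM.
have g1 : cn z1 * cn z2 <= 2 * (cn sD * mm) / (X * X) * Y by apply: ler_pM; rewrite ?cn_ge0.
have g2 : cn z3 * cn z4 <= X * (2 * (cn sD * mm) / (Y * Y)) by apply: ler_pM; rewrite ?cn_ge0.
have g3 : X * (2 * (cn sD * mm) / (Y * Y)) <= 2 * (cn sD * mm) / (X * X) * Y.
  rewrite mulrC; apply: ler_pM => //; try exact: ltW.
    by rewrite divr_ge0 ?mulr_ge0 ?ltW // mulr_gt0.
  rewrite ler_pM2l ?mulr_gt0 // lef_pV2 ?posrE ?mulr_gt0 //.
  by apply: ler_pM => //; apply: ltW.
move=> g0; have g : cn sD <= 2 * (2 * (cn sD * mm) / (X * X) * Y) by lra.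
have XX : 0 < X * X by rewrite mulr_gt0.
have : cn sD * (X * X) <= cn sD * (4 * (mm * Y)).
  have := ler_wpM2r (ltW XX) g.
  rewrite (_ : 2 * (2 * (cn sD * mm) / (X * X) * Y) * (X * X) = cn sD * (4 * (mm * Y))) //.
  by field; rewrite gt_eqF.
by rewrite ler_pM2l.
Qed.

Lemma exp2_ge j : (3 <= j)%N -> (8 * j <= 3 * 2 ^ j)%N /\ (8 <= 2 ^ j)%N.
Proof.
elim: j => // j IH; rewrite leq_eqVlt => /orP[/eqP <- //|].
by rewrite ltnS => /IH [g1 g2]; rewrite expnS; lia.
Qed.

Lemma ln_ge1B (x : R) : 1 < x -> 1 - 1 / x <= ln x.
Proof.
move=> x1; have x0 : 0 < x by lra.
have xi : 0 < 1 / x by rewrite divr_gt0.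
have : ln (1 + (1 / x - 1)) <= 1 / x - 1 by apply: le_ln1Dx; lra.
rewrite (_ : 1 + (1 / x - 1) = 1 / x); last by ring.
by rewrite lnDiv // ln1; lra.
Qed.

Lemma ln2_ge : 533 / 840 <= ln 2 :> R.
Proof.
have e2 : 2 = (1 + 1 / 4) * ((1 + 1 / 5) * ((1 + 1 / 6) * (1 + 1 / 7))) :> R by lra.
have E2 : ln 2 = ln (1 + 1 / 4) + (ln (1 + 1 / 5) + (ln (1 + 1 / 6) + ln (1 + 1 / 7))) :> R.
  by rewrite {1}e2 !lnMp //; lra.
have q4 : 1 / 5 <= ln (1 + 1 / 4) :> R.
  have : 1 < 1 + 1 / 4 :> R by lra.
  by move=> /ln_ge1B; rewrite (_ : 1 - 1 / (1 + 1 / 4) = 1 / 5) //; field.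
have q5 : 1 / 6 <= ln (1 + 1 / 5) :> R.
  have : 1 < 1 + 1 / 5 :> R by lra.
  by move=> /ln_ge1B; rewrite (_ : 1 - 1 / (1 + 1 / 5) = 1 / 6) //; field.
have q6 : 1 / 7 <= ln (1 + 1 / 6) :> R.
  have : 1 < 1 + 1 / 6 :> R by lra.
  by move=> /ln_ge1B; rewrite (_ : 1 - 1 / (1 + 1 / 6) = 1 / 7) //; field.
have q7 : 1 / 8 <= ln (1 + 1 / 7) :> R.
  have : 1 < 1 + 1 / 7 :> R by lra.
  by move=> /ln_ge1B; rewrite (_ : 1 - 1 / (1 + 1 / 7) = 1 / 8) //; field.
by rewrite E2; lra.
Qed.

(** Converts the constants in the hypothesis on [m] to powers of [2]; with [ln2_ge] it yields the
    [49 / 5] and [7 / 8] of [count3]. *)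
Lemma ln_const_ge : 15 * ln 2 + 1 / 3 <= 6 * ln (7 / 2) + 3 * ln 3 :> R.
Proof.
have hh : 1 - 1 / (3 / 2) <= ln (3 / 2) :> R by apply: ln_ge1B; lra.
apply: le_trans (_ : 15 * ln 2 + ln (3 / 2) <= _); first by rewrite lerD2l; lra.
have p2 : 0 < (2 : R) ^+ 15 by rewrite exprn_gt0.
have p3 : 0 < (3 : R) ^+ 3 by rewrite exprn_gt0.
have p7 : 0 < (7 / 2 : R) ^+ 6 by rewrite exprn_gt0 //; lra.
have h7 : 0 < 7 / 2 :> R by lra.
have h3 : 0 < 3 / 2 :> R by lra.
rewrite -(lnX 15 (_ : 0 < 2)) // -(lnX 6 h7) -(lnX 3 (_ : 0 < 3)) // -!lnMp //.
apply: le_ln; first exact: mulr_gt0.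
rewrite (_ : (2 : R) ^+ 15 = (2 ^+ 5) * ((2 ^+ 5) * (2 ^+ 5))); last by rewrite -!exprD.
have -> : (2 : R) ^+ 5 = 32 by rewrite !exprS expr0; lra.
by rewrite !exprS expr0; lra.
Qed.

Variables (a b : 'I_3 -> C) (c : 'I_3 -> 'I_3) (A B E F : int).
Hypothesis fd : form_data a b c.
Hypothesis hA : A%:~R = a o0 * a o1 * a o2.
Hypothesis hB : B%:~R = - (b o0 * a o1 * a o2 + a o0 * b o1 * a o2 + a o0 * a o1 * b o2).
Hypothesis hE : E%:~R = b o0 * b o1 * a o2 + b o0 * a o1 * b o2 + a o0 * b o1 * b o2.
Hypothesis hF : F%:~R = - (b o0 * b o1 * b o2).

Definition cM i v : C := dt a b (nxt i) (nxt (nxt i)) * lf a b v i.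
Definition sDc : C := - (dt a b o0 o1 * dt a b o1 o2 * dt a b o2 o0).

Definition cF (v : int * int) : int := cubF A B E F v.1 v.2.
Definition cT (v w : int * int) : int := cubT A B E F v.1 v.2 w.1 w.2.
Definition cG (v : int * int) : int := cubG A B E F v.1 v.2.
Definition cD : int := cubD A B E F.

Lemma cM_sum i v : cM (nxt (nxt i)) v = - cM i v - cM (nxt i) v.
Proof. by move: i; apply: ord3; rewrite /cM /dt /lf /=; ring. Qed.

Lemma cM_cross i v w : cM i v * cM (nxt i) w - cM (nxt i) v * cM i w = sDc * (cross v w)%:~R.
Proof.
rewrite /cross rmorphB !rmorphM /=.
by move: i; apply: ord3; rewrite /sDc /cM /dt /lf /=; ring.
Qed.

Lemma cM_prod i v : cM i v * cM (nxt i) v * cM (nxt (nxt i)) v = sDc * (cF v)%:~R.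
Proof.
have -> : (cF v)%:~R = cubF A%:~R B%:~R E%:~R F%:~R v.1%:~R v.2%:~R :> C.
  by rewrite /cF /cubF; ring.
rewrite hA hB hE hF /cubF.
by move: i; apply: ord3; rewrite /sDc /cM /dt /lf /=; ring.
Qed.

Lemma cM_T i v w : cM i v * cM i w + cM (nxt i) v * cM (nxt i) w
  + cM (nxt (nxt i)) v * cM (nxt (nxt i)) w = (cT v w)%:~R.
Proof.
have -> : (cT v w)%:~R = cubT A%:~R B%:~R E%:~R F%:~R v.1%:~R v.2%:~R w.1%:~R w.2%:~R :> C.
  by rewrite /cT /cubT; ring.
rewrite hA hB hE hF /cubT.
by move: i; apply: ord3; rewrite /cM /dt /lf /=; ring.
Qed.

Lemma cM_G i v : (cM (nxt i) v - cM (nxt (nxt i)) v) * (cM (nxt (nxt i)) v - cM i v)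
  * (cM i v - cM (nxt i) v) = (cG v)%:~R.
Proof.
have -> : (cG v)%:~R = cubG A%:~R B%:~R E%:~R F%:~R v.1%:~R v.2%:~R :> C.
  by rewrite /cG /cubG; ring.
rewrite hA hB hE hF /cubG.
by move: i; apply: ord3; rewrite /cM /dt /lf /=; ring.
Qed.

Lemma sDc_sqr : sDc * sDc = cD%:~R.
Proof.
have -> : cD%:~R = cubD A%:~R B%:~R E%:~R F%:~R :> C.
  by rewrite /cD /cubD; ring.
rewrite hA hB hE hF /cubD.
by rewrite /sDc /dt; ring.
Qed.

Lemma sDc_neq0 : sDc != 0.
Proof. by rewrite oppr_eq0 !mulf_neq0 // (fd_d0 fd). Qed.

Lemma lnD3 : lnD a b = 2 * ln (cn sDc).
Proof.
have d i j : i != j -> 0 < cn (dt a b i j) by move=> ij; rewrite cn_gt0 (fd_d0 fd).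
rewrite /lnD sum_offdiag_sym; last by move=> i j; rewrite dt_anti cnN.
congr (2 * _); rewrite /sDc cnN !cnM !lnMp ?mulr_gt0 ?d // sum_ord3.
rewrite [X in X + _ + _]big_mkcond [X in _ + X + _]big_mkcond [X in _ + _ + X]big_mkcond.
rewrite !sum_ord3 /= (dt_anti a b o2 o0) cnN.
ring.
Qed.

Definition cXi v : R := Num.max (cn (cM o0 v)) (Num.max (cn (cM o1 v)) (cn (cM o2 v))).

Lemma XiE i v : Xi (cM i) (cM (nxt i)) (cM (nxt (nxt i))) v = cXi v.
Proof.
move: i; apply: ord3; rewrite /Xi /cXi //=; first by rewrite maxA [RHS]maxC.
by rewrite maxC -maxA.
Qed.

Lemma cM_le i v : cn (cM i v) <= cXi v.
Proof. by move: i; apply: ord3; rewrite /cXi !le_max lexx ?orbT. Qed.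

Lemma cross_le_Xi v w : cross v w != 0 -> cn sDc <= 2 * (cXi v * cXi w).
Proof.
move=> vw; have h := cM_cross o0 v w.
have : 1 <= `|cross v w|%:~R :> R by rewrite ler1z; move: vw; lia.
move=> c1; apply: le_trans (_ : cn sDc * `|cross v w|%:~R <= _).
  by rewrite ler_peMr ?cn_ge0.
rewrite -cn_int -cnM -h; apply: le_trans (cnB _ _) _.
rewrite (cnM (cM o0 v)) (cnM (cM (nxt o0) v)).
have h1 : cn (cM o0 v) * cn (cM (nxt o0) w) <= cXi v * cXi w.
  by apply: ler_pM; rewrite ?cn_ge0 ?cM_le.
have h2 : cn (cM (nxt o0) v) * cn (cM o0 w) <= cXi v * cXi w.
  by apply: ler_pM; rewrite ?cn_ge0 ?cM_le.
by lra.
Qed.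

(** Up to a constant, [cM i] is [x - alpha_i y] times the difference of the other two roots;
    conjugation permutes the roots, and the modulus ignores the sign of the difference. *)
Lemma cM_conj i v : cn (cM (c i) v) = cn (cM i v).
Proof.
pose al i := b i / a i; pose A0 := a o0 * a o1 * a o2.
have a0 := fd_a0 fd; have cJ := fd_J fd; have cc := fd_cc fd.
have e i' : cM i' v = A0 * ((al (nxt (nxt i')) - al (nxt i')) * (v.1%:~R - al i' * v.2%:~R)).
  by move: i'; apply: ord3; rewrite /cM /dt /lf /al /A0 /=; field; rewrite !a0.
have J i' : cn (v.1%:~R - al (c i') * v.2%:~R) = cn (v.1%:~R - al i' * v.2%:~R).
  rewrite /al cJ -[RHS]cn_conj; congr cn; move: (b i' / a i') => t.
  by rewrite rmorphB rmorphM /= !rmorph_int.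
have D i' j' : cn (al (c i') - al (c j')) = cn (al i' - al j').
  by rewrite /al !cJ -[RHS]cn_conj rmorphB.
rewrite !e !cnM J; congr (_ * (_ * _)).
have cinj : injective c := inv_inj cc.
have S (i' j' k' : 'I_3) : i' != j' -> i' != k' -> j' != k' ->
    cn (al (nxt (nxt i')) - al (nxt i')) = cn (al k' - al j').
  move: i' j' k'; apply: ord3; apply: ord3; apply: ord3 => //= _ _ _; exact: cn_dist.
have n1 i' : i' != nxt i' by move: i'; apply: ord3.
have n2 i' : i' != nxt (nxt i') by move: i'; apply: ord3.
have n3 i' : nxt i' != nxt (nxt i') by move: i'; apply: ord3.
by rewrite (S (c i) (c (nxt i)) (c (nxt (nxt i)))) ?(inj_eq cinj) ?n1 ?n2 ?n3 // D.
Qed.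

(** Small and large solutions are not separated: doubling at each gap, a number of steps that
    depends on [e] reaches the size required by [cubic_thue_pair], which gives [8 + 2 / e] per real
    root. *)
Lemma count3 (mm e : R) (S : seq (int * int)) :
  let L := 2 * ln (cn sDc) in
  1 <= mm -> 0 < e -> e < 1 ->
  ln mm <= (1 - e) * (L / 4) - 3 / 2 * ln (7 / 2) - 3 / 4 * ln 3 ->
  uniq S -> (forall v w, v \in S -> w \in S -> v != w -> cross v w != 0) ->
  (forall v, v \in S -> sol a b mm v) ->
  (size S)%:R <= (9 * nreal c + 2 * npair c)%:R + 2 * (nreal c + npair c)%:R / e.
Proof.
move=> L m1 e0 e1 hm uS cr hS.
have m0 : 0 < mm by apply: lt_le_trans m1.
have lm0 : 0 <= ln mm by apply: ln_ge0.
have sd0 : 0 < cn sDc by rewrite cn_gt0 sDc_neq0.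
have cc := fd_cc fd.
pose k : R := ln 2.
have k0 : 0 < k by rewrite ln_gt0 // ltr1n.
have k1 : 533 / 840 <= k := ln2_ge.
have big : 15 * k + 1 / 3 <= 6 * ln (7 / 2) + 3 * ln 3 := ln_const_ge.
have eL : 0 < e * L -> 49 / 5 <= L.
  move=> h; have : 0 <= (1 - e) * (L / 4) - 3 / 2 * ln (7 / 2) - 3 / 4 * ln 3 by lra.
  by lra.
have L0 : 0 < L.
  have : 0 < (1 - e) * L by lra.
  by rewrite pmulr_rgt0 // subr_gt0.
have L1 : 49 / 5 <= L by apply: eL; rewrite mulr_gt0.
have eL0 : 0 < e * L by rewrite mulr_gt0.
have Mp i v : v \in S -> cn (cM i v * cM (nxt i) v * cM (nxt (nxt i)) v) = cn sDc * mm.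
  move=> /hS [_ <-]; rewrite prod_ord3 -!(@cnM R) -[LHS]cnN; congr cn.
  by move: i; apply: ord3; rewrite /cM /sDc /=; ring.
have Mn v i : v \in S -> 0 < cn (cM i v).
  move=> vS; rewrite cn_gt0 mulf_neq0 //; last exact: (sol_L0 m0 i (hS v vS)).
  by apply: (fd_d0 fd); move: i; apply: ord3.
(* Two solutions violating this would contradict [cross_le_Xi], so there is at most one; for the
   others [pair_ln] excludes a nonreal closest root. *)
pose ok v := cn sDc <= 2 * (cXi v * cXi v).
have X0 v : v \in S -> 0 < cXi v.
  by move=> vS; apply: lt_le_trans (Mn v o0 vS) (cM_le _ _).
have exc : (count (predC ok) S <= 1)%N.
  rewrite -size_filter; set S' := filter _ S; have uS' : uniq S' by rewrite filter_uniq.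
  case E' : S' => [|v [|w s]] //; exfalso.
  have : v \in S' by rewrite E' mem_head.
  have : w \in S' by rewrite E' !inE eqxx orbT.
  have vw : v != w by move: uS'; rewrite E' /= inE negb_or => /andP[/andP[]].
  rewrite !mem_filter /= /ok -!ltNge => /andP[hw wS] /andP[hv vS].
  have h := cross_le_Xi (cr v w vS wS vw).
  have Xv := X0 v vS; have Xw := X0 w wS.
  case: (lerP (cXi v) (cXi w)) => vw'.
    by have := ler_wpM2r (ltW Xw) vw'; lra.
  by have := ler_wpM2l (ltW Xv) (ltW vw'); lra.
pose idx v := [arg min_(i < o0) (cn (cM i v))]%O.
have idxP v j : cn (cM (idx v) v) <= cn (cM j v).
  by rewrite /idx; case: arg_minP => // i _ h; apply: h.
have rl v : rel1 (cM (idx v)) (cM (nxt (idx v))) (cM (nxt (nxt (idx v)))) v by split; apply: idxP.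
pose lX v := ln (cXi v).
have lXge v : v \in S -> ok v -> L / 4 - k / 2 <= lX v.
  move=> vS; have Xv := X0 v vS; rewrite /ok => h.
  have := le_ln sd0 h; rewrite !lnMp ?mulr_gt0 // -/k -/(lX v) /L; lra.
have real v : v \in S -> ok v -> c (idx v) == idx v.
  move=> vS okv; apply/negPn/negP => ci; have Xv := X0 v vS.
  have P := Mp (idx v) v vS; rewrite (cnM (_ * _)) (cnM (cM _ _)) in P.
  have [t1 t2 t3] := M_tri (cM_sum (idx v)) v.
  have ce := cM_conj (idx v) v.
  have XE := XiE (idx v) v; rewrite /Xi in XE.
  have i1 := idxP v (nxt (idx v)); have i2 := idxP v (nxt (nxt (idx v))).
  have x0 : 0 < cn (cM (idx v) v) := Mn v (idx v) vS.
  have [cE|cE] : c (idx v) = nxt (idx v) \/ c (idx v) = nxt (nxt (idx v)).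
    exact: ord3_neq.
  - rewrite cE in ce; rewrite ce in P t1 t2 t3 i1 i2 XE.
    have X3 : cXi v <= cn (cM (nxt (nxt (idx v))) v) by rewrite -XE !ge_max lexx i2.
    have h := pair_ln x0 i2 t3 Xv X3 sd0 m0 P.
    have h' := lXge v vS okv; rewrite -/k in h; rewrite /lX in h'.
    have LE : L = 2 * ln (cn sDc) by [].
    by lra.
  - rewrite cE in ce; rewrite ce in P t1 t2 t3 i1 i2 XE.
    have X3 : cXi v <= cn (cM (nxt (idx v)) v) by rewrite -XE !ge_max lexx i1.
    have P' : cn (cM (idx v) v) * cn (cM (idx v) v) * cn (cM (nxt (idx v)) v) = cn sDc * mm.
      by rewrite -P mulrAC.
    have h := pair_ln x0 i1 t2 Xv X3 sd0 m0 P'.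
    have h' := lXge v vS okv; rewrite -/k in h; rewrite /lX in h'.
    have LE : L = 2 * ln (cn sDc) by [].
    by lra.
(* [c0 = ln (4 mm)]: after this shift the gap of [gap_real] is exactly a doubling. *)
pose c0 := 2 * k + ln mm.
pose tau v := lX v - c0.
pose z0 := 7 / 8 + e * L / 4.
pose T i := [seq v <- S | ok v && (idx v == i)].
have subT i v : v \in T i -> [/\ v \in S, ok v & idx v = i].
  by rewrite mem_filter => /andP[/andP[-> /eqP ->] ->].
have uT i : uniq (T i) by rewrite filter_uniq.
have tz v : v \in S -> ok v -> z0 <= tau v.
  by move=> vS okv; have := lXge v vS okv; rewrite /z0 /tau /c0; lra.
have gap i v w : v \in T i -> w \in T i -> v != w -> tau v <= tau w -> 2 * tau v <= tau w.
  move=> /subT [vS okv iv] /subT [wS okw iw] vw tvw.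
  have Xv := X0 v vS; have Xw := X0 w wS.
  have Xvw : cXi v <= cXi w.
    by rewrite -ler_ln ?posrE //; move: tvw; rewrite /tau /lX; lra.
  have rv := rl v; have rw := rl w; rewrite iv in rv; rewrite iw in rw.
  have XvE := XiE i v; have XwE := XiE i w.
  have sv := rel1_small (cM_sum i) rv (Mp i v vS); rewrite XvE in sv.
  have sw := rel1_small (cM_sum i) rw (Mp i w wS); rewrite XwE in sw.
  have h := gap_real (cM_cross i v w) (cr v w vS wS vw) sd0 m0 Xv Xvw (sv Xv) (sw Xw)
    (cM_le _ v) (cM_le _ w).
  have := le_ln (mulr_gt0 Xv Xv) h; rewrite !lnMp ?mulr_gt0 //.
  rewrite (_ : ln 4 = 2 * k); last first.
    by rewrite (_ : 4 = 2 * 2 :> R) ?lnMp //; [rewrite /k; ring | ring].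
  by rewrite /tau /c0 /lX; lra.
have Tle i : (size (T i))%:R <= 8 + 2 / e.
  rewrite leNgt; apply/negP => hs.
  have e2 : 2 < 2 / e by rewrite ltr_pdivlMr //; lra.
  have s11 : (11 <= size (T i))%N by rewrite -(ltr_nat R); lra.
  have [j sj] : exists j, (size (T i) = j + 8)%N.
    by exists (size (T i) - 8)%N; rewrite subnK // (leq_trans _ s11).
  have j3 : (3 <= j)%N by rewrite sj in s11; rewrite -(leq_add2r 8).
  have jR : 2 / e < j%:R by move: hs; rewrite sj natrD; lra.
  have je : 2 < j%:R * e by rewrite -ltr_pdivrMr.
  have hz v : v \in T i -> z0 <= tau v by move=> /subT [vS okv _]; apply: tz.
  have j8 : (j + 4 + 3 < size (T i))%N by rewrite sj -addnA ltn_add2l.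
  have [v [w [vT wT h1 h2]]] := growth_pair (uT i) (ler0n R 2) hz (@gap i) j8.
  have [g1 g2] := exp2_ge j3.
  have g1R : 8 * j%:R <= 3 * 2 ^+ j :> R by rewrite -natrX -!natrM ler_nat.
  have g2R : 8 <= 2 ^+ j :> R by rewrite -natrX ler_nat.
  (* [j e > 2] and [2 ^ j >= 8 j / 3] give [64 / 3 * L] from the part in [e L], and [2 ^ j >= 8]
     gives [112]; the missing [13] comes from [L >= 49 / 5]. *)
  have big1 : 20 * L + 125 <= 2 ^+ (j + 4) * z0.
    have -> : (2 : R) ^+ (j + 4) = 2 ^+ j * 16.
      by rewrite exprD; congr (_ * _); rewrite !exprS expr0; lra.
    have q1 : j%:R * e * L <= 3 / 8 * 2 ^+ j * e * L.
      apply: ler_wpM2r; first exact: ltW.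
      by apply: ler_wpM2r; [exact: ltW | lra].
    have q2 : 2 * L <= j%:R * e * L by apply: ler_wpM2r; exact: ltW.
    by rewrite /z0; lra.
  have [vS okv iv] := subT i v vT; have [wS okw iw] := subT i w wT.
  have Xv := X0 v vS; have Xw := X0 w wS.
  have rv := rl v; have rw := rl w; rewrite iv in rv; rewrite iw in rw.
  have c00 : 0 <= c0 by rewrite /c0; lra.
  have c01 : c0 <= L / 4 by rewrite /c0; lra.
  have h8 : 8 * tau v <= tau w.
    by move: h2; rewrite (_ : 2 ^+ 3 = 8 :> R) //; rewrite !exprS expr0; lra.
  apply: (@cubic_thue_pair _ _ _ _ _ _ _ _ _ (cM_sum i) (cM_cross i) (cM_prod i) (cM_T i)
    (cM_G i) sDc_sqr sDc_neq0 v w mm rv rw m0); rewrite ?XiE //.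
  - exact: Mp.
  - exact: Mp.
  - by move: h1; rewrite /tau -/(lX v) -/L; lra.
  - by rewrite -/L; lra.
  - by move: h1 h8; rewrite /tau -/(lX v) -/(lX w); lra.
have szS : (size S <= 1 + \sum_(i | c i == i) size (T i))%N.
  rewrite -(count_predC ok S) addnC leq_add //.
  rewrite -size_filter (size_sum_count idx) [leqRHS]big_mkcond /=; apply: leq_sum => i _.
  case: ifP => [_|/negbT ci].
    rewrite -size_filter -filter_predI /T; apply: eq_leq; congr size.
    by apply: eq_filter => v /=; rewrite andbC.
  rewrite leqn0; apply/eqP; rewrite -size_filter -filter_predI.
  apply/eqP; rewrite size_filter -leqn0 leqNgt -has_count; apply/hasP => -[v vS /= /andP[/eqP iv okv]].
  by move: ci; rewrite -iv real.
have nE := card_c cc.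
apply: le_trans (_ : (1 + \sum_(i | c i == i) size (T i))%:R <= _); first by rewrite ler_nat.
rewrite natrD natr_sum.
apply: le_trans (_ : 1 + \sum_(i | c i == i) (8 + 2 / e) <= _).
  by rewrite lerD2l; apply: ler_sum => i _; apply: Tle.
rewrite sumr_const -/(nreal c) -mulr_natl.
(* The degree is odd, so there is a real root; replacing [8] by [9] for it absorbs the exceptional
   solution. *)
have r1 : (0 < nreal c)%N.
  rewrite lt0n; apply/eqP => r0; move: nE; rewrite r0 add0n => /(congr1 odd).
  by rewrite oddM.
have r1R : 1 <= (nreal c)%:R :> R by rewrite ler1n.
have q0 : 0 <= (npair c)%:R :> R by rewrite ler0n.
have qe : 0 <= (npair c)%:R * (2 / e) by rewrite mulr_ge0 // divr_ge0 // ltW.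
rewrite (natrD _ (9 * nreal c)) (natrD _ (nreal c)) (natrM _ 9) (natrM _ 2).
rewrite (_ : 2 * _ / e = ((nreal c)%:R + (npair c)%:R) * (2 / e)); last by ring.
by lra.
Qed.

End CubicCount.

(** * Integrality of the resultant and irreducibility *)

Section Resultant.
Variable C : numFieldType.
Local Notation PC p := (map_poly (intr : int -> C) p).

(** The integer is the determinant of the Sylvester matrix [S]. Multiplied by [V], the Vandermonde
    matrix of the roots completed by an identity block, it becomes block triangular: the rows of [P]
    turn into values at the roots, those of [f] vanish there. *)
Lemma resultant_integral n d (f P : {poly int}) (alpha : 'I_n -> C) :
  (size f <= n.+1)%N -> (size P <= d.+1)%N -> injective alpha ->
  (forall l, (PC f).[alpha l] = 0) ->
  exists z : int, z%:~R = (f`_n)%:~R ^+ d * \prod_l (PC P).[alpha l].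
Proof.
move=> sf sP inj ra.
pose SA : 'M[int]_n := \matrix_(j, k) ('X^j * P)`_k.
pose SB : 'M[int]_(n, d) := \matrix_(j, i) ('X^j * P)`_(n + i).
pose SC : 'M[int]_(d, n) := \matrix_(i, k) ('X^i * f)`_k.
pose SD : 'M[int]_d := \matrix_(i, i') ('X^i * f)`_(n + i').
pose S : 'M[int]_(n + d) := block_mx SA SB SC SD.
pose al : 'rV[C]_n := \row_l alpha l.
pose Vd : 'M[C]_(d, n) := \matrix_(i, l) alpha l ^+ (n + i).
pose V : 'M[C]_(n + d) := block_mx (Vandermonde n al) 0 Vd 1%:M.
pose UL : 'M[C]_n := \matrix_(j, l) (alpha l ^+ j * (PC P).[alpha l]).
pose DR : 'M[C]_d := map_mx (intr : int -> C) SD.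
have ev (g : {poly int}) (x : C) : (size g <= n + d)%N ->
    (PC g).[x] = \sum_(k < n) (g`_k)%:~R * x ^+ k + \sum_(i < d) (g`_(n + i)%N)%:~R * x ^+ (n + i).
  move=> sg; rewrite (horner_coef_wide _ (_ : (size (PC g) <= n + d)%N)); last first.
    by rewrite (leq_trans (size_poly _ _)).
  rewrite big_split_ord /=; congr (_ + _); apply: eq_bigr => k _; by rewrite coef_map.
have szX (g : {poly int}) k e : (size g <= e.+1)%N -> (size ('X^k * g)%R <= k + e.+1)%N.
  move=> h; rewrite (leq_trans (size_polyMleq _ _)) // size_polyXn addSn /=.
  by rewrite leq_add2l.
have SV : map_mx (intr : int -> C) S *m V = block_mx UL (map_mx (intr : int -> C) SB) 0 DR.
  rewrite map_block_mx mulmx_block !mulmx0 !mulmx1 !add0r; congr block_mx.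
    apply/matrixP => j l; rewrite !mxE.
    have sj : (size ('X^j * P)%R <= n + d)%N.
      by rewrite (leq_trans (szX P j d sP)) // addnS -addSn leq_add2r.
    rewrite -[RHS](_ : (PC ('X^j * P)).[alpha l] = _); last first.
      by rewrite rmorphM /= map_polyXn hornerM hornerXn.
    by rewrite (ev _ _ sj); congr (_ + _); apply: eq_bigr => k _; rewrite !mxE.
  apply/matrixP => i l; rewrite !mxE.
  have si : (size ('X^i * f)%R <= n + d)%N.
    by rewrite (leq_trans (szX f i n sf)) // addnC addSn -addnS leq_add2l.
  rewrite -[RHS](_ : (PC ('X^i * f)).[alpha l] = _); last first.
    by rewrite rmorphM /= map_polyXn hornerM ra mulr0.
  by rewrite (ev _ _ si); congr (_ + _); apply: eq_bigr => k _; rewrite !mxE.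
have dV : \det V = \det (Vandermonde n al) by rewrite det_lblock det1 mulr1.
have dUL : \det UL = \det (Vandermonde n al) * \prod_l (PC P).[alpha l].
  rewrite (_ : UL = Vandermonde n al *m diag_mx (\row_l (PC P).[alpha l])).
    rewrite det_mulmx det_diag; congr (_ * _); by apply: eq_bigr => l _; rewrite mxE.
  by apply/matrixP => j l; rewrite mul_mx_diag !mxE.
have dDR : \det DR = (f`_n)%:~R ^+ d.
  rewrite det_trig; last first.
    apply/is_trig_mxP => i i' ii'; rewrite !mxE coefXnM; case: ifP => // _.
    rewrite nth_default // (leq_trans sf) // -addnBA; last exact: ltnW.
    by rewrite -[leqLHS]addn1 leq_add2l subn_gt0.
  rewrite (eq_bigr (fun=> (f`_n)%:~R)) ?prodr_const ?card_ord // => i _.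
  by rewrite !mxE coefXnM ltnNge leq_addl /= addnK.
have Vn0 : \det (Vandermonde n al) != 0.
  rewrite det_Vandermonde; apply/prodf_neq0 => i _; apply/prodf_neq0 => j ij.
  rewrite !mxE subr_eq0; apply: contraTneq ij => /inj ->; by rewrite ltnn.
exists (\det S); apply: (mulIf Vn0).
rewrite -det_map_mx -{1}dV -det_mulmx SV det_ublock dUL dDR; ring.
Qed.

End Resultant.

(** * Irreducibility of the form and of its dehomogenization *)

Section Homogenize.

Definition homog2 (d : nat) (g : {poly rat}) : {mpoly rat[2]} :=
  \sum_(k < d.+1) g`_k *: ('X_(0 : 'I_2) ^+ k * 'X_(1 : 'I_2) ^+ (d - k)).

Lemma hom_sum d (I : eqType) (r : seq I) (c : I -> rat) (e : I -> nat) :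
  (forall i, i \in r -> (e i <= d)%N) ->
  homog2 d (\sum_(i <- r) c i *: 'X^(e i)) =
  \sum_(i <- r) c i *: ('X_(0 : 'I_2) ^+ e i * 'X_(1 : 'I_2) ^+ (d - e i)).
Proof.
move=> he; rewrite /homog2.
under eq_bigr do rewrite coef_sum scaler_suml.
rewrite exchange_big /= !big_seq; apply: eq_bigr => i /he ei.
have ei' : (e i < d.+1)%N by [].
rewrite (bigD1 (Ordinal ei')) //= coefZ coefXn eqxx mulr1 big1 ?addr0 // => k.
rewrite -(inj_eq val_inj) /= => /negbTE kE.
by rewrite coefZ coefXn kE mulr0 scale0r.
Qed.

Lemma homM d e (g h : {poly rat}) : (size g <= d.+1)%N -> (size h <= e.+1)%N ->
  homog2 (d + e) (g * h) = homog2 d g * homog2 e h.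
Proof.
move=> sg sh.
have ex (p : {poly rat}) q : (size p <= q.+1)%N -> p = \sum_(k < q.+1) p`_k *: 'X^k.
  move=> sp; rewrite -poly_def; apply/polyP => i; rewrite coef_poly; case: ltnP => // l.
  by rewrite nth_default // (leq_trans sp).
pose c (ij : 'I_d.+1 * 'I_e.+1) := g`_ij.1 * h`_ij.2.
have -> : g * h = \sum_(ij <- index_enum _) c ij *: 'X^(ij.1 + ij.2)%N.
  rewrite {1}(ex g d sg) {1}(ex h e sh) big_distrlr /= pair_big /=.
  by apply: eq_bigr => -[i j] _ /=; rewrite -scalerAl -scalerAr scalerA -exprD.
rewrite hom_sum => [|[i j] _]; last by rewrite /= leq_add // -ltnS.
rewrite /homog2 big_distrlr /= pair_big /=; apply: eq_bigr => -[i j] _ /=.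
rewrite -scalerAl -scalerAr scalerA /c /=; congr (_ *: _).
have hi : (i <= d)%N by rewrite -ltnS. have hj : (j <= e)%N by rewrite -ltnS.
have -> : (d + e - (i + j) = (d - i) + (e - j))%N by move: hi hj; clear; lia.
by rewrite !exprD; ring.
Qed.

Lemma unit_hom d g : homog2 d g \is a GRing.unit -> d = 0%N.
Proof.
move=> /andP[/eqP E u0]; case: d E u0 => // d; set c := (_)@_0 => E u0.
have := congr1 (meval (fun=> 0)) E; rewrite mevalC /homog2 rmorph_sum /= big1 => [c0|k _].
  by move: u0; rewrite -c0 unitr0.
rewrite mevalZ mevalM !rmorphXn /= !mevalXU.
case: (posnP k) => [->|k0]; last by rewrite expr0n gtn_eqF // mul0r mulr0.
by rewrite subn0 expr0 mul1r expr0n mulr0.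
Qed.

Lemma irreducible_split n d e (f g h : {poly rat}) :
  irreducible_elt (homog2 n f) -> (d + e = n)%N -> (size g <= d.+1)%N -> (size h <= e.+1)%N ->
  f = g * h -> d = 0%N \/ e = 0%N.
Proof.
move=> [_ _ irr] de sg sh E.
have := irr (homog2 d g) (homog2 e h); rewrite -homM // de -E => /(_ erefl).
by case/orP => /unit_hom ->; [left | right].
Qed.

(** If the degree dropped, the second variable would divide the form; it is the polynomial [1]
    homogenized in degree 1. *)
Lemma irreducible_size n (f : {poly rat}) : (1 < n)%N -> irreducible_elt (homog2 n f) ->
  (size f <= n.+1)%N -> size f = n.+1.
Proof.
move=> n1 irr sf; apply/eqP; rewrite eqn_leq sf /= ltnNge; apply/negP => sn.
case: n n1 irr sf sn => // n n1 irr sf sn.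
have [//|n0] : 1%N = 0%N \/ n = 0%N; last by rewrite n0 in n1.
by apply: (irreducible_split (g := 1) irr (add1n n) _ sn); rewrite ?mul1r // size_poly1.
Qed.

Lemma irreducible_hom n (f : {poly rat}) : (1 < n)%N -> irreducible_elt (homog2 n f) ->
  (size f <= n.+1)%N -> irreducible_poly f.
Proof.
move=> n1 irr sf; have sE := irreducible_size n1 irr sf; split.
  by rewrite sE ltnS (ltnW n1).
move=> q sq /dvdpP [h fE].
have f0 : f != 0 by rewrite -size_poly_gt0 sE.
have h0 : h != 0 by apply: contraNneq f0 => h0; rewrite fE h0 mul0r.
have q0 : q != 0 by apply: contraNneq f0 => q0; rewrite fE q0 mulr0.
have hs : (0 < size h)%N by rewrite size_poly_gt0.
have qs : (0 < size q)%N by rewrite size_poly_gt0.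
have de : ((size h).-1 + (size q).-1 = n)%N.
  have := size_mul h0 q0; rewrite -fE sE; case: (size h) hs => // x _.
  by case: (size q) qs => // y _ /=; rewrite addnS => -[->].
have [e|e] := irreducible_split irr de (leqSpred _) (leqSpred _) fE.
  have /size_poly1P [c c0 hc] : size h == 1%N by rewrite -(prednK hs) e.
  by rewrite fE hc mul_polyC eqp_sym eqp_scale.
by move: sq; rewrite -(prednK qs) e.
Qed.

End Homogenize.

Section NormIntegral.
Variable R : realType.
Local Notation C := R[i].
Local Notation PC p := (map_poly (intr : int -> C) p).
Local Notation PQ p := (map_poly (intr : int -> rat) p).

Lemma map_PQ (p : {poly int}) : map_poly (ratr : rat -> C) (PQ p) = PC p.
Proof. by rewrite -map_poly_comp; apply: eq_map_poly => k /=; rewrite ratr_int. Qed.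

(** An integer resultant of modulus below 1 is zero, so [f] and [P] share a root, and irreducibility
    over the rationals makes [f] divide [P]. *)
Lemma irreducible_norm_integral n (f : {poly int}) (a alpha : 'I_n -> C) :
  size f = n.+1 -> irreducible_poly (PQ f) -> injective alpha ->
  (forall l, (PC f).[alpha l] = 0) -> (f`_n)%:~R = \prod_i a i ->
  norm_integral a alpha.
Proof.
move=> sf irr inj ra lead d P sP hP.
have [z hz] := resultant_integral (eq_leq sf) sP inj ra.
have z0 : z = 0.
  have : cn (z%:~R : C) < 1.
    rewrite hz cnM cnX lead !cn_prod -prodrXl -big_split /=; exact: hP.
  by rewrite cn_int -[1]/(1%:~R) ltr_int; move: (z) => t; lia.
have lead0 : (f`_n)%:~R != 0 :> C.
  have -> : f`_n = lead_coef f by rewrite lead_coefE sf.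
  by rewrite intr_eq0 lead_coef_eq0 -size_poly_gt0 sf.
have /prodf_eq0 [i _ /eqP Pi] : \prod_l (PC P).[alpha l] == 0.
  have /eqP := hz; rewrite z0 eq_sym mulf_eq0 expf_eq0 (negbTE lead0) andbF; exact.
have fP : PQ f %| PQ P.
  rewrite -[_ %| _]negbK -(irreducible_poly_coprime _ irr); apply/negP => /Bezout_eq1_coprimepP [[u v] /= B].
  have := congr1 (fun p => (map_poly (ratr : rat -> C) p).[alpha i]) B.
  rewrite rmorphD !rmorphM /= !map_PQ rmorph1 hornerD !hornerM ra Pi !mulr0 addr0 hornerC.
  by move=> /eqP; rewrite eq_sym oner_eq0.
move=> j; have /dvdpP [h hE] := fP.
by rewrite -map_PQ hE rmorphM /= map_PQ hornerM ra mulr0.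
Qed.

End NormIntegral.

(** * From the form to its linear factors *)

Section Transfer.
Variable R : realType.
Local Notation C := R[i].
Local Notation PC p := (map_poly (intr : int -> C) p).
Local Notation PQ p := (map_poly (intr : int -> rat) p).

Lemma mmap1_2 (S : comNzRingType) (h : 'I_2 -> S) m : mmap1 h m = h 0 ^+ m 0 * h 1 ^+ m 1.
Proof.
rewrite /mmap1 !big_ord_recl big_ord0 mulr1; congr (_ ^+ _ * _ ^+ _) => //.
by congr h; apply: val_inj.
by congr (m _); apply: val_inj.
Qed.

Lemma mmap_map_int (K S : comNzRingType) (g : {rmorphism K -> S}) (h : 'I_2 -> S)
    (F : {mpoly int[2]}) :
  mmap g h (map_mpoly (intr : int -> K) F) =
  \sum_(m <- msupp F) (F@_m)%:~R * (h 0 ^+ m 0 * h 1 ^+ m 1).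
Proof.
rewrite /map_mpoly {2}/mmap rmorph_sum /=; apply: eq_bigr => m _.
rewrite rmorphM /= mmapC mmap1_id mmapX mmap1_2; congr (_ * _); exact: rmorph_int.
Qed.

Lemma meval_int (F : {mpoly int[2]}) (x y : int) :
  F.@[tnth [tuple x; y]] = \sum_(m <- msupp F) F@_m * (x ^+ m 0 * y ^+ m 1).
Proof. by apply: eq_bigr => m _; rewrite mmap1_2. Qed.

Lemma dehomogenizeE (F : {mpoly int[2]}) :
  dehomogenize F = \sum_(m <- msupp F) F@_m *: 'X^(m 0).
Proof.
by apply: eq_bigr => m _; rewrite mmap1_2 /= expr1n mulr1 mul_polyC.
Qed.

Variables (n : nat) (F : {mpoly int[2]}) (a b : 'I_n -> C).
Hypothesis n3 : (3 <= n)%N.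
Hypothesis hF : irreducible_binary_form n F.
Hypothesis hab : map_mpoly (intr : int -> C) F
      = \prod_(i < n) (a i *: 'X_(0 : 'I_2) - b i *: 'X_(1 : 'I_2)).
Hypothesis d0 : forall i j, i != j -> dt a b i j != 0.

Let f := dehomogenize F.
Let alpha i := b i / a i.

Let supp_deg (m : 'X_{1..2}) : m \in msupp F -> (m 0%R + m 1%R = n)%N.
Proof.
have [/dhomogP h _] := hF; move=> /h <-.
rewrite [RHS](_ : _ = (\sum_i m i)%N); last exact: mdegE.
rewrite !big_ord_recl big_ord0 addn0; congr (_ + _)%N.
by congr (m _); apply: val_inj.
Qed.

Let F_hom : map_mpoly (intr : int -> rat) F = homog2 n (PQ f).
Proof.
rewrite /f dehomogenizeE rmorph_sum /=.
under eq_bigr do rewrite map_polyZ /= map_polyXn.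
rewrite hom_sum => [|m /supp_deg <-]; last exact: leq_addr.
rewrite [LHS]/map_mpoly /mmap !big_seq; apply: eq_bigr => m /supp_deg mE.
by rewrite mmap1_2 /= mul_mpolyC -mE addKn.
Qed.

Let sizeQ : size (PQ f) = size f.
Proof. by apply: size_map_inj_poly => //; apply: intr_inj. Qed.

Let size_f_le : (size f <= n.+1)%N.
Proof.
rewrite /f dehomogenizeE (leq_trans (size_sum _ _ _)) // big_seq.
apply/bigmax_leqP_seq => m; rewrite /= => _ /supp_deg mE.
by rewrite (leq_trans (size_scale_leq _ _)) // size_polyXn ltnS -mE leq_addr.
Qed.

Let irrQ : irreducible_elt (homog2 n (PQ f)).
Proof. by have [_] := hF; rewrite F_hom. Qed.

Let n1 : (1 < n)%N. Proof. exact: leq_trans n3. Qed.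

Lemma size_dehom : size f = n.+1.
Proof. by rewrite -sizeQ; apply: irreducible_size irrQ _; rewrite ?sizeQ. Qed.

Lemma dehom_factor : PC f = \prod_i (a i *: 'X - (b i)%:P).
Proof.
pose h : 'I_2 -> {poly C} := tnth [tuple 'X; 1].
have := congr1 (mmap (@polyC C) h) hab; rewrite mmap_map_int => E.
transitivity (mmap (@polyC C) h (\prod_(i < n) (a i *: 'X_(0 : 'I_2) - b i *: 'X_(1 : 'I_2)))).
  rewrite -E /f dehomogenizeE rmorph_sum /=; apply: eq_bigr => m _.
  by rewrite map_polyZ /= map_polyXn expr1n mulr1 -mul_polyC rmorph_int.
rewrite rmorph_prod /=; apply: eq_bigr => i _.
by rewrite rmorphB /= !mmapZ !mmapX !mmap1U /= mulr1 mul_polyC.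
Qed.

Lemma lead_dehom : (f`_n)%:~R = \prod_i a i.
Proof.
rewrite -[LHS](coef_map (intr : int -> C)) dehom_factor.
have h k (r : seq 'I_n) : size r = k ->
    (size (\prod_(i <- r) (a i *: 'X - (b i)%:P))%R <= k.+1)%N /\
    (\prod_(i <- r) (a i *: 'X - (b i)%:P))`_k = \prod_(i <- r) a i.
  elim: r k => [|i r IH] k /=; first by move=> <-; rewrite !big_nil size_poly1 coef1.
  move=> <-; have [s1 s2] := IH _ erefl; rewrite !big_cons; set Q := \prod_(j <- r) _ in s1 s2 *.
  have s3 : (size (a i *: 'X - (b i)%:P)%R <= 2)%N.
    rewrite (leq_trans (size_polyD _ _)) // size_polyN geq_max (leq_trans (size_scale_leq _ _)) ?size_polyX //=.
    by rewrite (leq_trans (size_polyC_leq1 _)).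
  split.
    rewrite (leq_trans (size_polyMleq _ _)) //; move: s1 s3; clear.
    by move: (size _) (size _) => x y; lia.
  rewrite mulrBl coefB -scalerAl coefZ coefXM /= mul_polyC coefZ s2.
  by rewrite [Q`__]nth_default ?mulr0 ?subr0.
have e : size (index_enum 'I_n) = n.
  by rewrite -[RHS](card_ord n) -sum1_card -[LHS]sum1_size; apply: eq_bigl.
by have [_] := h n _ e.
Qed.

Lemma a_neq0 i : a i != 0.
Proof.
have : (f`_n)%:~R != 0 :> C.
  have -> : f`_n = lead_coef f by rewrite lead_coefE size_dehom.
  by rewrite intr_eq0 lead_coef_eq0 -size_poly_gt0 size_dehom.
by rewrite lead_dehom => /prodf_neq0; apply.
Qed.

Lemma root_dehom z : root (PC f) z = [exists i, z == alpha i].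
Proof.
rewrite /root dehom_factor horner_prod; apply/prodf_eq0/existsP => [[i _]|[i /eqP ->]].
  rewrite !hornerE subr_eq0 => /eqP e; exists i; apply/eqP.
  by rewrite /alpha -e mulrC mulKf // a_neq0.
exists i => //; rewrite hornerD hornerN hornerZ hornerX hornerC /alpha.
by rewrite [a i * _]mulrC divfK ?a_neq0 // subrr.
Qed.

Let alphaI : injective alpha := alpha_inj a_neq0 d0.

Let conj_root i : root (PC f) ((alpha i)^*)%C.
Proof.
have r : root (PC f) (alpha i) by rewrite root_dehom; apply/existsP; exists i.
have -> : PC f = map_poly (@conjc R) (PC f).
  by rewrite -map_poly_comp; apply: eq_map_poly => k /=; rewrite rmorph_int.
by rewrite fmorph_root.
Qed.

(** The default is never reached: the coefficients are real, so the conjugate of a root is a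
    root. *)
Definition conj_index (i : 'I_n) : 'I_n := odflt i [pick j | (alpha i)^*%C == alpha j].

Lemma conj_indexE i : alpha (conj_index i) = ((alpha i)^*)%C.
Proof.
rewrite /conj_index; case: pickP => [j /eqP <- //|h].
by have := conj_root i; rewrite root_dehom => /existsP[j]; rewrite h.
Qed.

Lemma form_data_dehom : form_data a b conj_index.
Proof.
have cE := conj_indexE; split => //.
- exact: a_neq0.
- apply: (irreducible_norm_integral (f := f)) => //.
  + exact: size_dehom.
  + by apply: irreducible_hom irrQ _; rewrite ?sizeQ.
  + by move=> l; apply/eqP; rewrite -/(root _ _) root_dehom; apply/existsP; exists l.
  + exact: lead_dehom.
- by move=> i; apply: alphaI; rewrite !cE conjcK.
Qed.

Lemma nonreal_card q : nonreal_roots R f #= `I_(2 * q)%N -> q = npair conj_index.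
Proof.
have [_ _ _ cc _] := form_data_dehom; have nE := card_c cc.
pose P := [pred i | conj_index i != i].
have cP : #|P| = (2 * npair conj_index)%N.
  have := cardC [pred i | conj_index i == i]; rewrite card_ord -/(nreal conj_index).
  rewrite (_ : #|[predC _]| = #|P|); last by apply: eq_card => i; rewrite !inE.
  by move: nE; clear; move: #|P| => t; lia.
pose s := [seq alpha i | i <- enum P].
have us : uniq s by rewrite map_inj_uniq ?enum_uniq.
have sE : nonreal_roots R f = [set` [fset x in s]%fset].
  apply/seteqP; split => [z /= [rz nz]|z /=].
    move: rz; rewrite root_dehom => /existsP[i /eqP zE]; rewrite inE /=.
    apply/mapP; exists i; rewrite // mem_enum inE; apply: contraNneq nz => ci.
    rewrite CrealE zE; apply/eqP; have := conj_indexE i; by rewrite ci.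
  move=> zs; have /mapP [i iP ->] : z \in s by move: zs; rewrite inE.
  have ci : conj_index i != i by move: iP; rewrite mem_enum inE.
  split.
    by rewrite root_dehom; apply/existsP; exists i.
  apply: contra ci => /CrealP h; apply/eqP; apply: alphaI; rewrite conj_indexE; exact: h.
rewrite sE => /card_eq_fsetP; rewrite card_fseq undup_id // size_map -cardE cP.
by clear; lia.
Qed.

Lemma eval_lf v : (F.@[tnth [tuple v.1; v.2]])%:~R = \prod_i lf a b v i.
Proof.
pose h : 'I_2 -> C := tnth [tuple v.1%:~R; v.2%:~R].
have := congr1 (meval h) hab; rewrite [X in X = _](mmap_map_int idfun) => E.
transitivity (meval h (\prod_(i < n) (a i *: 'X_(0 : 'I_2) - b i *: 'X_(1 : 'I_2)))).
  rewrite -E meval_int rmorph_sum /=; apply: eq_bigr => m _.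
  by rewrite !rmorphM !rmorphXn.
rewrite rmorph_prod /=; apply: eq_bigr => i _.
by rewrite rmorphB /= !mevalZ !mevalXU.
Qed.

End Transfer.

(** * Solutions up to sign *)

Section Classes.
Variable R : realType.
Local Notation C := R[i].

(** A bound on all duplicate-free sequences also rules out infinite sets, which contain arbitrarily
    long ones. *)
Lemma card_at_most_seq (T : choiceType) (A : set T) (B : R) :
  (forall s : seq T, uniq s -> (forall x, x \in s -> A x) -> (size s)%:R <= B) ->
  card_at_most A B.
Proof.
move=> h; have [fA|iA] := pselect (finite_set A).
  have [k Ak] := (finite_setP A).1 fA; exists k => //.
  have kE := card_fset_set Ak; rewrite -kE; apply: h => [|x]; first exact: fset_uniq.
  by rewrite in_fset_set // inE.
have B0 : 0 <= B by apply: (h [::]).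
have [X XA] := infinite_set_fset (Num.truncn B).+1 iA; rewrite -(ler_nat R) => hX.
have := h X (fset_uniq X) (fun x xX => XA x xX).
move=> /(le_trans hX); have := truncnS_gt B; lra.
Qed.

(** Bezout coefficients of [v] make the ratio [la] of the proportional vectors an integer, and those
    of [w] make it a unit. *)
Lemma primitive_cross0 v w : gcdz v.1 v.2 = 1 -> gcdz w.1 w.2 = 1 -> cross v w = 0 ->
  w = v \/ w = (- v.1, - v.2).
Proof.
case: v w => v1 v2 [w1 w2]; rewrite /cross /= => gv gw /eqP; rewrite subr_eq0 => /eqP cr.
have /coprimezP [[s t] /= st] : coprimez v1 v2 by rewrite /coprimez gv.
have /coprimezP [[s' t'] /= st'] : coprimez w1 w2 by rewrite /coprimez gw.
pose la := s * w1 + t * w2.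
have e1 : w1 = la * v1.
  rewrite -{1}[w1]mulr1 -st /la (_ : (s * w1 + t * w2) * v1 = s * w1 * v1 + t * (v1 * w2)); last by ring.
  by rewrite cr; ring.
have e2 : w2 = la * v2.
  rewrite -{1}[w2]mulr1 -st /la (_ : (s * w1 + t * w2) * v2 = s * (v2 * w1) + t * (w2 * v2)); last by ring.
  by rewrite -cr; ring.
have : (la %| 1)%Z.
  have h1 : 1 = (s' * v1 + t' * v2) * la by rewrite -[LHS]st' {1}e1 {1}e2; ring.
  by apply/dvdzP; exists (s' * v1 + t' * v2).
rewrite dvdz1 => h; have [l1|l1] : la = 1 \/ la = -1 by move: h; clear; lia.
  by left; rewrite e1 e2 l1 !mul1r.
by right; rewrite e1 e2 l1 !mulN1r.
Qed.

Definition positive_rep (v : int * int) : bool := (0 < v.1) || (v.1 == 0) && (0 < v.2).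

Lemma classes_at_most (F : {mpoly int[2]}) (m : int) (B : R) :
  (forall v, primitive_solutions F m v -> primitive_solutions F m (- v.1, - v.2)) ->
  (forall s : seq (int * int), uniq s -> (forall v, v \in s -> primitive_solutions F m v) ->
     (forall v w, v \in s -> w \in s -> v != w -> cross v w != 0) -> (size s)%:R <= B) ->
  card_at_most (solution_classes F m) B.
Proof.
move=> symm h.
pose E := [set v | primitive_solutions F m v /\ positive_rep v].
pose g (v : int * int) : set (int * int) := [set v; (- v.1, - v.2)].
have canon v w : positive_rep v -> positive_rep w -> w = v \/ w = (- v.1, - v.2) -> w = v.
  move=> hv hw [//|e]; exfalso; move: hv hw; rewrite e /positive_rep /=; clear; lia.
have cE : solution_classes F m = g @` E.
  apply/seteqP; split => [_ [v sv <-]|_ [v [sv _] <-]]; last by exists v.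
  have [pv|nv] := boolP (positive_rep v); first by exists v.
  exists (- v.1, - v.2); last by rewrite /g /= !opprK -surjective_pairing; apply: setUC.
  split; first exact: symm.
  have [_ gv] := sv; move: nv gv; rewrite /positive_rep /=; case: (v) => x y /=.
  have [-> |x0] := eqVneq x 0; last by clear -x0; lia.
  have [-> |y0] := eqVneq y 0; first by rewrite gcdz0.
  by clear -y0; lia.
have gi : {in E &, injective g}.
  move=> v w /set_mem [_ pv] /set_mem [_ pw] e.
  have : g v w by rewrite e; left.
  by move=> h'; apply/esym; apply: (canon v w pv pw); case: h' => ->; [left|right].
have [k Ek kB] : card_at_most E B.
  apply: card_at_most_seq => s us sE; apply: h => // [v /sE [] //|v w vs ws vw].
  apply: contraNneq vw => c0.
  have [[_ gv] pv] := sE v vs; have [[_ gw] pw] := sE w ws.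
  by rewrite (canon v w pv pw (primitive_cross0 gv gw c0)).
exists k => //; rewrite cE; apply: card_eq_trans Ek; exact: inj_card_eq gi.
Qed.

End Classes.

(** * From the hypothesis on [m] to the final count *)

Section Assembly.
Variable R : realType.
Local Notation C := R[i].

Lemma ln_hyp (n : nat) (D m : int) (eps : R) : (3 <= n)%N -> 0 < m ->
  eps < 1 / (2 * (n%:R - 1)) ->
  m%:~R <= `|D|%:~R `^ (1 / (2 * (n%:R - 1)) - eps)
                   / ((35 / 10) `^ (n%:R / 2) * n%:R `^ (n%:R / (2 * (n%:R - 1)))) ->
  D != 0 /\ ln (m%:~R : R) <= (1 / (2 * (n%:R - 1)) - eps) * ln (`|D|%:~R : R)
    - n%:R / 2 * ln (7 / 2) - n%:R / (2 * (n%:R - 1)) * ln n%:R.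
Proof.
move=> n3 m0 he hm.
have mR : 0 < m%:~R :> R by rewrite ltr0z.
have e0 : 0 < 1 / (2 * (n%:R - 1)) - eps by rewrite subr_gt0.
(* The exponent is positive, so [D = 0] would make the bound on [m] zero. This is the source of the
   distinctness of the roots. *)
have D0 : D != 0.
  apply/eqP => D0; move: hm; rewrite D0 normr0 powR0 ?gt_eqF // mul0r.
  by move=> /(lt_le_trans mR); rewrite ltxx.
split => //.
have DR : 0 < `|D|%:~R :> R by rewrite ltr0z normr_gt0.
have nR : 0 < n%:R :> R by rewrite ltr0n (leq_trans _ n3).
have h35 : 0 < 35 / 10 :> R by lra.
have p1 := powR_gt0 (1 / (2 * (n%:R - 1)) - eps) DR.
have p2 := powR_gt0 (n%:R / 2) h35.
have p3 := powR_gt0 (n%:R / (2 * (n%:R - 1))) nR.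
have := le_ln mR hm; rewrite lnDiv ?mulr_gt0 // lnMp // !ln_powR.
have -> : 35 / 10 = 7 / 2 :> R by lra.
by rewrite opprD addrA.
Qed.

Lemma lnD_disc n (a b : 'I_n -> C) (D : int) : (forall i j, i != j -> dt a b i j != 0) ->
  D%:~R = \prod_(i < n) \prod_(j < n | (i < j)%N) (a i * b j - a j * b i) ^+ 2 ->
  lnD a b = ln (`|D|%:~R : R).
Proof.
move=> d0 hD; rewrite /lnD sum_offdiag_sym; last by move=> i j; rewrite dt_anti cnN.
have := congr1 (@cn R) hD; rewrite cn_int cn_prod => ->.
have d (i j : 'I_n) : (i < j)%N -> 0 < cn (dt a b i j).
  by move=> ij; rewrite cn_gt0 d0 // -(inj_eq val_inj) /= ltn_eqF.
rewrite ln_prod; last first.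
  move=> i _; rewrite cn_prod; apply: prodr_gt0 => j ij; rewrite cnX exprn_gt0 //; exact: d.
rewrite mulr_sumr; apply: eq_bigr => i _; rewrite cn_prod ln_prod; last first.
  by move=> j ij; rewrite cnX exprn_gt0 //; exact: d.
rewrite mulr_sumr; apply: eq_bigr => j ij; rewrite cnX lnX //; exact: d.
Qed.

Lemma cubic_coefs (f : {poly int}) (a b : 'I_3 -> C) :
  map_poly (intr : int -> C) f = \prod_i (a i *: 'X - (b i)%:P) ->
  [/\ (f`_3)%:~R = a o0 * a o1 * a o2,
      (f`_2)%:~R = - (b o0 * a o1 * a o2 + a o0 * b o1 * a o2 + a o0 * a o1 * b o2),
      (f`_1)%:~R = b o0 * b o1 * a o2 + b o0 * a o1 * b o2 + a o0 * b o1 * b o2 &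
      (f`_0)%:~R = - (b o0 * b o1 * b o2)].
Proof.
move=> E; set A := a o0 * _ * _; set B := - _; set G := _ + _ + _; set H := - _.
have {}E : map_poly (intr : int -> C) f = A%:P * 'X^3 + B%:P * 'X^2 + G%:P * 'X + H%:P.
  rewrite E !big_ord_recl big_ord0 mulr1.
  have -> : lift ord0 ord0 = o1 :> 'I_3 by apply: val_inj.
  have -> : lift ord0 (lift ord0 ord0) = o2 :> 'I_3 by apply: val_inj.
  have -> : ord0 = o0 :> 'I_3 by apply: val_inj.
  by rewrite /A /B /G /H -!mul_polyC !(polyCD, polyCN, polyCM); ring.
have co k : (f`_k)%:~R = (A%:P * 'X^3 + B%:P * 'X^2 + G%:P * 'X + H%:P)`_k.
  by rewrite -E coef_map.
by split; rewrite co !(coefD, coefCM, coefXn, coefX, coefC) /= ?mulr1 ?mulr0 ?addr0 ?add0r.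
Qed.

Definition rate (n : nat) : nat := if (n <= 4)%N then 9 else 7.

Lemma solution_count (n : nat) (F : {mpoly int[2]}) (D : int) (eps : R) (m : int) :
  (3 <= n)%N -> irreducible_binary_form n F -> is_discriminant R n F D ->
  0 < eps -> eps < 1 / (2 * (n%:R - 1)) -> 0 < m ->
  m%:~R <= `|D|%:~R `^ (1 / (2 * (n%:R - 1)) - eps)
                   / ((35 / 10) `^ (n%:R / 2) * n%:R `^ (n%:R / (2 * (n%:R - 1)))) ->
  exists q0 : nat, [/\ (2 * q0 <= n)%N,
    forall q, nonreal_roots R (dehomogenize F) #= `I_(2 * q)%N -> q = q0 &
    card_at_most (solution_classes F m)
      ((rate n)%:R * (n%:R - 2 * q0%:R) + 2 * q0%:R + (n%:R - q0%:R) / ((n%:R - 1) * eps) : R)].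
Proof.
move=> n3 hF [a [b [hab hD]]] eps0 eps1 m0 hm.
have [D0 lm] := ln_hyp n3 m0 eps1 hm.
have d0' (i j : 'I_n) : (i < j)%N -> dt a b i j != 0.
  move=> ij; have : (D%:~R : C) != 0 by rewrite intr_eq0.
  by rewrite hD => /prodf_neq0 /(_ i isT) /prodf_neq0 /(_ j ij); rewrite expf_eq0.
have d0 i j : i != j -> dt a b i j != 0.
  rewrite -(inj_eq val_inj) /= neq_ltn => /orP[|ji]; first exact: d0'.
  by rewrite dt_anti oppr_eq0 d0'.
have fd := form_data_dehom n3 hF hab d0.
pose c := conj_index a b.
have cc := fd_cc fd; have nE := card_c cc; rewrite -/c in nE.
have LE := lnD_disc d0 hD; rewrite -LE in lm.
have n3R : 3 <= n%:R :> R by rewrite ler_nat.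
have nu : 0 < n%:R - 1 :> R by lra.
pose e := 2 * (n%:R - 1) * eps.
have e0 : 0 < e by rewrite !mulr_gt0.
have e1 : e < 1 by move: eps1; rewrite ltr_pdivlMr ?mulr_gt0 // mulrC.
have m1 : 1 <= m%:~R :> R by rewrite ler1z; move: m0; clear; lia.
have hsol v : primitive_solutions F m v -> sol a b m%:~R v.
  move=> [Fv gv]; split; first by rewrite /coprimez gv.
  by rewrite -cn_prod -(eval_lf hab) cn_int Fv.
have eps_e : (1 / (2 * (n%:R - 1)) - eps) = (1 - e) / (2 * (n%:R - 1)).
  by rewrite /e; field; rewrite gt_eqF.
exists (npair c); split.
- by have := leq_addl (nreal c) (2 * npair c)%N; rewrite nE.
- by move=> q; apply: (nonreal_card n3 hF hab d0).
apply: classes_at_most.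
  move=> v [Fv gv]; split; last by rewrite /= gcdzN gcdNz.
  rewrite -Fv; apply: (@intr_inj R); rewrite -!(@cn_int R) !(eval_lf hab) !cn_prod.
  apply: eq_bigr => i _; rewrite -[RHS]cnN; congr cn.
  by rewrite /lf /= !rmorphN /=; ring.
move=> S uS hS crS.
have hS' v : v \in S -> sol a b m%:~R v by move=> /hS; apply: hsol.
have key : (size S)%:R <= (rate n * nreal c + 2 * npair c)%:R + 2 * (nreal c + npair c)%:R / e.
  case: (ltnP 3 n) => n4.
    have -> : rate n = (big_bound n).+1.
      by rewrite /rate /big_bound; case: (ltngtP n 4) n4.
    apply: (count_ge4 n4 fd m1 e0 e1 _ uS crS hS').
    rewrite eps_e in lm; apply: le_trans lm _; rewrite /ell.
    have ln0 : 0 <= ln (n%:R : R) by apply: ln_ge0; lra.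
    have nl : 0 <= n%:R * ln (n%:R : R) by rewrite mulr_ge0 ?ler0n.
    (* The hypothesis on [m] subtracts the whole term in [n ln n], while [(1 - e) * ell a b]
       contains only the part [1 - e] of it; this is the difference. *)
    have iv : 0 <= e * (n%:R * ln (n%:R : R)) / (2 * (n%:R - 1)) by rewrite divr_ge0 ?mulr_ge0 // ltW.
    move: iv; set L := lnD a b; set l := ln (n%:R : R); set W := _ * ln (7 / 2).
    have -> : (1 - e) * ((L - n%:R * l) / (2 * (n%:R - 1))) =
      (1 - e) / (2 * (n%:R - 1)) * L - n%:R / (2 * (n%:R - 1)) * l
      + e * (n%:R * l) / (2 * (n%:R - 1)) by ring.
    by clear; lra.
  have n3e : n = 3%N by apply/eqP; rewrite eqn_leq n4.
  subst n; have [hA hB hE hFc] := cubic_coefs (dehom_factor hab).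
  apply: (count3 fd hA hB hE hFc m1 e0 e1 _ uS crS hS').
  have x4 : 2 * (3%:R - 1) = 4 :> R by lra.
  by rewrite -(lnD3 fd); move: lm; rewrite eps_e x4; lra.
apply: le_trans key _.
have nER : n%:R = (nreal c)%:R + 2 * (npair c)%:R :> R by rewrite -natrM -natrD nE.
have B0 : 0 < (n%:R - 1) * eps by rewrite mulr_gt0.
have -> : 2 * (nreal c + npair c)%:R / e = (n%:R - (npair c)%:R) / ((n%:R - 1) * eps).
  have -> : e = 2 * ((n%:R - 1) * eps) by rewrite /e mulrA.
  rewrite natrD (_ : n%:R - (npair c)%:R = (nreal c)%:R + (npair c)%:R); last by rewrite nER; ring.
  by move: ((n%:R - 1) * eps) B0 => B B0; field; rewrite gt_eqF.
rewrite lerD2r natrD !natrM (_ : n%:R - 2 * (npair c)%:R = (nreal c)%:R) //.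
by rewrite nER; ring.
Qed.

End Assembly.

Theorem theorem1p2 (R : realType) (n : nat) (F : {mpoly int[2]}) (D : int)
    (eps : R) (m : int)
    (hn : (3 <= n)%N)
    (hF : irreducible_binary_form n F)
    (hD : is_discriminant R n F D)
    (heps0 : 0 < eps)
    (heps1 : eps < 1 / (2 * (n%:R - 1)))
    (hm0 : 0 < m)
    (hm : m%:~R <= `|D|%:~R `^ (1 / (2 * (n%:R - 1)) - eps)
                   / ((35 / 10) `^ (n%:R / 2)
                      * n%:R `^ (n%:R / (2 * (n%:R - 1))))) :
  [/\ (5 <= n)%N ->
        card_at_most (solution_classes F m)
          (7 * n%:R + n%:R / ((n%:R - 1) * eps)),
      n = 3%N \/ n = 4%N ->
        card_at_most (solution_classes F m)
          (9 * n%:R + n%:R / ((n%:R - 1) * eps)) &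
      forall q : nat, nonreal_roots R (dehomogenize F) #= `I_(2 * q)%N ->
        ((5 <= n)%N ->
           card_at_most (solution_classes F m)
             (7 * n%:R - 12 * q%:R + (n%:R - q%:R) / ((n%:R - 1) * eps))) /\
        (n = 3%N \/ n = 4%N ->
           card_at_most (solution_classes F m)
             (9 * n%:R - 16 * q%:R + (n%:R - q%:R) / ((n%:R - 1) * eps)))].
Proof.
have [q0 [q0n uq [k hk kB]]] := solution_count hn hF hD heps0 heps1 hm0 hm.
have n3R : 3 <= n%:R :> R by rewrite ler_nat.
have B0 : 0 < (n%:R - 1) * eps by rewrite mulr_gt0 //; lra.
have q0R : 0 <= q0%:R :> R by rewrite ler0n.
have qB : 0 <= q0%:R / ((n%:R - 1) * eps) by rewrite divr_ge0 // ltW.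
rewrite mulrBl in kB.
have r5 : (5 <= n)%N -> rate n = 7%N by rewrite /rate ltnNge => /negbTE ->.
have r4 : n = 3%N \/ n = 4%N -> rate n = 9%N by case=> ->.
split.
- by move=> /r5 r; exists k => //; move: kB; rewrite r; lra.
- by move=> /r4 r; exists k => //; move: kB; rewrite r; lra.
move=> q /uq ->; rewrite mulrBl; split.
- by move=> /r5 r; exists k => //; move: kB; rewrite r; lra.
- by move=> /r4 r; exists k => //; move: kB; rewrite r; lra.
Qed.
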